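(* Let $p$ be a prime, $F$ a totally real number field, and $K/F$ a finite abelian extension with $K$ a CM field. Let $(z_E)_{E\subset K}$, with $z_E\in R_E$, be a norm compatible family indexed by the CM fields $E$ with $F\subset E\subset K$. Suppose that for each finite abelian extension $K'/F$ with $K'$ CM such that $K'\supset K$ and $\Sigma(K')=\Sigma(K)$, the family $(z_E)_{E\subset K}$ can be extended to a norm compatible family $(z'_E)_{E\subset K'}$ with $z'_E\in R_E$. Then there exists a lift $\tilde z_K$ of $z_K$ to $\mathbf{Z}_p[G_K]_-$ such that $$e_E\,\mathrm{red}_{K/E}(\tilde z_K)=z_E\quad\text{in }R_E$$ for all CM fields $E$ with $F\subset E\subset K$.
   Context: For a finite abelian CM extension $E/F$: $G_E=\mathrm{Gal}(E/F)$, $c\in G_E$ is the complex conjugation, $\mathbf{Z}_p[G_E]_-=\mathbf{Z}_p[G_E]/(c+1)$ and $\mathbf{Q}_p[G_E]_-=\mathbf{Q}_p[G_E]/(c+1)$. $\Sigma(E)$ is the set consisting of all infinite places of $F$ and all primes $v\mid p$ of $F$ that are ramified in $E$. For a place $v$ of $F$, $G_{E,v}\subset G_E$ is the decomposition group at $v$, $\mathrm{N}G_{E,v}=\sum_{\sigma\in G_{E,v}}\sigma$, and $$e_E=\prod_{v\in\Sigma(E)}\left(1-\mathrm{N}G_{E,v}/\#G_{E,v}\right),$$ an idempotent. $R_E=e_E\cdot\mathbf{Z}_p[G_E]_-\subset\mathbf{Q}_p[G_E]_-$, a quotient of $\mathbf{Z}_p[G_E]_-$ via $x\mapsto e_Ex$;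 a lift of $z\in R_E$ to $\mathbf{Z}_p[G_E]_-$ is a preimage under this map. For $E\subset E'$, $\mathrm{red}_{E'/E}\colon\mathbf{Z}_p[G_{E'}]_-\to\mathbf{Z}_p[G_E]_-$ is the canonical reduction, and $$P(E'/E)=\prod_{v\in\Sigma(E')-\Sigma(E)}(1-\sigma_v^{-1})\in\mathbf{Z}_p[G_E]_-,$$ where $\sigma_v\in G_E$ is the Frobenius at $v$. A family $(z_E)_{E\subset K}$ with $z_E\in R_E$, indexed by the CM fields $E$ with $F\subset E\subset K$, is *norm compatible* if for every pair of CM fields $E',E$ with $F\subset E\subset E'\subset K$, $$\left(e_E\,\mathrm{red}_{E'/E}(\tilde z_{E'})-z_E\right)P(E'/E)=0\quad\text{in }R_E,$$ where $\tilde z_{E'}$ is any lift of $z_{E'}$ to $\mathbf{Z}_p[G_{E'}]_-$ (the condition does not depend on the lift). For a CM abelian extension $K'/F$ with $K'\supset K$, the family $(z_E)_{E\subset K}$ *can be extended to* $K'$ if there is a norm compatible family $(z'_E)_{E\subset K'}$ with $z'_E\in R_E$ and $z'_E=z_E$ for all $E\subset K$. *)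

(* Defs.v *)
(* MathComp, with the classical axioms of mathcomp.classical. *)
From HB Require Import structures.
From mathcomp Require Import all_boot all_order all_algebra.
From mathcomp Require Import all_fingroup all_solvable all_field.
From mathcomp Require Import generic_quotient.
From mathcomp Require Import finmap.
From mathcomp Require Import boolp classical_sets functions cardinality fsbigop.

Set Implicit Arguments.
Unset Strict Implicit.
Unset Printing Implicit Defensive.

Import Order.TTheory GRing.Theory Num.Theory.

Local Open Scope ring_scope.
Local Open Scope quotient_scope.

(* Z_p as the inverse limit of the Z/p^n: x n is the representative in
   [0, p^n[ of the image of x in Z/p^n.  The primality proof is a phantom
   argument of the type, needed by the ring structure. *)
Section PadicIntegers.
Variable p : nat.

Definition padic_coherent : pred (nat -> int) :=
  fun x => `[< forall n, (x n.+1 %% (p ^ n)%:Z)%Z = x n >].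

Record padic_seq := PadicSeq {
  padic_val :> nat -> int;
  _ : padic_coherent padic_val }.

HB.instance Definition _ := [isSub for padic_val].
HB.instance Definition _ := [Choice of padic_seq by <:].

Definition padic_int of prime p : Type := padic_seq.

Variable p_pr : prime p.
Local Notation Zp := (padic_int p_pr).

HB.instance Definition _ := SubType.copy Zp padic_seq.
HB.instance Definition _ := Choice.copy Zp padic_seq.

Implicit Types x y z : Zp.

Let pX n : int := (p ^ n)%:Z.

Let modz_modX k m n : (m <= n)%N -> ((k %% pX n)%Z = k %[mod pX m])%Z.
Proof.
move=> lemn; apply/eqP; rewrite eqz_mod_dvd {2}(divz_eq k (pX n)).
rewrite opprD addrCA subrr addr0 rpredN dvdz_mull //.
by rewrite dvdzE /= dvdn_exp2l.
Qed.

Lemma padicP x n : (x n.+1 %% pX n)%Z = x n.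
Proof. by case: x => x /= /asboolP. Qed.

Lemma padic_mod x m n : (m <= n)%N -> (x n %% pX m)%Z = x m.
Proof.
move=> /subnK <-; elim: (n - m)%N => [|k IHk]; first by rewrite -padicP modz_mod.
by rewrite -IHk -(padicP x (k + m)) modz_modX // leq_addl.
Qed.

Lemma eq_padic x y : (forall n, x n = y n) -> x = y.
Proof. by move=> exy; apply: val_inj; apply: funext. Qed.

Fact padic_of_subproof (u : nat -> int) :
  (forall n, (u n.+1 = u n %[mod pX n])%Z) ->
  padic_coherent (fun n => (u n %% pX n)%Z).
Proof.
by move=> Hu; apply/asboolP => n; rewrite modz_modX ?Hu.
Qed.

Definition padic_of u Hu : Zp := PadicSeq (@padic_of_subproof u Hu).

Fact padic_add_subproof x y n :
  ((x n.+1 + y n.+1)%R = (x n + y n)%R %[mod pX n])%Z.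
Proof. by rewrite -modzDm !padicP. Qed.
Fact padic_mul_subproof x y n :
  ((x n.+1 * y n.+1)%R = (x n * y n)%R %[mod pX n])%Z.
Proof. by rewrite -modzMm !padicP. Qed.
Fact padic_opp_subproof x n : ((- x n.+1)%R = (- x n)%R %[mod pX n])%Z.
Proof. by rewrite -modzNm padicP. Qed.
Fact padic_cst_subproof (k : int) n : (k = k %[mod pX n])%Z.
Proof. by []. Qed.

Definition padic_cst k : Zp :=
  @padic_of (fun=> k) (padic_cst_subproof k).
Definition padic_add x y : Zp :=
  @padic_of (fun n => x n + y n) (padic_add_subproof x y).
Definition padic_mul x y : Zp :=
  @padic_of (fun n => x n * y n) (padic_mul_subproof x y).
Definition padic_opp x : Zp :=
  @padic_of (fun n => - x n) (padic_opp_subproof x).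

Fact padic_addA : associative padic_add.
Proof. by move=> x y z; apply: eq_padic => n /=; rewrite modzDmr modzDml addrA. Qed.
Fact padic_addC : commutative padic_add.
Proof. by move=> x y; apply: eq_padic => n /=; rewrite addrC. Qed.
Fact padic_add0 : left_id (padic_cst 0) padic_add.
Proof. by move=> x; apply: eq_padic => n /=; rewrite modzDml add0r padic_mod. Qed.
Fact padic_addN : left_inverse (padic_cst 0) padic_opp padic_add.
Proof. by move=> x; apply: eq_padic => n /=; rewrite modzDml addNr. Qed.

HB.instance Definition _ :=
  GRing.isZmodule.Build Zp padic_addA padic_addC padic_add0 padic_addN.

Fact padic_mulA : associative padic_mul.
Proof. by move=> x y z; apply: eq_padic => n /=; rewrite modzMmr modzMml mulrA. Qed.
Fact padic_mulC : commutative padic_mul.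
Proof. by move=> x y; apply: eq_padic => n /=; rewrite mulrC. Qed.
Fact padic_mul1 : left_id (padic_cst 1) padic_mul.
Proof. by move=> x; apply: eq_padic => n /=; rewrite modzMml mul1r padic_mod. Qed.
Fact padic_mulD : left_distributive padic_mul padic_add.
Proof.
by move=> x y z; apply: eq_padic => n /=; rewrite modzMml modzDm mulrDl.
Qed.
Fact padic_1neq0 : padic_cst 1 != 0.
Proof.
apply/eqP => /(congr1 (fun x : Zp => x 1%N)) /=.
by rewrite /pX expn1 mod0z modz_small // ltz_nat prime_gt1.
Qed.

HB.instance Definition _ := GRing.Zmodule_isComNzRing.Build Zp
  padic_mulA padic_mulC padic_mul1 padic_mulD padic_1neq0.

Definition padic_unit : pred Zp := fun x => `[< exists y, y * x = 1 >].
Definition padic_inv x : Zp :=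
  if pselect (exists y, y * x = 1) is left ex then projT1 (cid ex) else x.

Fact padic_mulV : {in padic_unit, left_inverse 1 padic_inv *%R}.
Proof.
move=> x /asboolP ux; rewrite /padic_inv.
by case: pselect => // ex; case: cid.
Qed.
Fact padic_unitP x y : y * x = 1 -> x \in padic_unit.
Proof. by move=> yx1; apply/asboolP; exists y. Qed.
Fact padic_invout : {in [predC padic_unit], padic_inv =1 id}.
Proof.
move=> x; rewrite inE /= => /negP nux; rewrite /padic_inv.
by case: pselect => // ex; case: nux; apply/asboolP.
Qed.

HB.instance Definition _ := GRing.ComNzRing_hasMulInverse.Build Zp
  padic_mulV padic_unitP padic_invout.

Lemma padic_neq0 x : x != 0 -> exists n, ~~ (pX n %| x n)%Z.
Proof.
apply: contraNP => /forallNP x0; apply/eqP/eq_padic => n.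
move: (x0 n) => /negP; rewrite negbK => /dvdz_mod0P xn0.
by rewrite -(padic_mod x (leqnn n)) [LHS]xn0 [RHS]mod0z.
Qed.

Fact padic_integral : GRing.integral_domain_axiom Zp.
Proof.
move=> x y xy0; apply/norP => -[/padic_neq0[m xm] /padic_neq0[n yn]].
have xE : ~~ (pX m %| x (m + n)%N)%Z.
  apply: contra xm => /dvdz_mod0P d.
  by rewrite -(padic_mod x (leq_addr n m)) d dvdz0.
have yE : ~~ (pX n %| y (m + n)%N)%Z.
  apply: contra yn => /dvdz_mod0P d.
  by rewrite -(padic_mod y (leq_addl m n)) d dvdz0.
have : (pX (m + n) %| x (m + n)%N * y (m + n)%N)%Z.
  apply/dvdz_mod0P; rewrite -[RHS](mod0z (pX (m + n))).
  exact: (congr1 (fun z : Zp => z (m + n)%N) xy0).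
move: xE yE; rewrite !dvdzE abszM /=; move: `|x _|%N `|y _|%N => a b.
have [-> | a0] := posnP a; first by rewrite dvdn0.
have [-> | b0] := posnP b; first by rewrite dvdn0.
rewrite !pfactor_dvdn ?muln_gt0 ?a0 // lognM // -!ltnNge => la lb.
by rewrite leqNgt => /negP[]; rewrite -addSn leq_add // ltnW.
Qed.

HB.instance Definition _ := GRing.ComUnitRing_isIntegral.Build Zp padic_integral.

Definition padic_num : Type := {fraction Zp}.
HB.instance Definition _ := GRing.Field.on padic_num.

Definition Zp_to_Qp : Zp -> padic_num := @FracField.tofrac _.
HB.instance Definition _ := GRing.RMorphism.on Zp_to_Qp.

End PadicIntegers.

(* The group ring R[gT]: functions with the convolution product (the type
   {ffun gT -> R} itself carries the pointwise product). *)
Section GroupRing.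
Variables (R : comNzRingType) (gT : finGroupType).

Definition gring : Type := {ffun gT -> R}.
HB.instance Definition _ := GRing.Zmodule.on gring.

Implicit Types x y z : gring.

Definition gelt (g : gT) : gring := [ffun h => (h == g)%:R].

Definition gring_mul x y : gring :=
  [ffun g => \sum_h x h * y (h^-1 * g)%g].

Fact gring_mulA : associative gring_mul.
Proof.
move=> x y z; apply/ffunP => g; rewrite !ffunE.
under eq_bigr do rewrite ffunE mulr_sumr.
under [RHS]eq_bigr do rewrite ffunE mulr_suml.
rewrite [RHS]exchange_big /=; apply: eq_bigr => h _.
rewrite [RHS](reindex_inj (mulgI h)); apply: eq_bigr => k _ /=.
by rewrite mulKg invMg !mulrA mulgA.
Qed.
Fact gring_mul1 : left_id (gelt 1%g) gring_mul.
Proof.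
move=> x; apply/ffunP => g; rewrite ffunE (bigD1 1%g) //= ffunE eqxx mul1r.
rewrite invg1 mul1g big1 ?addr0 // => h /negPf h1.
by rewrite ffunE h1 mul0r.
Qed.
Fact gring_mulr1 : right_id (gelt 1%g) gring_mul.
Proof.
move=> x; apply/ffunP => g; rewrite ffunE (bigD1 g) //= ffunE mulVg eqxx mulr1.
rewrite big1 ?addr0 // => h /negPf hg.
by rewrite ffunE -eq_mulVg1 hg mulr0.
Qed.
Fact gring_mulDl : left_distributive gring_mul +%R.
Proof.
move=> x y z; apply/ffunP => g; rewrite !ffunE -big_split /=.
by apply: eq_bigr => h _; rewrite ffunE mulrDl.
Qed.
Fact gring_mulDr : right_distributive gring_mul +%R.
Proof.
move=> x y z; apply/ffunP => g; rewrite !ffunE -big_split /=.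
by apply: eq_bigr => h _; rewrite ffunE mulrDr.
Qed.
Fact gring_1neq0 : gelt 1%g != 0.
Proof.
apply/eqP => /ffunP/(_ 1%g); rewrite !ffunE eqxx; apply/eqP; exact: oner_neq0.
Qed.

HB.instance Definition _ := GRing.Zmodule_isNzRing.Build gring
  gring_mulA gring_mul1 gring_mulr1 gring_mulDl gring_mulDr gring_1neq0.

Definition gring_scale (a : R) x : gring := [ffun g => a * x g].

Fact gring_scaleA a b x : gring_scale a (gring_scale b x) = gring_scale (a * b) x.
Proof. by apply/ffunP => g; rewrite !ffunE mulrA. Qed.
Fact gring_scale1 : left_id 1 gring_scale.
Proof. by move=> x; apply/ffunP => g; rewrite !ffunE mul1r. Qed.
Fact gring_scaleDr : right_distributive gring_scale +%R.
Proof. by move=> a x y; apply/ffunP => g; rewrite !ffunE mulrDr. Qed.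
Fact gring_scaleDl x : {morph gring_scale^~ x : a b / a + b}.
Proof. by move=> a b; apply/ffunP => g; rewrite !ffunE mulrDl. Qed.

HB.instance Definition _ := GRing.Zmodule_isLmodule.Build R gring
  gring_scaleA gring_scale1 gring_scaleDr gring_scaleDl.

Definition gring_norm (D : {set gT}) : gring := \sum_(g in D) gelt g.

End GroupRing.

Definition gring_coef (R S : comNzRingType) (gT : finGroupType) (f : R -> S)
  (x : gring R gT) : gring S gT := [ffun g => f (x g)].

(* Linear extension of a map of groups. *)
Definition gring_push (R : comNzRingType) (gT hT : finGroupType) (f : gT -> hT)
  (x : gring R gT) : gring R hT := [ffun h => \sum_(g | f g == h) x g].

(* R[gT] / (c + 1), as a module over R[gT].  gring does not record whether gT
   is commutative, so (c + 1) is the left ideal generated by c + 1; gT is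
   abelian in all uses below. *)
Section MinusPart.
Variables (R : comNzRingType) (gT : finGroupType) (c : gT).

Definition minus_ideal : {pred gring R gT} :=
  fun x => `[< exists w, x = w * (gelt R c + 1) >].

Fact minus_ideal_zmod : zmod_closed minus_ideal.
Proof.
split=> [|x y /asboolP[u ->] /asboolP[v ->]]; apply/asboolP.
  by exists 0; rewrite mul0r.
by exists (u - v); rewrite mulrBl.
Qed.
HB.instance Definition _ := GRing.isZmodClosed.Build _ minus_ideal minus_ideal_zmod.

Definition minus_part : Type := {ideal_quot minus_ideal}.
HB.instance Definition _ := GRing.Zmodule.on minus_part.

Definition to_minus (x : gring R gT) : minus_part := \pi_({ideal_quot minus_ideal}) x.
Definition of_minus (x : minus_part) : gring R gT := repr x.

Lemma of_minusK : cancel of_minus to_minus.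
Proof. exact: reprK. Qed.

Lemma to_minusP x y :
  to_minus x = to_minus y <-> exists w, x - y = w * (gelt R c + 1).
Proof.
have H : (to_minus x == to_minus y) = (x - y \in minus_ideal).
  by rewrite Quotient.idealrBE.
split=> [/eqP|xy]; first by rewrite H => /asboolP.
by apply/eqP; rewrite H; apply/asboolP.
Qed.

Fact to_minus_zmod : zmod_morphism to_minus.
Proof. by move=> x y; exact: raddfB. Qed.
HB.instance Definition _ :=
  GRing.isZmodMorphism.Build (gring R gT) minus_part to_minus to_minus_zmod.

Definition minus_scale (a : gring R gT) (x : minus_part) : minus_part :=
  to_minus (a * of_minus x).

Lemma minus_scaleE a x : minus_scale a (to_minus x) = to_minus (a * x).
Proof.
apply/to_minusP; have /to_minusP[w Hw] := of_minusK (to_minus x).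
by exists (a * w); rewrite -mulrBr Hw mulrA.
Qed.

Fact minus_scaleA a b x : minus_scale a (minus_scale b x) = minus_scale (a * b) x.
Proof. by rewrite minus_scaleE mulrA. Qed.
Fact minus_scale1 : left_id 1 minus_scale.
Proof. by move=> x; rewrite /minus_scale mul1r of_minusK. Qed.
Fact minus_scaleDr : right_distributive minus_scale +%R.
Proof.
move=> a x y; rewrite -[x]of_minusK -[y]of_minusK -raddfD !minus_scaleE.
by rewrite mulrDr raddfD.
Qed.
Fact minus_scaleDl x : {morph minus_scale^~ x : a b / a + b}.
Proof. by move=> a b; rewrite /minus_scale mulrDl raddfD. Qed.

HB.instance Definition _ := GRing.Zmodule_isLmodule.Build (gring R gT) minus_part
  minus_scaleA minus_scale1 minus_scaleDr minus_scaleDl.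

End MinusPart.

(* The ring of integers of a number field. *)
Section RingOfIntegers.
Variable L : fieldType.

Definition int_elt : {pred L} := fun x => `[< integralOver (intr : int -> L) x >].

Fact int_elt_subring : subring_closed int_elt.
Proof.
split=> [|x y /asboolP ix /asboolP iy|x y /asboolP ix /asboolP iy]; apply/asboolP.
- exact: integral1.
- exact: integral_sub.
- exact: integral_mul.
Qed.
HB.instance Definition _ := GRing.isSubringClosed.Build L int_elt int_elt_subring.

Record int_ring := IntRing { int_val : L; _ : int_val \in int_elt }.
HB.instance Definition _ := [isSub for int_val].
HB.instance Definition _ := [Choice of int_ring by <:].
HB.instance Definition _ := [SubChoice_isSubComNzRing of int_ring by <:].

End RingOfIntegers.

Fact int_map_subproof (L M : fieldType) (f : {rmorphism L -> M}) (x : int_ring L) :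
  f (val x) \in @int_elt M.
Proof.
case: x => x /= /asboolP ix; apply/asboolP; have := integral_rmorph f ix.
by congr (integralOver _ _); apply/funext => k /=; rewrite rmorph_int.
Qed.
Definition int_map (L M : fieldType) (f : {rmorphism L -> M}) (x : int_ring L) : int_ring M :=
  IntRing (int_map_subproof f x).

Definition prime_ideal (R : nzRingType) (I : {pred R}) : Prop :=
  idealr_closed I /\ prime_idealr_closed I.

Definition ideal_mul (R : nzRingType) (I J : {pred R}) : {pred R} :=
  fun x => `[< exists2 s : seq (R * R),
     all (fun q => (q.1 \in I) && (q.2 \in J)) s & x = \sum_(q <- s) q.1 * q.2 >].

(* The number of cosets of I. *)
Definition ideal_norm (R : nzRingType) (I : {pred R}) : nat :=
  #|` fset_set [set [set y | y - x \in I] | x in [set: R]]%classic |%fset.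

Definition totally_real (L : fieldType) : Prop :=
  forall (f : {rmorphism L -> algC}) (x : L), f x \is Num.real.

Definition totally_imaginary (L : fieldType) : Prop :=
  forall f : {rmorphism L -> algC}, exists x : L, f x \isn't Num.real.

Definition CM_field (L : fieldExtType rat) : Prop :=
  totally_imaginary L /\
  exists L0 : {subfield L}, totally_real (subvs_of L0) /\ \dim_L0 {:L} = 2%N.

(* The places of a totally real field: the infinite ones are its embeddings in
   the algebraic complex numbers; a finite one is a subset of the ring of
   integers, required to be a prime ideal where it is used. *)
Inductive place (F : fieldType) : Type :=
| InfPlace of {rmorphism F -> algC}
| FinPlace of (int_ring F -> bool).

HB.instance Definition _ (F : fieldType) := gen_eqMixin (place F).
HB.instance Definition _ (F : fieldType) := gen_choiceMixin (place F).

Section Extension.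
Variables (F : fieldExtType rat) (K : splittingFieldType F).

Definition abelian_ext : Prop :=
  galois 1%AS {:K}%AS && abelian 'Gal({:K} / 1%AS)%g.

(* 'Gal(E / F) is the group gal_of E, for E : {subfield K} normal over F. *)
Section GaloisAction.
Variables (E : {subfield K}) (s : gal_of E).

Definition gal_act (x : subvs_of E) : subvs_of E := vsproj E (s (vsval x)).

Lemma gal_actE x : vsval (gal_act x) = s (vsval x).
Proof. by rewrite /gal_act vsprojK // memv_gal // subvsP. Qed.

Fact gal_act_zmod : zmod_morphism gal_act.
Proof.
move=> x y; apply: val_inj; rewrite [LHS]gal_actE.
by rewrite [RHS](raddfB vsval) /= 2!gal_actE !raddfB.
Qed.
Fact gal_act_monoid : monoid_morphism gal_act.
Proof.
split=> [|x y]; apply: val_inj; rewrite [LHS]gal_actE; first by rewrite [in LHS](rmorph1 vsval) [RHS](rmorph1 vsval) rmorph1.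
by rewrite [RHS](rmorphM vsval) /= 2!gal_actE rmorphM.
Qed.
HB.instance Definition _ :=
  GRing.isZmodMorphism.Build (subvs_of E) (subvs_of E) gal_act gal_act_zmod.
HB.instance Definition _ :=
  GRing.isMonoidMorphism.Build (subvs_of E) (subvs_of E) gal_act gal_act_monoid.

End GaloisAction.

Variable E : {subfield K}.

Definition base_embed (x : F) : subvs_of E := x%:A.
HB.instance Definition _ := GRing.RMorphism.copy base_embed (in_alg (subvs_of E)).

Definition CM : Prop := CM_field (baseFieldType (subvs_of E)).

Definition complex_conj : gal_of E :=
  odflt 1%g [pick c | `[< forall (f : {rmorphism subvs_of E -> algC}) x,
                            f (gal_act c x) = (f x)^* >]].

Definition lies_over (v : {pred int_ring F}) (P : {pred int_ring (subvs_of E)}) : Prop :=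
  prime_ideal P /\ forall x, (int_map base_embed x \in P) = (x \in v).

(* The ramification index of some P above v is at least 2. *)
Definition ramified (v : {pred int_ring F}) : Prop :=
  exists2 P, lies_over v P &
    {in v, forall x, int_map base_embed x \in ideal_mul P P}.

(* The stabiliser of all the places of E above v; these have the same
   stabiliser when E / F is abelian. *)
Definition decomp_group (v : place F) : {set gal_of E} :=
  match v with
  | InfPlace f => [set s | `[< forall g : {rmorphism subvs_of E -> algC},
      (forall x, g (base_embed x) = f x) ->
      (forall x, g (gal_act s x) = g x) \/
      (forall x, g (gal_act s x) = (g x)^*) >]]
  | FinPlace v => [set s | `[< forall P, lies_over v P ->
      forall x, (int_map (gal_act s) x \in P) = (x \in P) >]]
  end%SET.

(* Only meaningful when v is finite and unramified in E / F abelian. *)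
Definition frobenius (v : place F) : gal_of E :=
  match v with
  | InfPlace _ => 1%g
  | FinPlace v => odflt 1%g [pick s | `[< forall P, lies_over v P ->
      forall x, int_map (gal_act s) x - x ^+ ideal_norm v \in P >]]
  end.

Definition Sigma (p : nat) : set (place F) :=
  fun v => match v with
  | InfPlace _ => True
  | FinPlace v => [/\ prime_ideal v, p%:R \in v & ramified v]
  end.

Definition minus (R : comNzRingType) : Type := minus_part R complex_conj.
HB.instance Definition _ R := GRing.Lmodule.on (minus R).

End Extension.

Section Families.
Variables (p : nat) (p_pr : prime p) (F : fieldExtType rat).
Local Notation Zp := (padic_int p_pr).
Local Notation Qp := (padic_num p_pr).

Section Family.
Variable K : splittingFieldType F.
Implicit Types E : {subfield K}.

(* The factors lie in the subring generated by the elements of the group, which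
   is commutative in the abelian case, so the order of the product is
   irrelevant. *)
Definition idem_e E : gring Qp (gal_of E) :=
  \big[*%R/1]_(v \in Sigma E p)
    (1 - (#|decomp_group E v|%:R)^-1 *: gring_norm Qp (decomp_group E v)).

Definition P_elt E' E : gring Zp (gal_of E) :=
  \big[*%R/1]_(v \in (Sigma E' p `\` Sigma E p)%classic)
    (1 - gelt Zp (frobenius E v)^-1%g).

(* The maps on minus parts below are computed on representatives: the
   underlying maps of group rings send c + 1 to c + 1 (for the restriction maps,
   when the fields are CM and abelian over F). *)
Definition minus_ZQ E (x : minus E Zp) : minus E Qp :=
  to_minus _ (gring_coef (@Zp_to_Qp p p_pr) (of_minus x)).

Definition proj_e E (x : minus E Zp) : minus E Qp :=
  (idem_e E : gring _ _) *: minus_ZQ x.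

Definition in_R_E E (z : minus E Qp) : Prop := exists x, proj_e x = z.

(* For E \subset E' normal, gal E : gal_of E' -> gal_of E is the restriction. *)
Definition red E' E (x : minus E' Zp) : minus E Zp :=
  to_minus _ (gring_push (fun s : gal_of E' => gal E s) (of_minus x)).

(* Indexed by all intermediate fields; only the values at the CM fields enter
   the definitions and statements about families. *)
Definition minus_family : Type := forall E, minus E Qp.

Definition norm_compatible (z : minus_family) : Prop :=
  (forall E, CM E -> in_R_E (z E)) /\
  forall E' E, CM E' -> CM E -> (E <= E')%VS ->
    forall zt : minus E' Zp, proj_e zt = z E' ->
      gring_coef (@Zp_to_Qp p p_pr) (P_elt E' E) *:
        (proj_e (red E zt) - z E) = 0.

End Family.

Section Extend.
Variables (K K' : splittingFieldType F) (iota : 'AHom(K, K')).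

(* The isomorphism from Gal(iota(E) / F) to Gal(E / F) induced by iota, and the
   resulting identification of minus parts. *)
Definition gal_transport (E : {subfield K}) (s : gal_of (iota @: E)) : gal_of E :=
  odflt 1%g [pick t : gal_of E | `[< {in E, forall x, iota (t x) = s (iota x)} >]].

Definition transport (E : {subfield K})
    (x : minus (iota @: E)%AS Qp) : minus E Qp :=
  to_minus _ (gring_push (@gal_transport E) (of_minus x)).

Definition extends_to (z : minus_family K) : Prop :=
  exists z' : minus_family K', norm_compatible z' /\
    forall E : {subfield K}, CM E -> transport (z' (iota @: E)%AS) = z E.

End Extend.
End Families.

(* Main.v *)
(* Apply the extension hypothesis to K' = K(mu_m), where m = p^N - 1 with
   N = t p^n and t = [K:F]! [F:Q]!.  As p does not divide m, no new prime above
   p ramifies, so Sigma(K') = Sigma(K).  For a CM field E in K, each Frobenius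
   at a prime above p in E(mu_m) has a power h which is trivial on E and raises
   m-th roots of unity to the power p^t; the order of h is divisible by p^n.  In
   norm compatibility from K' to E(mu_m), every factor of the idempotent and of
   the Euler product either divides 1 - h or acts trivially on the minus part.
   Hence the error term is killed by a power of 1 - h, so by 1 - h itself
   (characteristic 0), and its image in Z_p[G_E]_- is, up to the factor 2 lost
   in lifting from the minus part, divisible by the order of h.  So a lift of
   z'_{K'} reduces to a lift of z_K that is right at every E modulo p^n, and
   compactness of Z_p[G_K] gives a lift that is right exactly. *)
Require Import Defs.
From HB Require Import structures.
From mathcomp Require Import all_boot all_order all_algebra.
From mathcomp Require Import all_fingroup all_solvable all_field.
From mathcomp Require Import generic_quotient.
From mathcomp Require Import finmap.
From mathcomp Require Import boolp classical_sets cardinality fsbigop.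
From mathcomp Require Import ring.

Set Implicit Arguments.
Unset Strict Implicit.
Unset Printing Implicit Defensive.

Import Order.TTheory GRing.Theory Num.Theory.
Local Open Scope ring_scope.

(** * Field extensions and roots of unity *)

(** Compatibility from [K'] to [E] only holds after multiplication by factors [1 - sigma_v^-1], and
    such a factor is 0 when [v] splits completely in [E], so it may carry no information at [E]
    itself. Over [E(mu_m)] what these factors kill is still controlled, and the remaining step from
    [E(mu_m)] to [E] has no Euler factor, since both fields have the same [Sigma]. The constant [t]
    makes one [h] serve all primes: if [v] has residue degree [f], its Frobenius raised to the power
    [t / f] acts on [mu_m] by the exponent [p^t], whatever [v] is, and [[E:F]] divides [t / f]. The
    choice [m = p^N - 1] makes [N] the exact order of [p] modulo [m]. Divisibility arises because an
    element of the group ring fixed by [h] is constant on the cosets of [<h>], which restriction to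
    [E] collapses to points. The fields [K'] for different [n] are unrelated, so only a limit point
    of the images of the lifts in [Z_p[G_K]] can be taken. *)

Lemma pchar_num_ext (F : fieldExtType rat) : [pchar F] =i pred0.
Proof. by move=> q; rewrite pchar_lalg pchar_num. Qed.

(** Primitive element theorem: [L = M(th)], and [th] may be sent to any root in [algC] of its
    minimal polynomial transported by [f0]. Separability holds because [f0] forces characteristic
    0. *)
Lemma extend_embedding (M : fieldType) (L : fieldExtType M) (f0 : {rmorphism M -> algC}) :
  exists f : {rmorphism L -> algC}, forall x : M, f x%:A = f0 x.
Proof.
have pcharL : [pchar L] =i pred0.
  by move=> q; rewrite pchar_lalg -(fmorph_pchar f0) pchar_num.
have sepL : separable 1 {:L}.
  by apply/separableP => y _; apply: pcharf0_separable.
have := eq_adjoin_separable_generator sepL (sub1v _).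
set th := separable_generator _ _ => defL.
have /polyOver1P [q0 Dq0] := minPolyOver 1 th.
have sq0 : (1 < size q0)%N by rewrite -(size_map_poly (in_alg L)) -Dq0 size_minPoly.
have q0_neq0 : q0 != 0 by rewrite -size_poly_gt0 (ltn_trans _ sq0).
have [z z0] : exists z : algC, root (map_poly f0 q0) z.
  by apply: closed_rootP; rewrite size_map_poly neq_ltn sq0 orbT.
pose ev (q : {poly M}) := (map_poly (in_alg L) q).[th].
pose evz (q : {poly M}) := (map_poly f0 q).[z].
have evP (x : L) : exists q, ev q = x.
  have : x \in <<1; th>>%VS by rewrite -defL memvf.
  by case/Fadjoin_polyP => _ /polyOver1P [q ->] ->; exists q.
have ev0 q : ev q = 0 -> evz q = 0.
  move=> eq0.
  have : minPoly 1 th %| map_poly (in_alg L) q.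
    by apply: minPoly_dvdp; [apply/polyOver1P; exists q | rewrite rootE -/(ev q) eq0].
  rewrite Dq0 dvdp_map => /dvdpP [r ->].
  by rewrite /evz rmorphM hornerM (rootP z0) mulr0.
(* The representing polynomial is chosen arbitrarily; [ev0] makes the value independent of it. *)
pose phi x := evz (projT1 (cid (evP x))).
have phiE q : phi (ev q) = evz q.
  rewrite /phi; case: cid => r /= er; apply/eqP; rewrite -subr_eq0; apply/eqP.
  have -> : evz r - evz q = evz (r - q) by rewrite /evz rmorphB hornerD hornerN.
  by apply: ev0; rewrite /ev rmorphB hornerD hornerN -!/(ev _) er subrr.
have phi_zmod : zmod_morphism phi.
  move=> x y; have [[r <-] [s <-]] := (evP x, evP y).
  have -> : ev r - ev s = ev (r - s) by rewrite /ev rmorphB hornerD hornerN.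
  by rewrite !phiE /evz rmorphB hornerD hornerN.
have phi_monoid : monoid_morphism phi.
  split=> [|x y].
    have -> : 1 = ev 1 by rewrite /ev rmorph1 hornerC.
    by rewrite phiE /evz rmorph1 hornerC.
  have [[r <-] [s <-]] := (evP x, evP y).
  have -> : ev r * ev s = ev (r * s) by rewrite /ev rmorphM hornerM.
  by rewrite !phiE /evz rmorphM hornerM.
pose phiM : {rmorphism L -> algC} := HB.pack phi
  (GRing.isZmodMorphism.Build _ _ phi phi_zmod) (GRing.isMonoidMorphism.Build _ _ phi phi_monoid).
exists phiM => x /=.
have -> : x%:A = ev x%:P by rewrite /ev map_polyC hornerC.
by rewrite phiE /evz map_polyC hornerC.
Qed.

Lemma num_field_embedding (L : fieldExtType rat) : inhabited {rmorphism L -> algC}.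
Proof. by have [f _] := extend_embedding L (ratr : {rmorphism rat -> algC}). Qed.

(** [K(a)] is formed as polynomials modulo a nonzero annihilator of [a] of least degree, irreducible
    by minimality. *)
Lemma simple_ext_in_algC (K : fieldType) (f : {rmorphism K -> algC}) (a : algC)
    (q : {poly K}) : q != 0 -> root (map_poly f q) a ->
  exists (L : fieldExtType K) (g : {rmorphism L -> algC}) (z : L),
    [/\ g z = a, forall x : K, g x%:A = f x & <<1; z>>%VS = fullv].
Proof.
move=> q0 qa.
have exn : exists n, `[< exists2 r, (r != 0) && root (map_poly f r) a & size r = n >].
  by exists (size q); apply/asboolP; exists q => //; rewrite q0.
case: (ex_minnP exn) => m /asboolP [p /andP[p0 pa] szp] pmin.
have irr_p : irreducible_poly p.
  apply/(subfx_irreducibleP pa p0) => r ra r0; rewrite szp; apply: pmin.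
  by apply/asboolP; exists r => //; rewrite r0.
exists (SubFieldExtType pa irr_p), (subfx_inj : {rmorphism subFExtend f a p -> algC}).
exists (subfx_root f a p); split.
- exact: subfx_inj_root.
- by move=> x; apply: subfx_inj_base.
apply/vspaceP => x; rewrite memvf; apply/Fadjoin_polyP.
have [r ->] := subfxEroot pa p0 x.
by exists (map_poly (in_alg (SubFieldExtType pa irr_p)) r) => //; apply/polyOver1P; exists r.
Qed.

(** [K(mu_m)] is built over [K], then seen over [F]. It is a splitting field over [F] of the product
    of [X^m - 1] and a polynomial of which [K] is the splitting field. *)
Lemma cyclotomic_extension (F : fieldExtType rat) (K : splittingFieldType F) (m : nat) :
  (0 < m)%N -> exists (K' : splittingFieldType F) (iota : 'AHom(K, K')) (zeta : K'),
    m.-primitive_root zeta /\ <<(iota @: {:K})%AS; zeta>>%VS = {:K'}%VS.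
Proof.
move=> m0; have [f'] := num_field_embedding (baseFieldType K).
pose f : {rmorphism K -> algC} := f'.
have [a a_prim] := C_prim_root_exists m0.
have Xm1 : 'X^m - 1 != 0 :> {poly K} by rewrite -size_poly_eq0 size_XnsubC.
have am1 : root (map_poly f ('X^m - 1)) a.
  by rewrite rmorphB rmorphXn /= map_polyX rmorph1 rootE !hornerE (prim_expr_order a_prim) subrr.
have [L [g [z [gz gK Lz]]]] := simple_ext_in_algC Xm1 am1.
have z_prim : m.-primitive_root z by rewrite -(fmorph_primitive_root g) gz.
pose L0 := baseFieldType L : fieldExtType F.
pose io (x : K) : L0 := (x%:A : L).
have io_zmod : zmod_morphism io by move=> x y; rewrite /io scalerBl.
have io_mon : monoid_morphism io.
  by split=> [|x y]; [exact: (rmorph1 (in_alg L)) | exact: (rmorphM (in_alg L))].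
have io_scal : scalable io.
  by move=> c x; rewrite /io baseField_scaleE scalerA mulr_algl.
pose ioL : {linear K -> L0} := HB.pack io
   (GRing.isZmodMorphism.Build _ _ io io_zmod) (GRing.isScalable.Build _ _ _ _ io io_scal).
have io_ahom : ahom_in {:K} (linfun ioL).
  apply/ahom_inP; split => [x y _ _|]; rewrite !lfunE /=.
    exact: (io_mon.2 x y).
  exact: io_mon.1.
have [p Fp [rs Dp defK]] := splittingPoly K.
have [iota0 iotaE] : exists iota : 'AHom(K, L0), forall x, iota x = io x.
  by exists (AHom io_ahom) => x; exact: (lfunE ioL).
have iotaL x : io x \in (iota0 @: {:K})%VS by rewrite -iotaE memv_img ?memvf.
have genL (M : {subfield L0}) : (iota0 @: {:K} <= M)%VS -> z \in M -> (M = {:L0} :> {vspace _})%VS.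
  move=> sKM zM; apply/vspaceP => x; rewrite memvf.
  have : (x : L) \in <<1; z>>%VS by rewrite Lz memvf.
  case/Fadjoin_polyP => _ /polyOver1P [q ->] ->.
  elim/poly_ind: q => [|q c IHq]; first by rewrite rmorph0 horner0; exact: (mem0v M).
  rewrite rmorphD rmorphM /= map_polyX map_polyC hornerMXaddC.
  by apply: (@memvD _ _ M); [apply: (@memvM _ L0 M) | apply: (subvP sKM)].
pose zs := [seq z ^+ k | k <- index_iota 0 m] : seq L0.
have fac : map_poly iota0 (\prod_(r <- rs) ('X - r%:P)) = \prod_(r <- map iota0 rs) ('X - r%:P).
  rewrite rmorph_prod big_map; apply: eq_bigr => r _.
  by rewrite rmorphB /= map_polyX map_polyC.
have split_L0 : SplittingField.axiom L0.
  exists (map_poly iota0 p * ('X^m - 1)).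
    apply: rpredM; last by rewrite rpredB ?rpredX ?polyOverX ?rpred1.
    case/polyOver1P: Fp => q ->; apply/polyOver1P; exists q.
    rewrite -map_poly_comp; apply: eq_map_poly => c /=.
    by rewrite linearZ rmorph1.
  exists (map iota0 rs ++ zs).
    rewrite big_cat /= -fac.
    have -> : 'X^m - 1 = \prod_(r <- zs) ('X - r%:P) :> {poly L0}.
      have := @factor_Xn_sub_1 L m z z_prim.
      by rewrite big_map => ->.
    by apply: eqp_mulr; rewrite eqp_map.
  set M := <<1 & map iota0 rs ++ zs>>%AS.
  apply: (genL M).
    rewrite -defK aimg_adjoin_seq aimg1; apply/Fadjoin_seqP.
    split; first exact: sub1v.
    by move=> x xrs; apply: seqv_sub_adjoin; rewrite mem_cat xrs.
  apply: seqv_sub_adjoin; rewrite mem_cat; apply/orP; right; apply/mapP.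
  (* The exponents in [zs] stop at [m - 1], so for [m = 1] the root [z] occurs as [z^0]. *)
  have [m1|m1] := ltnP 1 m; first by exists 1%N; rewrite ?mem_index_iota ?expr1.
  exists 0%N; rewrite ?mem_index_iota // expr0.
  have -> : z = z ^+ m by have -> : m = 1%N by apply/eqP; rewrite eqn_leq m1.
  exact: prim_expr_order.
pose z1 : L0 := z.
have gen := genL <<(iota0 @: {:K})%AS; z1>>%AS (subv_adjoin _ _) (memv_adjoin _ _).
pose K' : splittingFieldType F := HB.pack L0 (FieldExt_isSplittingField.Build _ L0 split_L0).
by exists K', iota0, z1; split; [exact: z_prim | exact: gen].
Qed.

Section AbelianExt.
Variables (F : fieldExtType rat) (K : splittingFieldType F).

Lemma gal1T (E : {subfield K}) : 'Gal(E / 1)%g = [set: gal_of E].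
Proof.
by apply/setP=> s; rewrite inE gal_kHom ?sub1v // k1AHom.
Qed.

Lemma galois1f : galois 1%AS {:K}%AS.
Proof.
rewrite /galois sub1v normalFieldf andbT /=.
apply/separableP => y _; apply: pcharf0_separable => q.
by rewrite pchar_lalg pchar_num_ext.
Qed.

(** Every subgroup of an abelian group is normal. *)
Lemma abelian_galois (E : {subfield K}) : abelian_ext K -> galois 1%AS E.
Proof.
case/andP=> _ abG.
have galE : galois E {:K}%AS by apply: galoisS galois1f; rewrite sub1v subvf.
have <- : fixedField 'Gal({:K} / E)%g = E :> {vspace _} by apply/galois_fixedField.
apply: (normal_fixedField_galois galois1f (G := 'Gal({:K} / E)%G)).
by rewrite -sub_abelian_normal ?galS ?sub1v.
Qed.

Lemma abelian_gal (E : {subfield K}) : abelian_ext K -> abelian [set: gal_of E].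
Proof.
move=> abK; have /and3P[_ _ nE] := abelian_galois E abK.
have sE : (1 <= E <= {:K})%VS by rewrite sub1v subvf.
rewrite -gal1T -(normalField_img galois1f sE nE) morphim_abelian //.
by case/andP: abK.
Qed.

Lemma card_gal (E : {subfield K}) : abelian_ext K -> #|[set: gal_of E]| = \dim E.
Proof.
by move=> /(abelian_galois E) galE; rewrite -gal1T -galois_dim // dimv1 divn1.
Qed.

Lemma gal_adjoin_ext (E E0 : {subfield K}) z (s t : gal_of E) :
  (<<E0; z>> = E)%VS -> {in E0, s =1 t} -> s z = t z -> s = t.
Proof.
move=> defE st stz; apply/eqP/gal_eqP => x xE.
have /Fadjoin_polyP [q qE ->] : x \in <<E0; z>>%VS by rewrite defE.
rewrite -!horner_map /= stz; congr (_.[_]); apply/polyP => i.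
by rewrite !coef_map /= st // (polyOverP qE).
Qed.

End AbelianExt.

Section Restriction.
Variables (F : fieldExtType rat) (K K' : splittingFieldType F) (iota : 'AHom(K, K')).
Variables (E : {subfield K}) (E' : {subfield K'}).

(** A relation rather than a map, so that one notion covers inclusions inside one field ([iota] the
    identity) and embeddings into a larger one; [restricts_inj] then identifies composites of
    restriction maps. *)
Definition restricts (s : gal_of E') (t : gal_of E) := {in E, forall x, iota (t x) = s (iota x)}.

Lemma restricts_inj s t u : restricts s t -> restricts s u -> t = u.
Proof.
move=> st su; apply/eqP/gal_eqP => x xE.
by apply: (fmorph_inj iota); apply: etrans (st x xE) (esym (su x xE)).
Qed.

Hypothesis nE : normalField 1%AS E.
Hypothesis sEE' : (iota @: E <= E')%VS.

Lemma restricts1 : restricts 1%g 1%g.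
Proof. by move=> x xE; rewrite !gal_id. Qed.

Lemma restrictsM s1 s2 t1 t2 : restricts s1 t1 -> restricts s2 t2 -> restricts (s1 * s2)%g (t1 * t2)%g.
Proof.
move=> r1 r2 x xE; rewrite galM // galM; last by rewrite (subvP sEE') // memv_img.
by rewrite r2 ?memv_gal // r1.
Qed.

Lemma restrictsX s t n : restricts s t -> restricts (s ^+ n)%g (t ^+ n)%g.
Proof.
move=> st; elim: n => [|n IHn]; first exact: restricts1.
by rewrite !expgS; apply: restrictsM.
Qed.

(** [s (iota x)] is a root of the transported minimal polynomial of [x], whose roots all lie in
    [iota E] by normality; hence [s] preserves [iota E] and pulls back along [iota]. *)
Lemma gal_restricts (s : gal_of E') : exists t, restricts s t.
Proof.
have sE x : x \in E -> exists2 y, y \in E & iota y = s (iota x).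
  move=> xE; have [rs /allP rsE Dx] := normalFieldP nE x xE.
  have /polyOver1P [q Dq] := minPolyOver 1 x.
  have : root (map_poly iota (minPoly 1 x)) (s (iota x)).
    rewrite Dq -map_poly_comp.
    have -> : map_poly (iota \o in_alg K) q = map_poly s (map_poly iota (map_poly (in_alg K) q)).
      rewrite -!map_poly_comp; apply: eq_map_poly => c /=.
      by rewrite !linearZ !rmorph1.
    by rewrite rootE horner_map horner_map /= -Dq minPolyxx !rmorph0.
  rewrite Dx rmorph_prod /= -(big_map _ predT (fun P => P)) /=.
  have -> : \prod_(P <- [seq map_poly iota ('X - r%:P) | r <- rs]) P
            = \prod_(r <- map iota rs) ('X - r%:P).
    by rewrite !big_map; apply: eq_bigr => r _; rewrite rmorphB /= map_polyX map_polyC.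
  by rewrite root_prod_XsubC => /mapP [y yr ->]; exists y => //; apply: rsE.
have iota_inj : injective iota by exact: (fmorph_inj iota).
have ker0 : lker iota == 0%VS by apply/lker0P.
pose f : 'End(K) := (iota^-1 \o s \o iota)%VF.
have fE x : x \in E -> f x \in E /\ iota (f x) = s (iota x).
  move=> xE; have [y yE Dy] := sE x xE.
  by rewrite /f !lfunE /= lfunE /= -Dy lker0_lfunK.
have : kAut 1 E f.
  rewrite kAutE k1HomE; apply/andP; split.
    apply/ahom_inP; split=> [x y xE yE|]; apply: iota_inj.
      by rewrite [RHS]rmorphM /= !(proj2 (fE _ _)) ?memvM // rmorphM [LHS]rmorphM.
    by rewrite (proj2 (fE _ _)) ?mem1v // !rmorph1.
  by apply/subvP => _ /memv_imgP [x xE ->]; have [] := fE x xE.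
case/kAut_to_gal => t _ ft; exists t => x xE.
by rewrite -ft // (proj2 (fE _ _)).
Qed.

End Restriction.

(** * Primes above a place *)

(** Turns membership in [P] into vanishing in a domain, the form in which conjugacy of primes is
    proved. Inverses in the quotient are chosen classically, as [idomainType] carries an inverse
    operation. *)
Lemma prime_ideal_quotient (R : comNzRingType) (P : {pred R}) : prime_ideal P ->
  exists (O : idomainType) (rho : {rmorphism R -> O}),
    (forall y, exists x, rho x = y) /\ (forall x, (rho x == 0) = (x \in P)).
Proof.
case=> idP prP.
pose I : prime_idealr R := HB.pack P (isIdealr.Build R P idP) (isPrimeIdealrClosed.Build R P prP).
pose Q : comNzRingType := {ideal_quot I}.
pose inv (x : Q) : Q := if pselect (exists y, y * x = 1) is left ex then projT1 (cid ex) else x.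
pose unit : pred Q := fun x => `[< exists y, y * x = 1 >].
have mulV : {in unit, left_inverse 1 inv *%R}.
  by move=> x /asboolP ux; rewrite /inv; case: pselect => // ex; case: cid.
have unitP x y : y * x = 1 -> unit x by move=> yx1; apply/asboolP; exists y.
have invout : {in [predC unit], inv =1 id}.
  move=> x; rewrite inE => /negP nux; rewrite /inv.
  by case: pselect => // ex; case: nux; apply/asboolP.
pose Qu := GRing.ComNzRing_hasMulInverse.Build Q mulV unitP invout.
have int (x y : Q) : x * y = 0 -> (x == 0) || (y == 0) by exact: Quotient.rquot_IdomainAxiom.
pose O1 : comUnitRingType := HB.pack Q Qu.
pose O : idomainType := HB.pack O1 (GRing.ComUnitRing_isIntegral.Build O1 int).
exists O, (\pi_Q%qT : {rmorphism R -> Q}); split.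
  by move=> y; exists (repr y); exact: reprK.
move=> x; have -> : (x \in P) = (x \in (I : pred R)) by [].
by rewrite -[x in RHS]subr0 Quotient.idealrBE -(rmorph0 (\pi_Q%qT : {rmorphism R -> Q})).
Qed.

Lemma prime_ideal0 (R : comNzRingType) (P : {pred R}) : prime_ideal P -> 0 \in P.
Proof. by case=> -[]. Qed.

Lemma prime_ideal1 (R : comNzRingType) (P : {pred R}) : prime_ideal P -> 1 \notin P.
Proof. by case=> -[]. Qed.

Lemma prime_idealD (R : comNzRingType) (P : {pred R}) x y :
  prime_ideal P -> x \in P -> y \in P -> x + y \in P.
Proof. by case=> -[_ _ h] _ xP yP; rewrite -[x]mul1r h. Qed.

Lemma prime_idealMl (R : comNzRingType) (P : {pred R}) a x :
  prime_ideal P -> x \in P -> a * x \in P.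
Proof. by case=> -[h0 _ h] _ xP; rewrite -[_ * _]addr0 h. Qed.

Lemma prime_idealMr (R : comNzRingType) (P : {pred R}) a x :
  prime_ideal P -> x \in P -> x * a \in P.
Proof. by rewrite mulrC; apply: prime_idealMl. Qed.

Lemma prime_idealM (R : comNzRingType) (P : {pred R}) x y :
  prime_ideal P -> (x * y \in P) = (x \in P) || (y \in P).
Proof.
move=> pP; apply/idP/orP => [|[xP|yP]]; last 1 first.
- exact: prime_idealMl.
- by move=> /(proj2 pP)/orP.
- exact: prime_idealMr.
Qed.

Lemma prime_idealB (R : comNzRingType) (P : {pred R}) x y :
  prime_ideal P -> x \in P -> y \in P -> x - y \in P.
Proof. by move=> pP xP yP; rewrite prime_idealD // -mulN1r prime_idealMl. Qed.

Lemma prime_ideal_prod (R : comNzRingType) (P : {pred R}) (I : Type) (r : seq I) (Q : pred I) (f : I -> R) :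
  prime_ideal P -> (forall i, Q i -> f i \notin P) -> \prod_(i <- r | Q i) f i \notin P.
Proof.
move=> pP fP; elim/big_rec: _ => [|i x Qi xP]; first exact: prime_ideal1.
by rewrite prime_idealM // negb_or fP.
Qed.

Lemma prime_ideal_sum (R : comNzRingType) (P : {pred R}) (I : Type) (r : seq I) (Q : pred I) (f : I -> R) :
  prime_ideal P -> (forall i, Q i -> f i \in P) -> \sum_(i <- r | Q i) f i \in P.
Proof.
move=> pP fP; elim/big_rec: _ => [|i x Qi xP]; first exact: prime_ideal0.
by rewrite prime_idealD // fP.
Qed.

Lemma prime_ideal_preim (R S : comNzRingType) (f : {rmorphism R -> S}) (P : {pred S}) :
  prime_ideal P -> prime_ideal (fun x => f x \in P).
Proof.
move=> pP; split; [split|].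
- by rewrite unfold_in rmorph0; exact: prime_ideal0.
- by rewrite unfold_in rmorph1; exact: prime_ideal1.
- move=> a x y xP yP; rewrite unfold_in rmorphD rmorphM.
  by apply: (prime_idealD pP) yP; apply: (prime_idealMl _ pP) xP.
- by move=> x y; rewrite unfold_in rmorphM; case: pP => _; apply.
Qed.

(** * Finite group actions on rings: norms, conjugacy, lying over *)

Section FiniteInvariants.
Variables (A B : comNzRingType) (i : {rmorphism A -> B}) (gT : finGroupType).
Variables (act : gT -> {rmorphism B -> B}) (G : {group gT}).
Hypothesis act1 : act 1%g =1 id.
Hypothesis actM : forall g h, act (g * h)%g =1 act h \o act g.
Hypothesis fixed : forall b, (forall g, g \in G -> act g b = b) -> exists a, i a = b.

Lemma fixed_poly (X : {poly B}) :
  (forall g, g \in G -> map_poly (act g) X = X) -> exists q, map_poly i q = X.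
Proof.
move=> fX; have /(_ _)/cid cf k : exists a, i a = X`_k.
  by apply: fixed => g gG; rewrite -[in RHS](fX g gG) coef_map.
exists (\poly_(k < size X) projT1 (cf k)); apply/polyP => k.
rewrite coef_map coef_poly; case: ltnP => [_|kX]; first by case: (cf k).
by rewrite raddf0 nth_default.
Qed.

Lemma fixed_norm b : exists a, i a = \prod_(g in G) act g b.
Proof.
apply: fixed => h hG; rewrite rmorph_prod /= [RHS](reindex_inj (mulIg h)) /=.
apply: eq_big => g; first by rewrite groupMr.
by move=> _; rewrite actM.
Qed.

End FiniteInvariants.

Section InvariantsPoly.
Variables (A B : comNzRingType) (i : {rmorphism A -> B}) (gT : finGroupType).
Variables (act : gT -> {rmorphism B -> B}) (G : {group gT}).
Hypothesis act1 : act 1%g =1 id.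
Hypothesis actM : forall g h, act (g * h)%g =1 act h \o act g.
Hypothesis fixed : forall b, (forall g, g \in G -> act g b = b) -> exists a, i a = b.

(** [fixed_norm] for [B[X]] with the coefficientwise action, whose invariants come from [A[X]]. *)
Lemma fixed_norm_poly (X : {poly B}) :
  exists f, map_poly i f = \prod_(g in G) map_poly (act g) X.
Proof.
apply: (@fixed_norm _ _ (map_poly i) _ (fun g => map_poly (act g))).
  by move=> g h Y; rewrite /= -map_poly_comp; apply: eq_map_poly; exact: actM.
move=> Y fY; exact: (fixed_poly fixed fY).
Qed.

(** The norm of [X - b] has coefficients in [A], where [phi] and [rho] agree, so [phi b] is a root
    of the product of the [X - rho (act g b)]. Here [g] still depends on [b]. *)
Lemma conj_eval (b : B) (O : idomainType) (rho phi : {rmorphism B -> O}) :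
  (forall a, phi (i a) = rho (i a)) -> exists2 g, g \in G & phi b = rho (act g b).
Proof.
move=> phi_rho; have [f Df] := fixed_norm_poly ('X - b%:P).
have prodE (s : {rmorphism B -> O}) x : (map_poly s (map_poly i f)).[x] = \prod_(g in G) (x - s (act g b)).
  rewrite Df rmorph_prod horner_prod; apply: eq_bigr => g _.
  by rewrite !rmorphB /= !map_polyX !map_polyC /= !hornerE.
have : (map_poly rho (map_poly i f)).[phi b] == 0.
  have <- : map_poly phi (map_poly i f) = map_poly rho (map_poly i f).
    by rewrite -!map_poly_comp; apply: eq_map_poly.
  by rewrite prodE (bigD1 1%g) //= act1 subrr mul0r.
by rewrite prodE => /prodf_eq0 [g gG]; rewrite subr_eq0 => /eqP ->; exists g.
Qed.

(** The norm of [b] comes from [A] and is killed by [phi], hence by [rho]; in a domain one factor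
    must vanish. *)
Lemma conj_kernel (b : B) (O1 O2 : idomainType) (rho : {rmorphism B -> O2}) (phi : {rmorphism B -> O1}) :
  (forall a, phi (i a) = 0 -> rho (i a) = 0) -> phi b = 0 -> exists2 g, g \in G & rho (act g b) = 0.
Proof.
move=> phi_rho phib; have [a Da] := fixed_norm actM fixed b.
have /phi_rho : phi (i a) = 0 by rewrite Da rmorph_prod (bigD1 1%g) //= act1 phib mul0r.
by move/eqP; rewrite Da rmorph_prod => /prodf_eq0 [g gG] /eqP ?; exists g.
Qed.

End InvariantsPoly.

Section InvariantsGlobal.
Variables (A B : comNzRingType) (i : {rmorphism A -> B}) (gT : finGroupType).
Variables (act : gT -> {rmorphism B -> B}) (G : {group gT}).
Hypothesis act1 : act 1%g =1 id.
Hypothesis actM : forall g h, act (g * h)%g =1 act h \o act g.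
Hypothesis fixed : forall b, (forall g, g \in G -> act g b = b) -> exists a, i a = b.

Let pact1 : (fun g => map_poly (act g) : {rmorphism {poly B} -> {poly B}}) 1%g =1 id.
Proof. by move=> Y; rewrite /= (eq_map_poly act1) map_poly_id. Qed.

Let pactM g h : map_poly (act (g * h)%g) =1 map_poly (act h) \o map_poly (act g).
Proof. by move=> Y; rewrite /= -map_poly_comp; apply: eq_map_poly; exact: actM. Qed.

(* One polynomial carries the values of a putative counterexample for each g,
   so the pointwise statement over B[T] gives a g that works everywhere. *)
Lemma conj_morphism (O : idomainType) (rho phi : {rmorphism B -> O}) :
  (forall a, phi (i a) = rho (i a)) -> exists2 g, g \in G & phi =1 rho \o act g.
Proof.
move=> phi_rho; apply: contrapT => nex.
have /(_ _)/cid bad g : exists b, g \in G -> phi b <> rho (act g b).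
  apply: contrapT => /forallNP nb; apply: nex; exists g => [|b /=].
    by apply: contrapT => gG; apply: (nb 0).
  by apply: contrapT => ne; apply: (nb b).
pose X := \poly_(k < #|gT|) (if insub k is Some k' then projT1 (bad (enum_val (k' : 'I_#|gT|))) else 0).
have XE g : X`_(enum_rank g) = projT1 (bad g).
  by rewrite coef_poly ltn_ord; case: insubP => [u _ /ord_inj ->|]; rewrite ?enum_rankK // ltn_ord.
have [|g gG /(congr1 (fun P : {poly O} => P`_(enum_rank g)))] :=
    @conj_eval _ _ (map_poly i) _ (fun g => map_poly (act g)) G pact1 pactM (fixed_poly fixed)
    X _ (map_poly rho) (map_poly phi).
  by move=> f /=; rewrite -!map_poly_comp; apply: eq_map_poly.
by rewrite !coef_map XE; case: (bad g) => b /= /(_ gG).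
Qed.

(** Again one polynomial carries a putative counterexample for every [g], this time fed to
    [conj_kernel]. *)
Lemma conj_kernels (O1 O2 : idomainType) (rho : {rmorphism B -> O2}) (phi : {rmorphism B -> O1}) :
  (forall a, phi (i a) = 0 -> rho (i a) = 0) ->
  exists2 g, g \in G & forall b, phi b = 0 -> rho (act g b) = 0.
Proof.
move=> phi_rho; apply: contrapT => nex.
have /(_ _)/cid bad g : exists b, phi b = 0 /\ (g \in G -> rho (act g b) <> 0).
  apply: contrapT => /forallNP nb; apply: nex; exists g => [|b phib].
    by apply: contrapT => gG; apply: (nb 0); rewrite rmorph0.
  by apply: contrapT => ne; apply: (nb b).
pose X := \poly_(k < #|gT|) (if insub k is Some k' then projT1 (bad (enum_val (k' : 'I_#|gT|))) else 0).
have XE g : X`_(enum_rank g) = projT1 (bad g).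
  by rewrite coef_poly ltn_ord; case: insubP => [u _ /ord_inj ->|]; rewrite ?enum_rankK // ltn_ord.
have [||g gG /(congr1 (fun P : {poly O2} => P`_(enum_rank g)))] :=
    @conj_kernel _ _ (map_poly i) _ (fun g => map_poly (act g)) G pact1 pactM (fixed_poly fixed)
    X _ _ (map_poly rho) (map_poly phi).
- move=> f f0; apply/polyP => k; rewrite !coef_map coef0; apply: phi_rho.
  by move/(congr1 (fun P : {poly O1} => P`_k)): f0; rewrite !coef_map coef0.
- apply/polyP => k; rewrite coef_map coef_poly coef0; case: ifP => [_|]; last by rewrite raddf0.
  by case: insubP => [u _ _|]; [case: (bad _) => b [] | rewrite raddf0].
by rewrite !coef_map coef0 XE; case: (bad g) => b /= [_ /(_ gG)].
Qed.

End InvariantsGlobal.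

Lemma prime_idealX (R : comNzRingType) (P : {pred R}) x n :
  prime_ideal P -> x ^+ n \in P -> x \in P.
Proof.
move=> pP; elim: n => [|n IHn]; first by rewrite expr0 (negPf (prime_ideal1 pP)).
by rewrite exprS prime_idealM // => /orP [].
Qed.

Section LyingOver.
Variables (A B : comNzRingType) (i : {rmorphism A -> B}) (gT : finGroupType).
Variables (act : gT -> {rmorphism B -> B}) (G : {group gT}).
Hypothesis act1 : act 1%g =1 id.
Hypothesis actM : forall g h, act (g * h)%g =1 act h \o act g.
Hypothesis fixed : forall b, (forall g, g \in G -> act g b = b) -> exists a, i a = b.
Hypothesis act_i : forall g, g \in G -> forall a, act g (i a) = i a.
Hypothesis i_inj : injective i.
Variable P : {pred A}.
Hypothesis primeP : prime_ideal P.

Let avoids (J : set B) : Prop :=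
  (forall a u v, J u -> J v -> J (a * u + v)) /\ (forall a, J (i a) -> a \in P).

(* A maximal element among the ideals J of B with i^-1(J) contained in P; the
   empty set is allowed so that chains have upper bounds. *)
Lemma lying_over : exists2 Q : {pred B}, prime_ideal Q & forall a, (i a \in Q) = (a \in P).
Proof.
have [J [[Jlin JP] Jmax]] : exists J, avoids J /\ forall J', (J `<` J')%classic -> ~ avoids J'.
  apply: Zorn_bigcup => C Cav Ctot; split=> [a u v [J1 CJ1 J1u] [J2 CJ2 J2v]|a [J1 CJ1 J1a]].
    have [/(_ _ J1u) J2u|/(_ _ J2v) J1v] := Ctot _ _ CJ1 CJ2.
      by exists J2 => //; apply: (proj1 (Cav _ CJ2)).
    by exists J1 => //; apply: (proj1 (Cav _ CJ1)).
  exact: (proj2 (Cav _ CJ1)) J1a.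
(* If [J] were empty, the zero ideal would be a larger admissible set. *)
have J0 : J 0.
  apply: contrapT => nJ0; apply: (Jmax [set 0]%classic).
    split; last by move=> /(_ 0 erefl).
    move=> x Jx; case: nJ0; rewrite -(subrr x) addrC -mulN1r; exact: Jlin.
  split=> [a _ _ -> ->|a /=]; first by rewrite /= mulr0 addr0.
  by rewrite -(rmorph0 i) => /i_inj ->; exact: prime_ideal0.
have JD u v : J u -> J v -> J (u + v) by move=> *; rewrite -[u]mul1r; exact: Jlin.
have JM a u : J u -> J (a * u) by move=> *; rewrite -[_ * _]addr0; exact: Jlin.
(* Maximality: the ideal [J + B u] must meet [A] outside [P]. *)
have Jext u : ~ J u -> exists a j b, [/\ a \notin P, J j & i a = j + b * u].
  move=> nJu; apply: contrapT => nex.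
  apply: (Jmax [set x | exists j b, J j /\ x = j + b * u]%classic).
    split; first by move=> j Jj; exists j, 0; rewrite mul0r addr0.
    by move=> /(_ u) sJ; apply/nJu/sJ; exists 0, 1; rewrite mul1r add0r.
  split=> [a _ _ [j [b [Jj ->]]] [j' [b' [Jj' ->]]]|a [j [b [Jj Da]]]].
    exists (a * j + j'), (a * b + b'); split; first exact: Jlin.
    by rewrite mulrDl mulrDr addrACA mulrA.
  by apply: contrapT => /negP aP; apply: nex; exists a, j, b.
pose Q : {pred B} := fun b => `[< J b >].
have QE b : b \in Q <-> J b by split=> [/asboolP|/asboolP].
have primeQ : prime_ideal Q.
  split; [split|].
  - exact/QE.
  - apply/negP => /QE; rewrite -(rmorph1 i) => /JP; exact/negP/prime_ideal1.
  - by move=> a u v /QE Ju /QE Jv; apply/QE; exact: Jlin.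
  - move=> u v /QE Juv; apply/orP; apply: contrapT => /not_orP [nu nv].
    have [a [j [b [aP Jj Da]]]] := Jext u (fun h => nu (proj2 (QE _) h)).
    have [a' [j' [b' [a'P Jj' Da']]]] := Jext v (fun h => nv (proj2 (QE _) h)).
    have /negP : a * a' \notin P by rewrite prime_idealM // negb_or aP.
    apply; apply: JP; rewrite rmorphM Da Da' mulrDl.
    have -> : j * (j' + b' * v) + b * u * (j' + b' * v) = (j' + b' * v) * j + ((b * u) * j' + (b * b') * (u * v)).
      by rewrite mulrC; congr (_ + _); rewrite mulrDr mulrACA.
    by apply: (JD); [exact: JM | apply: JD; exact: JM].
exists Q => // a; apply/idP/idP => [/QE/JP //|aP].
apply/QE; apply: contrapT => /Jext [s [j [b [sP Jj Ds]]]].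
(* The norm of [s - b X] takes the value [s^#|G|] at 0, and its value at [a] has the factor
   [i s - b (i a) = j], so lies in [P]. As [a] is in [P], the two values agree modulo [P], which
   forces [s] into [P]. *)
have [F DF] := @fixed_norm_poly _ _ i _ act G actM fixed ((i s)%:P - b *: 'X).
have FE x : (map_poly i F).[x] = \prod_(g in G) (i s - act g b * x).
  rewrite DF horner_prod; apply: eq_bigr => g gG.
  by rewrite rmorphB /= map_polyC map_polyZ map_polyX /= act_i // !hornerE.
have F0 : F.[0] = s ^+ #|G|.
  apply: i_inj; rewrite -horner_map FE rmorphXn -prodr_const.
  by apply: eq_bigr => g _; rewrite rmorph0 mulr0 subr0.
have JFa : J (i F.[a]).
  rewrite -horner_map FE (bigD1 1%g) //= act1 Ds addrK mulrC; exact: JM.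
have [F1 DF1] : exists F1, F = F1 * 'X + F.[0]%:P.
  have /factor_theorem [F1 DF1] : root (F - F.[0]%:P) 0 by rewrite rootE !hornerE subrr.
  by exists F1; rewrite -[LHS](subrK F.[0]%:P) DF1 subr0.
have : s ^+ #|G| \in P.
  rewrite -F0; have -> : F.[0] = F.[a] - F1.[a] * a.
    by rewrite [in F.[a]]DF1 !hornerE addrC addKr.
  by apply: prime_idealB => //; [exact: JP | exact: prime_idealMl].
by move/(prime_idealX primeP); apply/negP.
Qed.
End LyingOver.

(** * Rings of integers and the Galois action on their primes *)

Fact int_val_zmod (L : fieldType) : zmod_morphism (@int_val L).
Proof. exact: (raddfB \val). Qed.
Fact int_val_monoid (L : fieldType) : monoid_morphism (@int_val L).
Proof. by split; [exact: (rmorph1 \val) | exact: (rmorphM \val)]. Qed.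
HB.instance Definition _ (L : fieldType) :=
  GRing.isZmodMorphism.Build (int_ring L) L (@int_val L) (@int_val_zmod L).
HB.instance Definition _ (L : fieldType) :=
  GRing.isMonoidMorphism.Build (int_ring L) L (@int_val L) (@int_val_monoid L).

Section IntMap.
Variables (L M : fieldType) (f : {rmorphism L -> M}).

Fact int_map_zmod : zmod_morphism (int_map f).
Proof. by move=> x y; apply: val_inj; exact: rmorphB. Qed.
Fact int_map_monoid : monoid_morphism (int_map f).
Proof. by split=> [|x y]; apply: val_inj; [exact: rmorph1 | exact: rmorphM]. Qed.
HB.instance Definition _ :=
  GRing.isZmodMorphism.Build (int_ring L) (int_ring M) (int_map f) int_map_zmod.
HB.instance Definition _ :=
  GRing.isMonoidMorphism.Build (int_ring L) (int_ring M) (int_map f) int_map_monoid.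

Lemma int_map_inj : injective (int_map f).
Proof. by move=> x y /(congr1 val) /(fmorph_inj f) ?; apply: val_inj. Qed.

Lemma int_elt_fmorph x : (f x \in @int_elt M) = (x \in @int_elt L).
Proof.
apply/asboolP/asboolP => [[q mq q0]|ix].
  exists q => //; rewrite -(fmorph_root f) -map_poly_comp.
  by rewrite (eq_map_poly (_ : _ =1 intr)) // => c /=; rewrite rmorph_int.
have := integral_rmorph f ix.
by congr (integralOver _ _); apply/funext => k /=; rewrite rmorph_int.
Qed.

End IntMap.

Section SubEmbed.
Variables (F : fieldExtType rat) (K K' : splittingFieldType F) (iota : 'AHom(K, K')).
Variables (E : {subfield K}) (E' : {subfield K'}).

Definition sub_embed of (iota @: E <= E')%VS := fun x : subvs_of E => vsproj E' (iota (vsval x)).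

Hypothesis sEE' : (iota @: E <= E')%VS.

Lemma sub_embedE x : vsval (sub_embed sEE' x) = iota (vsval x).
Proof. by rewrite vsprojK // (subvP sEE') // memv_img // subvsP. Qed.

Fact sub_embed_zmod : zmod_morphism (sub_embed sEE').
Proof.
move=> x y; apply: val_inj; rewrite [LHS]sub_embedE.
by rewrite [RHS](raddfB vsval) /= !sub_embedE !raddfB.
Qed.
Fact sub_embed_monoid : monoid_morphism (sub_embed sEE').
Proof.
split=> [|x y]; apply: val_inj; rewrite [LHS]sub_embedE; first by rewrite [in LHS](rmorph1 vsval) [RHS](rmorph1 vsval) rmorph1.
by rewrite [RHS](rmorphM vsval) /= !sub_embedE rmorphM.
Qed.
HB.instance Definition _ :=
  GRing.isZmodMorphism.Build (subvs_of E) (subvs_of E') (sub_embed sEE') sub_embed_zmod.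
HB.instance Definition _ :=
  GRing.isMonoidMorphism.Build (subvs_of E) (subvs_of E') (sub_embed sEE') sub_embed_monoid.

Lemma sub_embed_base x : sub_embed sEE' (base_embed E x) = base_embed E' x.
Proof.
by apply: val_inj; rewrite [LHS]sub_embedE /= !linearZ /= !algid1 rmorph1.
Qed.

Lemma sub_embed_gal s t x : restricts iota s t ->
  sub_embed sEE' (gal_act t x) = gal_act s (sub_embed sEE' x).
Proof.
move=> st; apply: val_inj; rewrite [LHS]sub_embedE [RHS]gal_actE [in LHS]gal_actE sub_embedE.
exact: st (subvsP x).
Qed.

Lemma lies_over_restr v (P : {pred int_ring (subvs_of E')}) : lies_over v P ->
  lies_over v (fun x => int_map (sub_embed sEE') x \in P).
Proof.
case=> pP vP; split; first exact: (prime_ideal_preim (int_map (sub_embed sEE')) pP).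
move=> x; rewrite -vP unfold_in; congr (_ \in P).
by apply: val_inj; exact: sub_embed_base.
Qed.

End SubEmbed.

Section Places.
Variables (F : fieldExtType rat) (K : splittingFieldType F) (E : {subfield K}).

Definition gal_int (s : gal_of E) : {rmorphism int_ring (subvs_of E) -> int_ring (subvs_of E)} :=
  int_map (gal_act s).

Lemma gal_act1 : gal_act (1%g : gal_of E) =1 id.
Proof. by move=> x; apply: val_inj; rewrite [LHS]gal_actE gal_id. Qed.

Lemma gal_actM (s t : gal_of E) : gal_act (s * t)%g =1 gal_act t \o gal_act s.
Proof.
by move=> x; apply: val_inj; rewrite [LHS]gal_actE galM ?subvsP // [RHS]gal_actE gal_actE.
Qed.

Lemma gal_act_base (s : gal_of E) x : gal_act s (base_embed E x) = base_embed E x.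
Proof. by apply: val_inj; rewrite [LHS]gal_actE /= linearZ /= !algid1 rmorph1. Qed.

Lemma gal_int1 : gal_int 1%g =1 id.
Proof. by move=> x; apply: val_inj; exact: gal_act1. Qed.

Lemma gal_intM s t : gal_int (s * t)%g =1 gal_int t \o gal_int s.
Proof. by move=> x; apply: val_inj; exact: gal_actM. Qed.

Lemma gal_int_base s x : gal_int s (int_map (base_embed E) x) = int_map (base_embed E) x.
Proof. by apply: val_inj; exact: gal_act_base. Qed.

Hypothesis galE : galois 1%AS E.

(** Integrality is reflected by the embedding of [F], so the integers of [F] and of [E] with the
    Galois group are an instance of the invariant setting above. *)
Lemma gal_int_fixed b : (forall g, g \in [set: gal_of E] -> gal_int g b = b) ->
  exists a, int_map (base_embed E) a = b.
Proof.
move=> fb; have : vsval (val b) \in fixedField 'Gal(E / 1)%g.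
  apply/fixedFieldP => [|s _]; first exact: subvsP.
  by have /(congr1 val)/(congr1 val) := fb s (finset.in_setT _); rewrite [LHS]gal_actE.
have /galois_fixedField -> := galE; case/vlineP => c Dc.
have Db : base_embed E c = val b by apply: val_inj; rewrite /= ?linearZ /= algid1 Dc.
have ci : c \in @int_elt F by rewrite -(int_elt_fmorph (base_embed E)); move: (valP b); rewrite -Db.
by exists (IntRing ci); apply: val_inj.
Qed.

(** [conj_kernels] only carries one prime into another. With [s] mapping [Q] into [P] and [t]
    mapping [P] into [Q], the product [s * t] preserves [Q] and has finite order, so the inclusions
    are equalities. *)
Lemma places_conjugate v (P Q : {pred int_ring (subvs_of E)}) :
  lies_over v P -> lies_over v Q -> exists s, forall x, (gal_int s x \in P) = (x \in Q).
Proof.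
suff sub P' Q' : lies_over v P' -> lies_over v Q' ->
    exists s, forall x, x \in Q' -> gal_int s x \in P'.
  move=> vP vQ; have [[s sQP] [t tPQ]] := (sub _ _ vP vQ, sub _ _ vQ vP).
  exists s => x; apply/idP/idP => [sxP|]; last exact: sQP.
  have stX n y : y \in Q -> gal_int ((s * t) ^+ n)%g y \in Q.
    elim: n y => [|n IHn] y yQ; first by rewrite gal_int1.
    by rewrite expgS gal_intM /=; apply: IHn; rewrite gal_intM /=; apply: tPQ; apply: sQP.
  have := stX #[(s * t)%g]%g.-1 _ (tPQ _ sxP).
  have -> : gal_int t (gal_int s x) = gal_int (s * t)%g x by rewrite gal_intM.
  have -> : gal_int ((s * t) ^+ #[(s * t)%g]%g.-1)%g (gal_int (s * t)%g x) = gal_int ((s * t) * (s * t) ^+ #[(s * t)%g]%g.-1)%g x.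
    by rewrite [RHS]gal_intM.
  by rewrite -expgS prednK // expg_order gal_int1.
move=> [pP vP] [pQ vQ].
have [O1 [phi [_ Dphi]]] := prime_ideal_quotient pQ.
have [O2 [rho [_ Drho]]] := prime_ideal_quotient pP.
have [|s _ sP] := conj_kernels (G := [set: gal_of E]%G) gal_int1 gal_intM gal_int_fixed (rho := rho) (phi := phi).
  by move=> a /eqP; rewrite Dphi vQ -vP -Drho => /eqP.
by exists s => x xQ; rewrite -Drho; apply/eqP/sP/eqP; rewrite Dphi.
Qed.

Lemma place_above v : prime_ideal v -> exists P : {pred int_ring (subvs_of E)}, lies_over v P.
Proof.
move=> pv; have [||P pP vP] := lying_over (i := int_map (base_embed E)) (G := [set: gal_of E]%G) gal_int1 gal_intM gal_int_fixed _ _ pv.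
- by move=> s _ a; exact: gal_int_base.
- exact: int_map_inj.
by exists P.
Qed.

End Places.

(** * Valuations and ramification in cyclotomic extensions *)

Lemma horner_int_morph (R S : nzRingType) (g : {rmorphism R -> S}) (q : {poly int}) x :
  (map_poly intr q).[g x] = g (map_poly intr q).[x].
Proof.
rewrite -horner_map -map_poly_comp; congr (_.[_]).
by apply: eq_map_poly => c /=; rewrite rmorph_int.
Qed.

(** Dividing by the content keeps an algebraic relation nontrivial modulo [p]. *)
Lemma primitive_int_poly (p : nat) (q : {poly rat}) : prime p -> q != 0 ->
  exists (r : {poly int}) (a : rat),
    [/\ a != 0, map_poly intr r = a *: q & exists k, ~~ (p %| r`_k)%Z].
Proof.
move=> p_pr q0; have [q1 [a a0 Dq]] := rat_poly_scale q.
have q1_0 : q1 != 0.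
  by apply: contraNneq q0 => q10; rewrite Dq q10 rmorph0 scaler0.
have z0 : (zcontents q1)%:~R != 0 :> rat by rewrite intr_eq0 zcontents_eq0.
have a0' : a%:~R != 0 :> rat by rewrite intr_eq0.
exists (zprimitive q1), (a%:~R / (zcontents q1)%:~R); split.
- by rewrite mulf_neq0 ?invr_eq0.
- have Dq1 : map_poly intr q1 = (zcontents q1)%:~R *: map_poly intr (zprimitive q1) :> {poly rat}.
    by rewrite {1}(zpolyEprim q1) map_polyZ.
  by rewrite Dq scalerA mulrAC divff // mul1r Dq1 scalerA mulVf // scale1r.
apply: contrapT => /forallNP nk.
have : (p %| zcontents (zprimitive q1))%Z.
  by rewrite dvdz_contents; apply/polyOverP => k; move: (nk k) => /negP; rewrite negbK.
by rewrite zcontents_primitive q1_0 dvdzE /= dvdn1 => /eqP p1; rewrite p1 in p_pr.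
Qed.

Section PrimesAboveP.
Variables (p : nat) (p_pr : prime p) (L : fieldType) (P : {pred int_ring L}).
Hypotheses (primeP : prime_ideal P) (pP : p%:R \in P).

Lemma int_in_prime (c : int) : (c%:~R \in P) = (p %| c)%Z.
Proof.
have [O [rho [_ Drho]]] := prime_ideal_quotient primeP.
have pO : p \in [pchar O] by rewrite inE p_pr /= -(rmorph_nat rho) Drho.
by rewrite (dvdz_pcharf pO) -Drho rmorph_int.
Qed.

Lemma nat_in_prime (c : nat) : (c%:R \in P) = (p %| c)%N.
Proof. by rewrite -[c%:R]/((Posz c)%:~R) int_in_prime. Qed.

(** In the quotient, a domain of characteristic [p], the image of [x] satisfies a relation that is
    nontrivial modulo [p]. Constant terms divisible by [p] are stripped, cancelling [x], until one
    is prime to [p]. *)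
Lemma prime_maximal x : x \notin P -> exists y, x * y - 1 \in P.
Proof.
have [O [rho [surj Drho]]] := prime_ideal_quotient primeP.
have pO : p \in [pchar O] by rewrite inE p_pr /= -(rmorph_nat rho) Drho.
move=> xP; have x0 : rho x != 0 by rewrite Drho.
have [q mq qx] : integralOver (intr : int -> L) (val x) by apply/asboolP; exact: valP x.
have qx0 : (map_poly intr q).[rho x] = 0.
  rewrite horner_int_morph (_ : (map_poly intr q).[x] = 0) ?rmorph0 //.
  by apply: val_inj; exact: etrans (esym (horner_int_morph \val q x)) (eqP qx).
have : exists k, ~~ (p %| q`_k)%Z.
  by exists (size q).-1; rewrite -/(lead_coef q) (monicP mq) dvdzE /= dvdn1 neq_ltn prime_gt1 ?orbT.
suff inv (r : {poly int}) : (map_poly intr r).[rho x] = 0 -> (exists k, ~~ (p %| r`_k)%Z) ->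
    exists y, rho x * y = 1.
  move=> /(inv _ qx0) [y xy]; have [z Dz] := surj y.
  by exists z; rewrite -Drho rmorphB rmorphM Dz xy rmorph1 subrr.
elim/poly_ind: r => [_ [k]|r c IHr]; first by rewrite coef0 dvdz0.
rewrite rmorphD rmorphM /= map_polyX map_polyC hornerMXaddC /= => rc [k pk].
have [pc|pc] := boolP (p %| c)%Z.
  apply: IHr; last first.
    case: k pk => [|k]; first by rewrite coefD coefMX coefC add0r pc.
    by rewrite coefD coefMX coefC addr0 => ?; exists k.
  move: rc; rewrite (dvdz_pcharf pO) in pc; rewrite (eqP pc) addr0 => /eqP.
  by rewrite mulf_eq0 (negPf x0) orbF => /eqP.
have /coprimezP [[u v] /= uv] : coprimez p c by rewrite coprimezE /= prime_coprime // -dvdzE.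
(* From [r(x) x + c = 0] and [u p + v c = 1], modulo [p]. *)
exists (- (map_poly intr r).[rho x] * v%:~R).
rewrite mulrA mulrN [rho x * _]mulrC.
move/eqP: rc; rewrite addrC addr_eq0 => /eqP <-.
rewrite -[1 in RHS]/(1%:~R) -uv rmorphD !rmorphM /=.
by rewrite (_ : p%:~R = 0 :> O) ?mulr0 ?add0r 1?mulrC //; exact: (pcharf0 pO).
Qed.

End PrimesAboveP.

Section Valuation.
Variables (p : nat) (p_pr : prime p) (L : fieldType) (P : {pred int_ring L}).
Hypotheses (primeP : prime_ideal P) (pP : p%:R \in P).
Local Notation O := (int_ring L).

(** Multiplying the relation by [c^n], with [c] its coefficient of degree [n + 1], makes it monic in
    [c b]. *)
Lemma lead_mul_integral (q : {poly O}) (b : L) (n : nat) :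
  (size q <= n.+2)%N -> (map_poly (@int_val L) q).[b] = 0 -> int_val q`_n.+1 * b \in @int_elt L.
Proof.
move=> sq qb; set c := q`_n.+1.
pose r0 : {poly O} := 'X^(n.+1) + \poly_(k < n.+1) (q`_k * c ^+ (n - k)).
have mr : r0 \is monic.
  by rewrite /r0 monicE lead_coefDl ?lead_coefXn // size_polyXn ltnS size_poly.
apply/asboolP; apply: (integral_root_monic (p := map_poly (@int_val L) r0)).
- exact: monic_map.
- have qE : int_val c * b ^+ n.+1 + \sum_(k < n.+1) int_val q`_k * b ^+ k = (map_poly (@int_val L) q).[b].
    rewrite (horner_coef_wide _ (n := n.+2)); last by rewrite size_map_inj_poly //; exact: (val_inj (sT := int_ring L)).
    rewrite [RHS]big_ord_recr /= [RHS]addrC coef_map; congr (_ + _).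
    by apply: eq_bigr => k _; rewrite coef_map.
  rewrite rootE rmorphD /= map_polyXn hornerD hornerXn.
  rewrite (horner_coef_wide _ (n := n.+1)); last by rewrite size_map_inj_poly ?size_poly //; exact: (val_inj (sT := int_ring L)).
  have cnq : int_val c ^+ n * (int_val c * b ^+ n.+1 + \sum_(k < n.+1) int_val q`_k * b ^+ k) = 0.
    by rewrite qE qb mulr0.
  apply/eqP; apply: etrans cnq; rewrite mulrDr mulrA -exprSr exprMn; congr (_ + _).
  rewrite mulr_sumr; apply: eq_bigr => k _.
  rewrite coef_map coef_poly ltn_ord /= rmorphXn exprMn -mulrA.
  rewrite [int_val c ^+ n * _]mulrCA; congr (_ * _); rewrite mulrA -exprD subnK //.
  by rewrite -ltnS.
apply/integral_poly => k; rewrite coef_map; by have /asboolP := valP (r0`_k).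
Qed.

(* The u-or-u^-1 lemma: lowering the degree of a relation satisfied by b while
   keeping a coefficient outside P shows that the localisation at P is a
   valuation ring. *)
Lemma valuation_dichotomy (q : {poly O}) (b : L) :
  (map_poly (@int_val L) q).[b] = 0 -> (exists k, q`_k \notin P) ->
  (exists2 s, s \notin P & int_val s * b \in @int_elt L) \/
  (b != 0 /\ exists2 s, s \notin P & int_val s / b \in @int_elt L).
Proof.
have [-> _ _|b0] := eqVneq b 0.
  by left; exists 1; rewrite ?prime_ideal1 ?mulr0 ?rpred0.
have [n] := ubnP (size q); elim: n q => // n IHn q; rewrite ltnS => sq qb [k kP].
case: n => [|n] in IHn sq *.
  move: sq; rewrite leqn0 size_poly_eq0 => /eqP q0.
  by rewrite q0 coef0 prime_ideal0 in kP.
case: n => [|n] in IHn sq *.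
  have qC := size1_polyC sq; rewrite qC coefC in kP.
  case: eqP kP => [_ kP|_]; last by rewrite prime_ideal0.
  move: qb; rewrite qC map_polyC hornerC /= => /eqP.
  by rewrite -(rmorph0 (@int_val L)) => /eqP/val_inj q0; rewrite q0 prime_ideal0 in kP.
have ci := lead_mul_integral sq qb; set c := q`_n.+1 in ci.
have [cP|cP] := boolP (c \in P); last by left; exists c.
pose u : O := IntRing ci.
(* The leading term is folded into the next one: [c b^(n+1) = u b^n] with [u = c b] integral. *)
pose q' := \poly_(k < n.+1) q`_k + u *: 'X^n.
have q'b : (map_poly (@int_val L) q').[b] = 0.
  rewrite -qb rmorphD /= map_polyZ map_polyXn /= !hornerE [in RHS](horner_coef_wide _ (n := n.+2)); last by rewrite size_map_inj_poly //; exact: (val_inj (sT := int_ring L)).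
  rewrite [in RHS]big_ord_recr /= coef_map -/c exprS mulrA; congr (_ + _).
  rewrite (horner_coef_wide _ (n := n.+1)); last by rewrite size_map_inj_poly ?size_poly //; exact: (val_inj (sT := int_ring L)).
  by apply: eq_bigr => j _; rewrite !coef_map coef_poly ltn_ord.
have [[j jP]|allP] := pselect (exists j, q'`_j \notin P).
  apply: (IHn q') => //; last by exists j.
  rewrite ltnS (leq_trans (size_polyD _ _)) // geq_max size_poly.
  by rewrite (leq_trans (size_scale_leq _ _)) // size_polyXn.
(* Folding changes only the coefficient of degree [n], so [k = n] and [u] is outside [P]; then
   [u / b = c] is integral. *)
right; split=> //.
have all_in j : q'`_j \in P by apply: contrapT => /negP jP; apply: allP; exists j.
have := all_in k; rewrite coefD coef_poly coefZ coefXn.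
case: ltngtP => [kn|kn|kn].
- case: eqP => [kn'|_]; last by rewrite mulr0 addr0 (negPf kP).
  rewrite mulr1 => quP; exists u => //; last first.
    by rewrite /= mulfK //; exact: (valP c).
  by apply: contra kP => uP; rewrite -(addrK u q`_k) prime_idealB.
- move: kP; rewrite nth_default ?prime_ideal0 // (leq_trans sq) //.
- by move: kP; rewrite kn -/c cP.
Qed.

Hypothesis algL : forall x : L, exists q : {poly int},
  (exists k, ~~ (p %| q`_k)%Z) /\ (map_poly intr q).[x] = 0.

(** The dichotomy is applied to [a / pi]. If it is the inverse that becomes integral, [s pi = a y],
    then [y] is outside [P], since otherwise [pi] would be in [P^2], and [y] serves as the
    denominator. *)
Lemma prime_uniformizer (pi : O) : pi \in P -> pi \notin ideal_mul P P ->
  forall a, a \in P -> exists2 s, s \notin P & exists y, s * a = pi * y.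
Proof.
move=> piP piP2 a aP.
have pi0 : pi != 0.
  by apply: contraNneq piP2 => ->; apply/asboolP; exists [::]; rewrite ?big_nil.
have vpi0 : int_val pi != 0 by apply: contra pi0 => /eqP; rewrite -(rmorph0 (@int_val L)) => /val_inj ->.
have [q [[k kq] qb]] := algL (int_val a / int_val pi).
have mapq : map_poly (@int_val L) (map_poly intr q : {poly O}) = map_poly intr q.
  by rewrite -map_poly_comp; apply: eq_map_poly => c /=; rewrite (rmorph_int (@int_val L)).
have [||[s sP si]|[b0 [s sP si]]] := @valuation_dichotomy (map_poly intr q) (int_val a / int_val pi).
- by rewrite mapq.
- by exists k; rewrite coef_map /= (int_in_prime p_pr primeP pP).
- exists s => //; exists (IntRing si); apply: val_inj; rewrite /=.
  by rewrite [RHS]mulrC mulrA divfK.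
have a0 : int_val a != 0 by apply: contraNneq b0 => ->; rewrite mul0r.
pose y : O := IntRing si.
have Dy : s * pi = a * y.
  by apply: val_inj; rewrite /= invf_div mulrCA [int_val a * _]mulrC divfK.
exists y; last by exists s; rewrite [LHS]mulrC -Dy mulrC.
apply: contra piP2 => yP.
have [t tP] := prime_maximal p_pr primeP pP sP.
(* Here [t] inverts [s] modulo [P], and [pi = a y t + (1 - s t) pi]. *)
apply/asboolP; exists [:: (a, y * t); (1 - s * t, pi)].
  rewrite /= aP prime_idealMr // piP andbT /= -opprB -mulN1r prime_idealMl //.
rewrite !big_cons big_nil addr0 /= mulrBl mul1r mulrA -Dy.
by rewrite [s * t * pi]mulrAC addrC subrK.
Qed.

End Valuation.

(** * Unramifiedness of adjoining roots of unity of order prime to p *)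

Section UnramifiedAlgebra.
Variables (A B : comNzRingType) (i : {rmorphism A -> B}) (gT : finGroupType).
Variables (act : gT -> {rmorphism B -> B}) (G : {group gT}).
Hypothesis act1 : act 1%g =1 id.
Hypothesis actM : forall g h, act (g * h)%g =1 act h \o act g.
Hypothesis fixed : forall b, (forall g, g \in G -> act g b = b) -> exists a, i a = b.
Variables (P : {pred B}) (z : B).
Hypothesis primeP : prime_ideal P.
Hypothesis z_sep : forall g, g \in G -> g != 1%g -> z - act g z \notin P.

(* Lagrange interpolation at the conjugates of z. *)
Lemma unramified_generation x : x \in P ->
  exists2 s, s \notin P & exists2 q : {poly A}, forall k, i q`_k \in P & s * x = (map_poly i q).[z].
Proof.
move=> xP.
(* If no element outside [P] is sent into [P] by [g], then [g^-1] preserves [P]; by finite order so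
   does [g], and [e = 1] works. *)
have /(_ _)/cid mover g : exists e, e \notin P /\ act g (e * x) \in P.
  have [[e eP geP]|noe] := pselect (exists2 e, e \notin P & act g e \in P).
    by exists e; rewrite rmorphM prime_idealMr.
  have sub e : act g e \in P -> e \in P.
    by move=> geP; apply: contrapT => /negP eP; apply: noe; exists e.
  have inv y : y \in P -> act g^-1%g y \in P.
    by move=> yP; apply: sub; rewrite -[act g _]/((act g \o act g^-1%g) y) -actM mulVg act1.
  have invX n y : y \in P -> act (g^-1 ^+ n)%g y \in P.
    elim: n y => [|n IHn] y yP; first by rewrite act1.
    by rewrite expgSr actM /=; apply: inv; apply: IHn.
  exists 1; rewrite prime_ideal1 // mul1r; split=> //.
  have -> : g = (g^-1 ^+ #[g^-1]%g.-1)%g by rewrite -invg_expg invgK.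
  exact: invX.
pose e := \prod_(g in G) projT1 (mover g).
have eP : e \notin P by apply: prime_ideal_prod => // g _; case: (mover g) => ? [].
have geP g : g \in G -> act g (e * x) \in P.
  move=> gG; rewrite /e (bigD1 g) //= mulrAC rmorphM prime_idealMr //.
  by case: (mover g) => ? [].
(* The interpolation polynomial taking at each node [g z] the value [g (e x)] times the product of
   node differences. It is invariant, so it comes from [A]; the multiplier [e] puts its coefficients
   in [P]; at [z] only the summand of the identity survives. *)
pose X := \sum_(g in G) (act g (e * x))%:P * \prod_(h in G | h != g) ('X - (act h z)%:P).
have [q Dq] : exists q, map_poly i q = X.
  apply: (fixed_poly fixed) => k kG; rewrite rmorph_sum /= [RHS](reindex_inj (mulIg k)) /=.
  apply: eq_big => [g|g gG]; first by rewrite groupMr.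
  rewrite [LHS](rmorphM (map_poly (act k))) /= map_polyC actM; congr (_ * _).
  rewrite rmorph_prod [RHS](reindex_inj (mulIg k)) /=.
  apply: eq_big => [h|h _]; first by rewrite groupMr // (inj_eq (mulIg k)).
  by rewrite rmorphB /= map_polyX map_polyC /= actM.
exists (e * \prod_(h in G | h != 1%g) (z - act h z)).
  rewrite prime_idealM // negb_or eP; apply: prime_ideal_prod => // h /andP[]; exact: z_sep.
exists q => [k|].
  rewrite -coef_map Dq coef_sum; apply: prime_ideal_sum => // g gG.
  by rewrite coefCM prime_idealMr // geP.
rewrite Dq horner_sum [RHS](bigD1 1%g) //= [X in _ = _ + X]big1 ?addr0 => [|g /andP[gG g1]].
  rewrite hornerM hornerC act1 horner_prod mulrAC; congr (_ * _).
  by apply: eq_bigr => h _; rewrite !hornerE.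
rewrite hornerM horner_prod (bigD1 1%g) /= ?group1 1?eq_sym //.
by rewrite act1 hornerXsubC subrr mul0r mulr0.
Qed.

End UnramifiedAlgebra.

(** For [y != z] the sum of the [y^(m-1-k) z^k], that is [(y^m - z^m) / (y - z)], vanishes. If [y]
    and [z] were congruent modulo [P], it would be congruent to [m z^(m-1)], which is outside
    [P]. *)
Lemma unity_root_sub_notin (L : fieldType) (P : {pred int_ring L}) (m : nat) (y z : int_ring L) :
  prime_ideal P -> m%:R \notin P -> y ^+ m = 1 -> z ^+ m = 1 -> y != z -> y - z \notin P.
Proof.
move=> primeP mP ym zm yz; have [m0|m_gt0] := posnP m.
  by rewrite m0 prime_ideal0 in mP.
have : (\sum_(k < m) y ^+ (m.-1 - k) * z ^+ k) = 0.
  apply: (int_map_inj (f := idfun)); apply: val_inj; rewrite /=.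
  have yz0 : int_val (y - z) != 0.
    by rewrite rmorphB subr_eq0; apply: contra yz => /eqP/val_inj ->.
  by apply: (mulfI yz0); rewrite -rmorphM -subrXX ym zm subrr !rmorph0 mulr0.
move=> sum0; apply: contra mP => yzP.
have zP k : z ^+ k \notin P.
  apply/negP => /(prime_idealX primeP) zP.
  have := prime_idealX (n := m) primeP; have /negP := prime_ideal1 primeP.
  by rewrite -zm -(prednK m_gt0) exprS prime_idealMr.
have : z ^+ m.-1 * m%:R \in P.
  have -> : z ^+ m.-1 * m%:R = - \sum_(k < m) (y ^+ (m.-1 - k) * z ^+ k - z ^+ m.-1).
    by rewrite sumrB sum0 sub0r opprK sumr_const card_ord mulr_natr.
  rewrite -mulN1r prime_idealMl // prime_ideal_sum // => k _.
  have -> : z ^+ m.-1 = z ^+ (m.-1 - k) * z ^+ k.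
    by rewrite -exprD subnK // -ltnS prednK.
  by rewrite -mulrBl prime_idealMr // subrXX prime_idealMr.
by rewrite prime_idealM // (negPf (zP _)).
Qed.

Lemma num_field_algebraic (L : fieldExtType rat) (p : nat) (x : L) : prime p ->
  exists q : {poly int}, (exists k, ~~ (p %| q`_k)%Z) /\ (map_poly intr q).[x] = 0.
Proof.
move=> p_pr; have /polyOver1P [q0 Dq0] := minPolyOver 1 x.
have q0_neq0 : q0 != 0 by rewrite -(map_poly_eq0 (in_alg L)) -Dq0 monic_neq0 ?monic_minPoly.
have [r [a [a0 Dr rp]]] := primitive_int_poly p_pr q0_neq0.
exists r; split=> //.
have -> : map_poly intr r = map_poly (in_alg L) (map_poly intr r).
  by rewrite -map_poly_comp; apply: eq_map_poly => c /=; rewrite -in_algE rmorph_int.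
by rewrite Dr map_polyZ -Dq0 hornerZ minPolyxx mulr0.
Qed.

Lemma subvs_algebraic (F : fieldExtType rat) (K : fieldExtType F) (E : {subfield K}) (p : nat) (x : subvs_of E) :
  prime p -> exists q : {poly int}, (exists k, ~~ (p %| q`_k)%Z) /\ (map_poly intr q).[x] = 0.
Proof. exact: (@num_field_algebraic (baseFieldType (subvs_of E))). Qed.

Section RamificationTransfer.
Variables (F : fieldExtType rat) (K K' : splittingFieldType F) (iota : 'AHom(K, K')).
Variables (E : {subfield K}) (E' : {subfield K'}).
Hypothesis sEE' : (iota @: E <= E')%VS.
Let j := sub_embed sEE' : {rmorphism subvs_of E -> subvs_of E'}.

Lemma int_map_base v : int_map j (int_map (base_embed E) v) = int_map (base_embed E') v.
Proof. by apply: val_inj; exact: sub_embed_base. Qed.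

(** [ramified] asks for a single [P]; a conjugation carries it to the contraction of a prime [Q] of
    [E'], and sums of products from [P] go to sums of products from [Q]. *)
Lemma ramified_up v : galois 1%AS E -> galois 1%AS E' -> prime_ideal v ->
  ramified E v -> ramified E' v.
Proof.
move=> galE galE' pv [P vP ramP].
have [Q vQ] := place_above galE' pv.
have vQE := lies_over_restr sEE' vQ; rewrite -/j in vQE.
have [s sP] := places_conjugate galE vQE vP.
exists Q => // x xv; have /asboolP [l lP Dx] := ramP x xv.
apply/asboolP; exists [seq (int_map j (gal_int s q.1), int_map j (gal_int s q.2)) | q <- l].
  apply/allP => _ /mapP [q ql ->] /=; have /andP[q1 q2] := allP lP _ ql.
  by apply/andP; split; [have := sP q.1; rewrite q1 | have := sP q.2; rewrite q2].
rewrite -int_map_base -(gal_int_base s) Dx !rmorph_sum big_map.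
by apply: eq_bigr => q _; rewrite !rmorphM.
Qed.

Variables (p m : nat) (p_pr : prime p) (z : K').
Hypotheses (pm : ~~ (p %| m)%N) (zm : z ^+ m = 1) (genE' : <<(iota @: E)%AS; z>>%VS = E').

(** If some [x] in [v] had image [pi] outside [P^2], with [P] the contraction of [Q], then [pi]
    would generate [P] locally, and also [Q], because distinct conjugates of [z] stay distinct
    modulo [Q]. But [pi] is in [Q^2], so [s pi = pi^2 w] with [s] outside [Q]; cancelling [pi] puts
    [s] in [Q]. *)
Lemma ramified_down v : galois 1%AS E' -> p%:R \in v -> ramified E' v -> ramified E v.
Proof.
move=> galE' pv [Q vQ ramQ].
have [pQ _] := vQ.
have vP := lies_over_restr sEE' vQ; set P := (fun x => _) in vP.
have [pP vPE] := vP.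
exists P => // x xv; apply: contrapT => /negP xP2.
set pi := int_map (base_embed E) x in xP2.
have piP : pi \in P by rewrite vPE.
have pP' : p%:R \in P by rewrite -(rmorph_nat (int_map (base_embed E))) vPE.
have pQ' : p%:R \in Q by rewrite -(rmorph_nat (int_map (base_embed E'))) (proj2 vQ).
have unif := prime_uniformizer p_pr pP pP' (fun y => subvs_algebraic y p_pr) piP xP2.
have galEE' : galois (iota @: E)%AS E'.
  by apply: galoisS galE'; rewrite sub1v -genE' subv_adjoin.
pose G := 'Gal(E' / (iota @: E)%AS)%G.
have fixed b : (forall g, g \in G -> gal_int g b = b) -> exists a, int_map j a = b.
  move=> fb; have : vsval (val b) \in fixedField 'Gal(E' / (iota @: E)%AS)%g.
    apply/fixedFieldP => [|s sG]; first exact: subvsP.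
    by have /(congr1 val)/(congr1 val) := fb s sG; rewrite [LHS]gal_actE.
  have /galois_fixedField -> := galEE'; case/memv_imgP => y yE Dy.
  have Db : j (vsproj E y) = val b.
    by apply: val_inj; rewrite [LHS]sub_embedE vsprojK // -Dy.
  have ci : vsproj E y \in @int_elt (subvs_of E).
    by rewrite -(int_elt_fmorph j); move: (valP b); rewrite -Db.
  by exists (IntRing ci); apply: val_inj.
have zE' : z \in E' by rewrite -genE' memv_adjoin.
have m_gt0 : (0 < m)%N by case: (m) pm; rewrite ?dvdn0.
have zi : vsproj E' z \in @int_elt (subvs_of E').
  rewrite -(int_elt_fmorph (vsval : {rmorphism subvs_of E' -> K'})) /= vsprojK //.
  apply/asboolP; exists ('X^m - 1); first by rewrite monicXnsubC.
  by rewrite rmorphB /= map_polyXn rmorph1 rootE !hornerE zm subrr.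
pose zt : int_ring (subvs_of E') := IntRing zi.
have ztm : zt ^+ m = 1.
  by apply: val_inj; apply: val_inj; rewrite rmorphXn [LHS]rmorphXn /= vsprojK // zm algid1.
have mQ : m%:R \notin Q by rewrite (nat_in_prime p_pr pQ pQ').
have z_sep g : g \in G -> g != 1%g -> zt - gal_int g zt \notin Q.
  move=> gG g1; apply: (unity_root_sub_notin pQ mQ) => //.
    by rewrite -rmorphXn ztm rmorph1.
  apply: contra g1 => /eqP zz; apply/eqP.
  apply: (gal_adjoin_ext genE') => [y yE|].
    by rewrite gal_id (fixed_gal _ gG) // -genE' subv_adjoin.
  rewrite gal_id; have /(congr1 val)/(congr1 val) := zz.
  by rewrite [RHS]gal_actE /= vsprojK.
have gen y : y \in Q -> exists2 s, s \notin Q & exists w, s * y = int_map j pi * w.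
  move=> yQ.
  have [s sQ [q qQ sy]] := unramified_generation (@gal_int1 _ _ E') (@gal_intM _ _ E') fixed pQ z_sep yQ.
  have /(_ _)/cid2 den k : exists2 t, t \notin P & exists w, t * q`_k = pi * w.
    by apply: unif; rewrite unfold_in qQ.
  (* A common denominator for all coefficients of [q]. *)
  pose t := \prod_(k < size q) s2val (den k).
  have tP : t \notin P by apply: prime_ideal_prod => // k _; case: (den k).
  have /(_ _)/cid wk k : exists w, t * q`_k = pi * w.
    have [kq|kq] := ltnP k (size q); last by exists 0; rewrite nth_default // !mulr0.
    rewrite /t (bigD1 (Ordinal kq)) //= mulrAC; case: (den k) => tk /= _ [w ->].
    by exists (w * \prod_(i < size q | i != Ordinal kq) s2val (den i)); rewrite mulrA.
  have Dtq : t *: q = pi *: \poly_(k < size q) projT1 (wk k).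
    apply/polyP => k; rewrite !coefZ coef_poly; case: ltnP => [_|kq]; first by case: (wk k).
    by rewrite nth_default // !mulr0.
  exists (int_map j t * s); first by rewrite prime_idealM // negb_or sQ andbT.
  exists (map_poly (int_map j) (\poly_(k < size q) projT1 (wk k))).[zt].
  by rewrite -mulrA sy -!hornerZ -!map_polyZ Dtq.
have [l lQ Dpi] : exists2 l : seq (int_ring (subvs_of E') * int_ring (subvs_of E')),
     all (fun q => (q.1 \in Q) && (q.2 \in Q)) l & int_map j pi = \sum_(q <- l) q.1 * q.2.
  by have /asboolP := ramQ x xv; rewrite -int_map_base.
have [s sQ [w sw]] : exists2 s, s \notin Q & exists w, s * int_map j pi = int_map j pi ^+ 2 * w.
  rewrite {1}Dpi {Dpi}; elim: l lQ => [_|q l IHl /= /andP[/andP[q1 q2] /IHl [s sQ [w sw]]]].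
    by exists 1; rewrite ?prime_ideal1 //; exists 0; rewrite big_nil !mulr0.
  have [s1 s1Q [w1 D1]] := gen _ q1; have [s2 s2Q [w2 D2]] := gen _ q2.
  exists (s * (s1 * s2)); first by rewrite !prime_idealM // !negb_or sQ s1Q.
  exists (s * (w1 * w2) + s1 * s2 * w); rewrite big_cons mulrDr mulrDr; congr (_ + _).
    by rewrite -[LHS]mulrA [s1 * s2 * _]mulrACA D1 D2 [X in s * X]mulrACA -expr2 [LHS]mulrCA.
  by rewrite mulrAC sw -[LHS]mulrA [w * _]mulrC.
have pi0 : int_map j pi != 0.
  apply: contraNneq xP2 => /eqP; rewrite -(rmorph0 (int_map j)) => /eqP/int_map_inj pi0.
  by apply/asboolP; exists [::]; rewrite ?pi0 ?big_nil.
have vpi0 : val (int_map j pi) != 0.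
  by apply: contra pi0 => /eqP; rewrite -(rmorph0 (@int_val _)) => /val_inj ->.
have Ds : s = int_map j pi * w.
  apply: val_inj; apply: (mulfI vpi0); have /(congr1 (@int_val _)) := sw.
  by rewrite mulrC expr2 -mulrA !rmorphM.
by move: sQ; rewrite Ds prime_idealMr.
Qed.

End RamificationTransfer.

Section SigmaTransfer.
Variables (F : fieldExtType rat) (K K' : splittingFieldType F) (iota : 'AHom(K, K')).
Variables (E : {subfield K}) (E' : {subfield K'}) (p : nat).
Hypothesis sEE' : (iota @: E <= E')%VS.

Lemma Sigma_sub : galois 1%AS E -> galois 1%AS E' -> (Sigma E p `<=` Sigma E' p)%classic.
Proof.
move=> galE galE' [f|v] //= [pv vp ram]; split=> //; exact: (ramified_up sEE').
Qed.

Lemma Sigma_adjoin_root (m : nat) (z : K') : prime p -> ~~ (p %| m)%N -> z ^+ m = 1 ->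
  <<(iota @: E)%AS; z>>%VS = E' -> galois 1%AS E' -> (Sigma E' p `<=` Sigma E p)%classic.
Proof.
move=> p_pr pm zm genE' galE' [f|v] //= [pv vp ram]; split=> //.
exact: (ramified_down sEE' p_pr pm zm genE').
Qed.

End SigmaTransfer.

(** * Residue fields and Frobenius elements *)

(** Multiplication by [a != 0] permutes the nonzero elements, so their product can be cancelled. *)
Lemma finite_domain_exp (O : idomainType) (es : seq O) (a : O) :
  uniq es -> (forall x, x \in es) -> a ^+ size es = a.
Proof.
move=> ues allx; have [->|a0] := eqVneq a 0.
  by rewrite expr0n; case: es allx {ues} => // /(_ 0).
pose ts := rem 0 es; have uts : uniq ts by rewrite rem_uniq.
have mts x : (x \in ts) = (x != 0) by rewrite mem_rem_uniq // inE allx andbT.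
have uats : uniq [seq a * x | x <- ts] by rewrite map_inj_uniq //; exact: mulfI.
have perm_a : perm_eq [seq a * x | x <- ts] ts.
  apply: uniq_perm => //; have [||//] := uniq_min_size uats (s2 := ts).
    by move=> _ /mapP [x xts ->]; rewrite mts mulf_eq0 negb_or a0 -mts.
  by rewrite size_map.
have pr0 : \prod_(x <- ts) x != 0.
  by rewrite prodf_seq_neq0; apply/allP => x; rewrite mts.
have : a ^+ size ts * \prod_(x <- ts) x = 1 * \prod_(x <- ts) x.
  rewrite mul1r -[RHS](perm_big _ perm_a) big_map big_split /=.
  by rewrite big_const_seq count_predT iter_mulr_1.
move/(mulIf pr0); rewrite size_rem // => a1.
by rewrite -(prednK (_ : 0 < size es)%N) ?exprS ?a1 ?mulr1 //; case: es allx {ues ts uts mts uats perm_a pr0 a1} => // /(_ 0).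
Qed.

Section ResidueField.
Variables (F : fieldExtType rat) (p : nat) (p_pr : prime p) (v : {pred int_ring F}).
Hypotheses (primev : prime_ideal v) (pv : p%:R \in v).

(** A rational dependence is scaled to a primitive integral one. Hence the residue ring at [v] has
    dimension at most [[F:Q]] over [F_p]. *)
Lemma int_ring_dependent (r : nat) (e : 'I_r -> int_ring F) : (\dim {:F} < r)%N ->
  exists c : 'I_r -> int, (exists k, ~~ (p %| c k)%Z) /\ \sum_k (c k)%:~R * e k = 0.
Proof.
move=> rn; pose X := [tuple int_val (e k) | k < r].
have /freeP nfree : ~~ free X.
  apply: contraTN rn => /eqP fX; rewrite -leqNgt -[r](size_tuple X) -fX.
  exact: dimvS (subvf _).
have [k [Dk k0]] : exists k : 'I_r -> rat, \sum_(i < r) k i *: X`_i = 0 /\ exists i, k i != 0.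
  apply: contrapT => /forallNP nk; apply: nfree => k k0 i.
  by apply: contrapT => /eqP ki; apply: (nk k); split=> //; exists i.
have [i0 ki0] := k0.
(* The coefficients are stored in a polynomial so that its content can be removed. *)
pose q := \poly_(i < r) (if insub i is Some i' then k i' else 0).
have qE i : q`_i = if insub i is Some i' then k (i' : 'I_r) else 0.
  by rewrite coef_poly; case: insubP => [u -> //|/negPf ->].
have qk (i : 'I_r) : q`_i = k i.
  by rewrite qE; case: insubP => [u _ /val_inj -> //|]; rewrite ltn_ord.
have q0 : q != 0 by apply: contraNneq ki0 => q0; rewrite -qk q0 coef0.
have [c [a [a0 Dc [l cl]]]] := primitive_int_poly p_pr q0.
have Dci i : (c`_i)%:~R = a * q`_i by rewrite -coefZ -Dc coef_map.
exists (fun i => c`_i); split.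
  have [lr|rl] := ltnP l r; first by exists (Ordinal lr).
  case/negP: cl; have /eqP := Dci l; rewrite qE; case: insubP => [u|_]; first by rewrite ltnNge rl.
  by rewrite mulr0 intr_eq0 => /eqP ->; rewrite dvdz0.
apply: val_inj; rewrite [RHS](rmorph0 (@int_val F)) [LHS](rmorph_sum (@int_val F)) /=.
have aDk : \sum_(i < r) a *: (k i *: X`_i) = 0 by rewrite -scaler_sumr Dk scaler0.
apply: etrans aDk; apply: eq_bigr => i _.
rewrite [LHS](_ : _ = (c`_i)%:~R * int_val (e i)); last first.
  by rewrite -(rmorph_int (@int_val F)).
by rewrite scalerA -qk -Dci scaler_int mulrzl -[X`_i]tnth_nth tnth_mktuple.
Qed.

(** A maximal family independent modulo [v] is a basis of the residue ring over [F_p], whose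
    elements are then listed by combinations with digits in ['I_p]. The bound on [f] makes [f]
    divide [[F:Q]!] later. *)
Lemma residue_field : exists f, [/\ (0 < f <= \dim {:F})%N, ideal_norm v = (p ^ f)%N &
  forall a, a ^+ (p ^ f)%N - a \in v].
Proof.
have [O [rho [surj Drho]]] := prime_ideal_quotient primev.
have inv := int_in_prime p_pr primev pv.
pose indep r (e : 'I_r -> int_ring F) := forall c : 'I_r -> int,
  \sum_k (c k)%:~R * e k \in v -> forall k, (p %| c k)%Z.
have ex0 : exists r, `[< exists e, @indep r e >].
  by exists 0%N; apply/asboolP; exists (fun=> 0) => c _ [].
have ubr r : `[< exists e, @indep r e >] -> (r <= \dim {:F})%N.
  move=> /asboolP [e ie]; rewrite leqNgt; apply/negP => /(int_ring_dependent e) [c [[k ck] c0]].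
  by move: ck; rewrite ie // c0 prime_ideal0.
case: (ex_maxnP ex0 ubr) => r /asboolP [e ie] rmax.
pose ev (c : {ffun 'I_r -> 'I_p}) : int_ring F := \sum_k (c k)%:R * e k.
have ev_inj c c' : ev c - ev c' \in v -> c = c'.
  have -> : ev c - ev c' = \sum_k ((c k)%:Z - (c' k)%:Z)%:~R * e k.
    rewrite -sumrB; apply: eq_bigr => k _.
    by rewrite -mulrBl rmorphB.
  move=> /ie cc; apply/ffunP => k; apply: val_inj; apply/eqP.
  by have := cc k; rewrite -eqz_mod_dvd /= !modz_nat !modn_small.
(* Adjoining [x] to the maximal family gives a relation modulo [v]; independence of the old family
   makes the coefficient of [x] prime to [p], and inverting it modulo [p] solves for [x]. *)
have ev_surj x : exists c, x - ev c \in v.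
  pose e1 (k : 'I_r.+1) := if unlift ord0 k is Some k' then e k' else x.
  have [c [cv [k0 ck0]]] : exists c : 'I_r.+1 -> int,
      \sum_k (c k)%:~R * e1 k \in v /\ exists k, ~~ (p %| c k)%Z.
    apply: contrapT => /forallNP nc.
    have : (r.+1 <= r)%N.
      apply: rmax; apply/asboolP; exists e1 => c cv k.
      by apply: contrapT => /negP ck; apply: (nc c); split=> //; exists k.
    by rewrite ltnn.
  have {}cv : (c ord0)%:~R * x + \sum_(k < r) (c (lift ord0 k))%:~R * e k \in v.
    move: cv; rewrite big_ord_recl {1}/e1 unlift_none.
    by under eq_bigr => k _ do rewrite /e1 liftK.
  have pcm : ~~ (p %| c ord0)%Z.
    apply/negP => pcm; case/negP: ck0; have [k' ->|->//] := unliftP ord0 k0.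
    apply: (ie (fun k => c (lift ord0 k))).
    rewrite -[\sum_k _](addKr ((c ord0)%:~R * x)) addrC prime_idealB //.
    by rewrite prime_idealMr // inv.
  have /coprimezP [[a b] /= ab] : coprimez p (c ord0) by rewrite coprimezE /= prime_coprime // -dvdzE.
  pose d k := ((- b * c (lift ord0 k)) %% p)%Z.
  have p0 : p%:Z != 0 by rewrite eqz_nat -lt0n prime_gt0.
  have dge k : 0 <= d k by rewrite modz_ge0.
  have dlt k : (`|d k| < p)%N.
    by rewrite -ltz_nat gez0_abs ?modz_ge0 // ltz_pmod // ltz_nat prime_gt0.
  exists [ffun k => Ordinal (dlt k)].
  have -> : ev [ffun k => Ordinal (dlt k)] = \sum_k (d k)%:~R * e k.
    apply: eq_bigr => k _; rewrite ffunE /=; congr (_ * _).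
    by rewrite -[in RHS](gez0_abs (dge k)).
  have Dx : x = (a * p + b * c ord0)%:~R * x by rewrite ab mul1r.
  have Dd k : (d k)%:~R * e k = (- b * c (lift ord0 k))%:~R * e k - (((- b * c (lift ord0 k)) %/ p)%Z * p)%:~R * e k.
    by rewrite -mulrBl -rmorphB /d {2}(divz_eq (- b * c (lift ord0 k)) p) [_ + (_ %% _)%Z]addrC addrK.
  under eq_bigr => k _ do rewrite Dd.
  rewrite sumrB opprB addrCA prime_idealD //.
    by apply: prime_ideal_sum => // k _; rewrite prime_idealMr // inv dvdz_mull.
  have -> : \sum_k (- b * c (lift ord0 k))%:~R * e k = - (b%:~R * \sum_(k < r) (c (lift ord0 k))%:~R * e k).
    rewrite mulr_sumr -sumrN; apply: eq_bigr => k _.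
    by rewrite mulNr rmorphN mulNr rmorphM mulrA.
  rewrite Dx opprK rmorphD /= mulrDl -addrA prime_idealD //.
    by rewrite prime_idealMr // inv dvdz_mull.
  by rewrite rmorphM -mulrA -mulrDr prime_idealMl.
have r0 : (0 < r)%N.
  rewrite lt0n; apply/eqP => r0; have [c] := ev_surj 1.
  rewrite /ev big1 => [|k]; last by case: k => k kr; exfalso; rewrite r0 in kr.
  by rewrite subr0 (negPf (prime_ideal1 primev)).
have card_ev : #|{ffun 'I_r -> 'I_p}| = (p ^ r)%N by rewrite card_ffun !card_ord.
exists r; split.
- by rewrite r0 ubr //; apply/asboolP; exists e.
- pose Phi c : set (int_ring F) := [set y | y - ev c \in v]%classic.
  rewrite /ideal_norm; have -> : [set [set y | y - x \in v] | x in [set: int_ring F]]%classic = [set` [fset Phi c | c in {ffun 'I_r -> 'I_p}]%fset]%classic.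
    apply/seteqP; split=> [_ [x _ <-]|_ /= /imfsetP [c _ ->]]; last by exists (ev c).
    have [c xc] := ev_surj x; apply/imfsetP; exists c => //; apply/seteqP; split=> y /= yx.
      by rewrite /Phi /= -(subrKA x y) prime_idealD.
    rewrite -(subrKA (ev c) y) prime_idealD //.
    by rewrite -opprB -mulN1r prime_idealMl.
  rewrite set_fsetK card_imfset ?card_ev /= -?cardE //.
  move=> c c' cc; apply: ev_inj.
  have : Phi c (ev c) by rewrite /Phi /= subrr prime_ideal0.
  by rewrite cc.
move=> a; pose es := [seq rho (ev c) | c <- enum {ffun 'I_r -> 'I_p}].
have ses : size es = (p ^ r)%N by rewrite size_map -cardE card_ev.
rewrite -Drho rmorphB rmorphXn subr_eq0 -ses finite_domain_exp //.
  rewrite map_inj_uniq ?enum_uniq // => c c' /eqP.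
  by rewrite -subr_eq0 -rmorphB Drho => /ev_inj.
move=> w; have [x <-] := surj w; have [c xc] := ev_surj x.
apply/mapP; exists c; first by rewrite mem_enum.
by apply/eqP; rewrite -subr_eq0 -rmorphB Drho.
Qed.
End ResidueField.

Section Frobenius.
Variables (F : fieldExtType rat) (K : splittingFieldType F) (E : {subfield K}).
Variables (p : nat) (p_pr : prime p) (v : {pred int_ring F}).
Hypotheses (abK : abelian_ext K) (primev : prime_ideal v) (pv : p%:R \in v).

Definition is_frobenius (s : gal_of E) := forall P, lies_over v P ->
  forall x, int_map (gal_act s) x - x ^+ ideal_norm v \in P.

(** The [q]-th power of the reduction modulo a prime above [v] is a ring morphism, and by Fermat it
    agrees with the reduction on the integers of [F]; [conj_morphism] turns it into the reduction of
    an automorphism. *)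
Lemma frobenius_exists : exists s, is_frobenius s.
Proof.
have galE := abelian_galois E abK.
have [P0 vP0] := place_above galE primev; have [pP0 P0v] := vP0.
have [O [rho [_ Drho]]] := prime_ideal_quotient pP0.
have [f [_ Dq Fq]] := residue_field p_pr primev pv.
have pO : p \in [pchar O].
  rewrite inE p_pr /= -(rmorph_nat rho) Drho -(rmorph_nat (int_map (base_embed E))).
  by rewrite P0v.
set q := ideal_norm v; have qnat : [pchar O].-nat q.
  by rewrite (eq_pnat _ (pcharf_eq pO)) /q Dq pnatX pnat_id.
pose phi x := rho x ^+ q.
have phi_zmod : zmod_morphism phi.
  move=> x y; rewrite /phi rmorphB exprDn_pchar // exprNn_pchar //.
have phi_monoid : monoid_morphism phi.
  by split=> [|x y]; rewrite /phi ?rmorph1 ?expr1n // rmorphM exprMn.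
pose phiM : {rmorphism int_ring (subvs_of E) -> O} := HB.pack phi
  (GRing.isZmodMorphism.Build _ _ phi phi_zmod) (GRing.isMonoidMorphism.Build _ _ phi phi_monoid).
have [|s _ Ds] := conj_morphism (G := [set: gal_of E]%G) (@gal_int1 _ _ E) (@gal_intM _ _ E) (gal_int_fixed galE) (rho := rho) (phi := phiM).
  move=> a; apply/eqP; rewrite -subr_eq0 /= /phi -!rmorphXn -!rmorphB Drho P0v.
  by rewrite /q Dq Fq.
(* Any other prime above [v] is a conjugate, and the conjugating element commutes with [s]. *)
exists s => P vP x; have [t Dt] := places_conjugate galE vP0 vP.
have comm y : gal_int t (gal_int s y) = gal_int s (gal_int t y).
  have /centsP ab := abelian_gal E abK.
  by have := gal_intM s t y; rewrite (ab s _ t) ?finset.in_setT // gal_intM.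
rewrite -Dt rmorphB rmorphXn [gal_int t _]comm -Drho rmorphB rmorphXn subr_eq0.
by have /= <- := Ds (gal_int t x).
Qed.

Lemma frobeniusP : is_frobenius (frobenius E (FinPlace v)).
Proof.
rewrite /frobenius; case: pickP => [s /asboolP //|none].
by have [s /asboolP] := frobenius_exists; rewrite none.
Qed.

Lemma frobenius_decomp s j : is_frobenius s -> (s ^+ j)%g \in decomp_group E (FinPlace v).
Proof.
move=> frs; rewrite inE; apply/asboolP => P vP; have [pP _] := vP.
have fr y : (gal_int s y \in P) = (y \in P).
  have sy : gal_int s y - y ^+ ideal_norm v \in P := frs P vP y.
  apply/idP/idP => yP.
    apply: (prime_idealX (n := ideal_norm v) pP).
    by rewrite -[_ ^+ _](subKr (gal_int s y)) prime_idealB.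
  have [f [/andP[f0 _] Dq _]] := residue_field p_pr primev pv.
  rewrite -[gal_int s y](subrK (y ^+ ideal_norm v)) prime_idealD //.
  by rewrite -[ideal_norm v]prednK ?Dq ?expn_gt0 ?prime_gt0 // exprS prime_idealMr.
elim: j => [|j IHj] x; first by have := gal_int1 x; rewrite /gal_int /= => ->.
have := gal_intM (s ^+ j) s x; rewrite -expgSr /gal_int /= => ->.
by rewrite -[int_map _ (int_map _ _)]/(gal_int s (int_map (gal_act (s ^+ j)%g) x)) fr IHj.
Qed.

(** Both sides are [m]-th roots of unity congruent modulo a prime above [p], where distinct ones
    stay distinct. *)
Lemma frobenius_unity_root s (m : nat) (z : K) : is_frobenius s -> ~~ (p %| m)%N -> z \in E ->
  z ^+ m = 1 -> s z = z ^+ ideal_norm v.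
Proof.
move=> frs pm zE zm; have galE := abelian_galois E abK.
have [P vP] := place_above galE primev; have [pP Pv] := vP.
have m_gt0 : (0 < m)%N by case: (m) pm; rewrite ?dvdn0.
have zi : vsproj E z \in @int_elt (subvs_of E).
  rewrite -(int_elt_fmorph (vsval : {rmorphism subvs_of E -> K})) /= vsprojK //.
  apply/asboolP; exists ('X^m - 1); first by rewrite monicXnsubC.
  by rewrite rmorphB /= map_polyXn rmorph1 rootE !hornerE zm subrr.
pose zt : int_ring (subvs_of E) := IntRing zi.
have ztm : zt ^+ m = 1.
  by apply: val_inj; apply: val_inj; rewrite rmorphXn [LHS]rmorphXn /= vsprojK // zm algid1.
have pP' : p%:R \in P by rewrite -(rmorph_nat (int_map (base_embed E))) Pv.
have mP : m%:R \notin P by rewrite (nat_in_prime p_pr pP pP').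
have := frs P vP zt.
have [zz _|zz] := eqVneq (int_map (gal_act s) zt) (zt ^+ ideal_norm v); last first.
  apply: contraTeq => _; apply: (unity_root_sub_notin pP mP) zz.
    by rewrite -rmorphXn ztm rmorph1.
  by rewrite -exprM mulnC exprM ztm expr1n.
have /(congr1 val)/(congr1 val) := zz.
by rewrite [LHS]gal_actE rmorphXn [RHS]rmorphXn /= vsprojK.
Qed.

End Frobenius.

(** * Complex conjugation *)

Lemma unity_root_conj (n : nat) (x : algC) : (0 < n)%N -> x ^+ n = 1 -> x ^* = x ^+ n.-1.
Proof.
move=> n0 xn.
have x0 : x != 0 by apply: contra_eq_neq xn => ->; rewrite expr0n gtn_eqF // eq_sym oner_eq0.
have nx : `|x| = 1.
  by apply/eqP; rewrite -(@pexpr_eq1 _ _ n) // -normrX xn normr1.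
by apply: (mulfI x0); rewrite -normCK nx expr1n -exprS prednK.
Qed.

Section CMCriterion.
Variable L : fieldExtType rat.

(** Being CM means being totally imaginary with this relation defined everywhere. In this form the
    property passes easily to fields generated by roots of unity. *)
Definition has_conj (x y : L) := forall f : {rmorphism L -> algC}, f y = (f x)^*.

(** For [x] outside the real subfield, the other root [- m_1 - x] of its quadratic minimal
    polynomial is the complex conjugate in every embedding. *)
Lemma CM_field_conj : CM_field L -> forall x, exists y, has_conj x y.
Proof.
case=> imL [L0 [reL0 dimL0]] x.
have real0 (f : {rmorphism L -> algC}) u : u \in L0 -> f u \is Num.real.
  move=> uL0; have := reL0 (f \o vsval) (vsproj L0 u).
  by rewrite /= vsprojK.
have [xL0|xL0] := boolP (x \in L0).
  by exists x => f; rewrite (CrealP (real0 f x xL0)).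
have sz : size (minPoly L0 x) = 3%N.
  have d2 : (adjoin_degree L0 x <= 2)%N.
    by rewrite adjoin_degreeE -dimL0 leq_div2r // dimvS ?subvf.
  have : adjoin_degree L0 x != 1%N by rewrite adjoin_deg_eq1.
  by rewrite size_minPoly; move: d2; rewrite /adjoin_degree; case: (_.-1) => [|[|]].
have gen : <<L0; x>>%VS = {:L}%VS.
  apply/eqP; rewrite eqEdim subvf dim_Fadjoin /=.
  have -> : adjoin_degree L0 x = 2%N by apply/eqP; rewrite -eqSS -size_minPoly sz.
  by rewrite -dimL0 divnK // field_dimS ?subvf.
pose m := minPoly L0 x.
have mL0 k : m`_k \in L0 by apply/polyOverP; exact: minPolyOver.
have mE : x ^+ 2 + m`_1 * x + m`_0 = 0.
  have := minPolyxx L0 x; rewrite horner_coef -/m sz !big_ord_recr big_ord0 /= expr0 expr1 mulr1 add0r.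
  have -> : m`_2 = 1 by have /monicP := monic_minPoly L0 x; rewrite lead_coefE sz.
  by rewrite mul1r => E; apply: etrans E; rewrite [LHS]addrC addrA addrAC.
exists (- m`_1 - x) => f.
(* A real [f x] would make [f] real on all of [L0(x) = L]. *)
have nreal : f x \isn't Num.real.
  apply/negP => fx; have [y /negP] := imL f; apply.
  have : y \in <<L0; x>>%VS by rewrite gen memvf.
  case/Fadjoin_polyP => q /polyOverP qL0 ->; rewrite -horner_map horner_coef.
  apply: rpred_sum => k _; rewrite coef_map /=.
  by rewrite rpredM ?rpredX // real0.
have fxE : (f x - (f x)^*) * (f x + (f x)^* + f m`_1) = 0.
  have E1 : f x ^+ 2 + f m`_1 * f x + f m`_0 = 0.
    by have /(congr1 f) := mE; rewrite !rmorphD rmorphXn rmorphM rmorph0.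
  have E2 : (f x)^* ^+ 2 + f m`_1 * (f x)^* + f m`_0 = 0.
    have /(congr1 Num.conj) := E1; rewrite !rmorphD rmorphXn rmorphM rmorph0 /=.
    by rewrite (CrealP (real0 f _ (mL0 1%N))) (CrealP (real0 f _ (mL0 0%N))).
  have -> : (f x - (f x)^*) * (f x + (f x)^* + f m`_1) =
      (f x ^+ 2 + f m`_1 * f x + f m`_0) - ((f x)^* ^+ 2 + f m`_1 * (f x)^* + f m`_0) by ring.
  by rewrite E1 E2 subrr.
move/eqP: fxE; rewrite mulf_eq0 subr_eq0 => /orP [/eqP/esym/CrealP fx|].
  by rewrite fx in nreal.
by rewrite addrAC addr_eq0 => /eqP E; rewrite rmorphB rmorphN -opprD [f m`_1 + _]addrC E opprK.
Qed.

Lemma has_conjM x x' y y' : has_conj x x' -> has_conj y y' -> has_conj (x * y) (x' * y').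
Proof. by move=> cx cy f; rewrite !rmorphM cx cy. Qed.

Lemma has_conj_sym x y : has_conj x y -> has_conj y x.
Proof. by move=> cx f; rewrite cx conjCK. Qed.

Lemma has_conj_uniq x y y' : has_conj x y -> has_conj x y' -> y = y'.
Proof.
have [f] := num_field_embedding L.
by move=> cx cx'; apply: (fmorph_inj f); rewrite cx cx'.
Qed.

(** Conjugation becomes an automorphism [c] with fixed field [L0]. For [x] non-real, [d = x - c x]
    is odd under [c], so [d^2] is in [L0], and [L = L0(d)] by splitting elements into even and odd
    parts. *)
Lemma conj_CM_field : totally_imaginary L -> (forall x, exists y, has_conj x y) -> CM_field L.
Proof.
move=> imL ex; split=> //.
have /(_ _)/cid exc := ex; pose c x := projT1 (exc x).
have cP x : has_conj x (c x) by rewrite /c; case: (exc x).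
have c_zmod : zmod_morphism c.
  move=> x y; apply: (has_conj_uniq (cP _)) => f.
  by rewrite !rmorphB /= -!cP.
have c_mon : monoid_morphism c.
  split=> [|x y]; first by apply: (has_conj_uniq (cP _)) => f; rewrite !rmorph1.
  by apply: (has_conj_uniq (cP _)); apply: has_conjM.
have c_scal : scalable c.
  move=> a x; apply: (has_conj_uniq (cP _)) => f.
  by rewrite !rmorphZ_num rmorphM /= -cP fmorph_rat.
pose cR : {rmorphism L -> L} := HB.pack c
   (GRing.isZmodMorphism.Build _ _ c c_zmod) (GRing.isMonoidMorphism.Build _ _ c c_mon).
pose cL : {linear L -> L} := HB.pack c
   (GRing.isZmodMorphism.Build _ _ c c_zmod) (GRing.isScalable.Build _ _ _ _ c c_scal).
have c_ahom : ahom_in {:L} (linfun cL).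
  apply/ahom_inP; split => [x y _ _|]; rewrite !lfunE /=.
    exact: (c_mon.2 x y).
  exact: c_mon.1.
pose cA : 'AEnd(L) := AHom c_ahom.
have cAE x : cA x = c x by exact: (lfunE cL).
pose L0 : {subfield L} := fixedSpace_aspace cA.
have memL0 x : (x \in L0) = (c x == x) by rewrite -cAE; apply/fixedSpaceP/eqP.
exists L0; split.
  (* [has_conj] speaks of embeddings of [L], so the given embedding of [L0] is first extended. *)
  move=> f x; have [g gE] := extend_embedding (fieldOver L0) f.
  rewrite -gE; set y := x%:A; have : vsval x \in L0 := subvsP x.
  rewrite memL0 => /eqP cx; have yE : y = vsval x by rewrite /y fieldOver_scaleE mulr1.
  by apply/CrealP; rewrite yE -[in RHS]cx; have /= := cP (vsval x) (g : {rmorphism L -> algC}) => ->.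
have [f] := num_field_embedding L; have [x fx] := imL f.
pose d := x - c x.
have cc y : c (c y) = y by apply: (has_conj_uniq (cP _)); exact: has_conj_sym.
have cd : c d = - d by rewrite /d c_zmod cc opprB.
have d0 : d != 0.
  apply: contra fx; rewrite /d subr_eq0 => /eqP xE; apply/CrealP.
  by rewrite -cP -xE.
have two0 : 2%:R != 0 :> L by rewrite -(fmorph_eq0 f) rmorph_nat pnatr_eq0.
have cdiv u w : c (u / w) = c u / c w by exact: (fmorph_div cR).
have cD u w : c (u + w) = c u + c w by exact: (rmorphD cR).
have cM u w : c (u * w) = c u * c w by exact: (rmorphM cR).
have c2 : c 2%:R = 2%:R by exact: (rmorph_nat cR).
have gen : <<L0; d>>%VS = {:L}%VS.
  apply/vspaceP => y; rewrite memvf.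
  have -> : y = (y + c y) / 2%:R + (y - c y) / (2%:R * d) * d.
    by field; rewrite two0 d0.
  have memc u : c u = u -> u \in <<L0; d>>%VS.
    by move=> cu; rewrite (subvP (subv_adjoin _ _)) // memL0 cu.
  apply: rpredD; [|apply: rpredM; last exact: memv_adjoin]; apply: memc.
    by rewrite cdiv cD c2 cc addrC.
  rewrite cdiv cM c_zmod c2 cc cd.
  by rewrite mulrN invrN mulrN -mulNr opprB.
have dL0 : d \notin L0.
  rewrite memL0 cd; apply: contra d0 => /eqP dd; have : d * 2%:R == 0.
    by rewrite mulr_natr mulr2n -{1}dd addNr.
  by rewrite mulf_eq0 (negPf two0) orbF.
rewrite -gen -adjoin_degreeE; apply/eqP; rewrite eqn_leq; apply/andP; split; last first.
  by move: dL0; rewrite -adjoin_deg_eq1 /adjoin_degree; case: (_.-1).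
rewrite -2!ltnS -size_minPoly; have -> : 4%N = (size ('X^2 - (d ^+ 2)%:P : {poly L})).+1.
  by rewrite size_XnsubC.
rewrite ltnS dvdp_leq -?size_poly_gt0 ?size_XnsubC //; apply: minPoly_dvdp.
  rewrite rpredB ?rpredX ?polyOverX // polyOverC memL0 expr2 cM cd mulrNN //.
by rewrite rootE !hornerE subrr.
Qed.
End CMCriterion.

Section SubfieldCM.
Variables (F : fieldExtType rat) (K : splittingFieldType F) (E : {subfield K}).

Definition conjugates (x y : subvs_of E) :=
  forall f : {rmorphism subvs_of E -> algC}, f y = (f x)^*.

Lemma CM_imaginary : CM E -> forall f : {rmorphism subvs_of E -> algC}, exists x, f x \isn't Num.real.
Proof. by case=> imE _ f; exact: (imE f). Qed.

Lemma CM_conjugates : CM E -> forall x, exists y, conjugates x y.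
Proof. by move=> cmE x; have [y xy] := CM_field_conj cmE x; exists y => f; exact: (xy f). Qed.

Lemma conjugates_CM : (forall f : {rmorphism subvs_of E -> algC}, exists x, f x \isn't Num.real) ->
  (forall x, exists y, conjugates x y) -> CM E.
Proof.
move=> imE cjE; apply: conj_CM_field => [f|x]; first exact: (imE f).
by have [y xy] := cjE x; exists y => f; exact: (xy f).
Qed.

Lemma embedding_exists : inhabited {rmorphism subvs_of E -> algC}.
Proof. exact: (num_field_embedding (baseFieldType (subvs_of E))). Qed.

Lemma conjugates_uniq x y y' : conjugates x y -> conjugates x y' -> y = y'.
Proof. exact: (@has_conj_uniq (baseFieldType (subvs_of E))). Qed.

Hypothesis F_real : totally_real F.

(** [complex_conj] is picked with default 1, so an automorphism with this property must exist:
    conjugation is a ring map of [E], and it is [F]-linear because [F] is totally real. *)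
Lemma complex_conjP : CM E -> forall x, conjugates x (gal_act (complex_conj E) x).
Proof.
move=> cmE; have /(_ _)/cid exc := CM_conjugates cmE; pose c x := projT1 (exc x).
have cP x : conjugates x (c x) by rewrite /c; case: (exc x).
pose ct (y : K) : K := vsval (c (vsproj E y)).
have c_scal a x : c (a *: x) = a *: c x.
  apply: (conjugates_uniq (cP _)) => f.
  have aE u : a *: u = base_embed E a * u by rewrite mulr_algl.
  rewrite !aE !rmorphM /= (cP x f); congr (_ * _).
  exact: esym (CrealP (F_real (f \o base_embed E) a)).
have cD x y : c (x + y) = c x + c y.
  by apply: (conjugates_uniq (cP _)) => f; rewrite !rmorphD /= -!cP.
have cM x y : c (x * y) = c x * c y.
  by apply: (conjugates_uniq (cP _)) => f; rewrite !rmorphM /= -!cP.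
have c1 : c 1 = 1 by apply: (conjugates_uniq (cP _)) => f; rewrite !rmorph1.
have ct_lin : linear ct.
  by move=> a x y; rewrite /ct (linearP (vsproj E)) cD c_scal (linearP vsval).
pose ctL : {linear K -> K} := HB.pack ct (GRing.isLinear.Build _ _ _ _ ct ct_lin).
have kAc : kAut 1 E (linfun ctL).
  rewrite kAutE k1HomE; apply/andP; split.
    apply/ahom_inP; split=> [x y xE yE|]; rewrite !lfunE /= /ct.
      rewrite -(vsprojK xE) -(vsprojK yE) -(rmorphM vsval) !vsvalK cM.
      exact: (rmorphM vsval).
    have -> : vsproj E 1 = 1 by apply: val_inj; rewrite /= vsprojK ?mem1v // algid1.
    by rewrite c1 /= algid1.
  by apply/subvP => _ /memv_imgP [x xE ->]; rewrite lfunE /= subvsP.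
have [t _ ft] := kAut_to_gal kAc.
rewrite /complex_conj; case: pickP => [s /asboolP sP x f|none]; first exact: sP.
have /asboolP[] := none t; move=> f x; rewrite -cP; congr (f _).
apply: val_inj; rewrite [LHS]gal_actE /= -ft ?subvsP // lfunE /= /ct vsvalK //.
Qed.

Lemma complex_conj2 : CM E -> (complex_conj E * complex_conj E)%g = 1%g.
Proof.
move=> cmE; apply/eqP/gal_eqP => x xE; rewrite galM // gal_id.
have [f] := embedding_exists.
have : gal_act (complex_conj E) (gal_act (complex_conj E) (vsproj E x)) = vsproj E x.
  by apply: (fmorph_inj f); rewrite !complex_conjP // conjCK.
move/(congr1 vsval) => cc; apply: etrans (etrans cc (vsprojK xE)).
by rewrite gal_actE gal_actE vsprojK.
Qed.

Lemma decomp_mul_conj (f : {rmorphism F -> algC}) s : CM E -> s \in decomp_group E (InfPlace f) ->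
  (complex_conj E * s)%g \in decomp_group E (InfPlace f).
Proof.
move=> cmE; rewrite !inE => /asboolP sD; apply/asboolP => g gf.
have [gs|gs] := sD g gf; [right|left] => x; rewrite gal_actM /=.
  by rewrite gs complex_conjP.
by rewrite gs complex_conjP // conjCK.
Qed.

End SubfieldCM.

Section CMTransfer.
Variables (F : fieldExtType rat) (K K' : splittingFieldType F) (iota : 'AHom(K, K')).
Variables (E : {subfield K}) (E' : {subfield K'}).
Hypothesis sEE' : (iota @: E <= E')%VS.
Let j := sub_embed sEE' : {rmorphism subvs_of E -> subvs_of E'}.

(** The conjugate of [z] is [z^(m-1)] in every embedding, and the elements of [E'] are polynomials
    in [z] over [E]. *)
Lemma CM_adjoin_root (m : nat) (z : K') : (0 < m)%N -> z ^+ m = 1 ->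
  <<(iota @: E)%AS; z>>%VS = E' -> CM E -> CM E'.
Proof.
move=> m0 zm genE' cmE; apply: conjugates_CM => [f|x].
  by have [x fx] := CM_imaginary cmE (f \o j); exists (j x).
have zE' : z \in E' by rewrite -genE' memv_adjoin.
have cj (u : subvs_of E) : exists y, conjugates (j u) y.
  by have [y uy] := CM_conjugates cmE u; exists (j y) => f; exact: (uy (f \o j)).
have cz : conjugates (vsproj E' z) (vsproj E' z ^+ m.-1).
  move=> f; rewrite rmorphXn (unity_root_conj m0) // -rmorphXn.
  have -> : vsproj E' z ^+ m = 1; last exact: rmorph1.
  by apply: val_inj; rewrite [LHS]rmorphXn /= vsprojK // zm algid1.
have : vsval x \in <<(iota @: E)%AS; z>>%VS by rewrite genE' subvsP.
case/Fadjoin_polyP => q /polyOverP qE Dx.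
have qe k : exists u : subvs_of E, vsval (j u) = q`_k.
  have /memv_imgP [u uE ->] := qE k; exists (vsproj E u).
  by rewrite [LHS]sub_embedE vsprojK.
have {Dx} -> : x = \sum_(k < size q) vsproj E' q`_k * vsproj E' z ^+ k.
  apply: val_inj; rewrite [LHS]Dx horner_coef [RHS](rmorph_sum vsval); apply: eq_bigr => k _.
  rewrite [RHS](rmorphM vsval) rmorphXn /= !vsprojK //.
  by have [u <-] := qe k; exact: subvsP.
elim/big_rec: _ => [|k y _ [y' yy']]; first by exists 0 => f; rewrite !rmorph0.
have [u Du] := qe k; have [u' uu'] := cj u.
exists (u' * (vsproj E' z ^+ m.-1) ^+ k + y') => f.
have -> : vsproj E' q`_k = j u by rewrite -Du vsvalK.
by rewrite !rmorphD !rmorphM !rmorphXn /= -uu' -yy' -cz rmorphXn.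
Qed.

Lemma restricts_complex_conj : totally_real F -> CM E -> CM E' ->
  restricts iota (complex_conj E') (complex_conj E).
Proof.
move=> F_real cmE cmE' x xE.
have : j (gal_act (complex_conj E) (vsproj E x)) = gal_act (complex_conj E') (j (vsproj E x)).
  apply: (conjugates_uniq (x := j (vsproj E x))); last exact: complex_conjP.
  by move=> f; exact: (complex_conjP F_real cmE (vsproj E x) (f \o j)).
by move/(congr1 vsval); rewrite [LHS]sub_embedE [RHS]gal_actE [in LHS]gal_actE sub_embedE vsprojK.
Qed.

End CMTransfer.

(** * p-adic group rings *)

Section Padic.
Variables (p : nat) (p_pr : prime p).
Local Notation Zp := (padic_int p_pr).
Local Notation Qp := (padic_num p_pr).
Implicit Types x y : Zp.

Let pX n : int := (p ^ n)%:Z.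
Let pX0 n : pX n != 0. Proof. by rewrite eqz_nat -lt0n expn_gt0 prime_gt0. Qed.

Lemma padic_natE (m : nat) n : (m%:R : Zp) n = (m%:Z %% pX n)%Z.
Proof.
elim: m => [|m IHm] /=; first by rewrite mod0z.
rewrite -[in LHS]addn1 natrD -[LHS]/(((m%:R : Zp) n + (1 : Zp) n) %% pX n)%Z IHm /=.
by rewrite modzDm -addn1 PoszD.
Qed.

Lemma padic_pX_val k y : ((p ^ k)%:R * y : Zp) k = 0.
Proof.
by rewrite -[LHS]/((((p ^ k)%:R : Zp) k * y k) %% pX k)%Z padic_natE modzz mul0r mod0z.
Qed.

(** Component [n] of the quotient is read off component [n + k] of [x]. *)
Lemma padic_divisible k x : x k = 0 -> exists u, x = (p ^ k)%:R * u.
Proof.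
move=> xk; pose u n := (x (n + k)%N %/ pX k)%Z.
have ux n : u n * pX k = x (n + k)%N.
  by apply: divzK; apply/dvdz_mod0P; rewrite padic_mod ?leq_addl.
have Hu n : (u n.+1 = u n %[mod pX n])%Z.
  apply/eqP; rewrite eqz_mod_dvd -(dvdz_mul2r (pX0 k)).
  rewrite mulrBl !ux -PoszM -expnD addSn; apply/dvdz_mod0P.
  by rewrite -modzDml padicP subrr mod0z.
exists (padic_of p_pr Hu); apply: eq_padic => n.
rewrite -[RHS]/((((p ^ k)%:R : Zp) n * (u n %% pX n)%Z) %% pX n)%Z padic_natE modzMml modzMmr.
by rewrite mulrC -/(pX k) ux padic_mod ?leq_addr.
Qed.

Lemma padic_cong k x y : x k = y k -> exists u, x - y = (p ^ k)%:R * u.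
Proof.
move=> xy; apply: padic_divisible.
by rewrite -[LHS]/((x k + (- y k %% pX k)%Z) %% pX k)%Z modzDmr xy subrr mod0z.
Qed.

Lemma padic_inf_divisible x : (forall k, exists u, x = (p ^ k)%:R * u) -> x = 0.
Proof.
move=> xdiv; apply: eq_padic => k; have [u ->] := xdiv k.
by rewrite padic_pX_val /= mod0z.
Qed.

Lemma padic_natr_eq0 m : (m%:R == 0 :> Zp) = (m == 0%N).
Proof.
apply/eqP/eqP => [m0|->//]; have := padic_natE m m; rewrite m0 /= mod0z => /esym/eqP.
rewrite modz_nat eqz_nat; case: m {m0} => // m.
by rewrite modn_small // ltn_expl // prime_gt1.
Qed.

Lemma Zp_to_Qp_inj : injective (@Zp_to_Qp p p_pr).
Proof. by move=> x y /eqP; rewrite [_ == _](tofrac_eq x y) => /eqP. Qed.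

Lemma Qp_natr_eq0 m : (m%:R == 0 :> Qp) = (m == 0%N).
Proof.
by rewrite -(rmorph_nat (@Zp_to_Qp p p_pr)) -(rmorph0 (@Zp_to_Qp p p_pr)) (inj_eq Zp_to_Qp_inj) padic_natr_eq0.
Qed.

Lemma Qp_denominator (a : Qp) : exists m : Zp, m != 0 /\ exists b, Zp_to_Qp m * a = Zp_to_Qp b.
Proof.
elim/quotW: a => r; exists (frac r).2; split; first exact: denom_ratioP.
exists (frac r).1; rewrite /Zp_to_Qp; unlock FracField.tofrac.
rewrite -[_ * _]FracField.pi_mul; apply/eqmodP.
by rewrite /= FracField.equivfE /FracField.mulf !numden_Ratio ?oner_eq0 ?mul1r ?denom_ratioP // mulrC; apply/eqP; exact: mul1r.
Qed.

End Padic.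

Section GringBasics.
Variables (R : comNzRingType) (gT : finGroupType).
Local Notation A := (gring R gT).
Implicit Types (x y : A) (a b g : gT).

Lemma gring_mulE x y g : (x * y) g = \sum_h x h * y (h^-1 * g)%g.
Proof. by rewrite ffunE. Qed.

Lemma gring_mulC : abelian [set: gT] -> forall x y : A, x * y = y * x.
Proof.
move=> abG x y; apply/ffunP => g; rewrite !ffunE.
rewrite (reindex_inj (inj_comp (mulgI g) invg_inj)) /=; apply: eq_bigr => h _.
by rewrite invMg invgK mulrC mulgKV; congr (_ * _); congr (x _); apply: (centsP abG); rewrite finset.in_setT.
Qed.

Lemma gelt_mulE a x g : (gelt R a * x) g = x (a^-1 * g)%g.
Proof.
rewrite gring_mulE (bigD1 a) //= ffunE eqxx mul1r big1 ?addr0 // => h /negPf ha.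
by rewrite ffunE ha mul0r.
Qed.

Lemma geltM a b : gelt R (a * b)%g = gelt R a * gelt R b.
Proof.
apply/ffunP => g; rewrite gelt_mulE !ffunE; congr (nat_of_bool _)%:R.
by rewrite -(inj_eq (mulgI a^-1%g)) mulKg.
Qed.

Lemma gelt1 : @gelt R gT 1%g = 1. Proof. by []. Qed.

Lemma geltX a n : gelt R (a ^+ n)%g = gelt R a ^+ n.
Proof. by elim: n => [|n IHn]; rewrite ?expg0 ?expr0 // expgS exprS geltM IHn. Qed.

Lemma gring_sum (I : Type) (r : seq I) (P : pred I) (f : I -> A) g :
  (\sum_(i <- r | P i) f i) g = \sum_(i <- r | P i) f i g.
Proof.
by apply: (big_morph (fun x : A => x g)) => [x y|]; rewrite ffunE.
Qed.

Lemma gring_decomp x : x = \sum_g x g *: gelt R g.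
Proof.
apply/ffunP => h; rewrite gring_sum (bigD1 h) //= big1 => [|g /negPf gh].
  by rewrite !ffunE eqxx mulr1 addr0.
by rewrite !ffunE eq_sym gh mulr0.
Qed.

(** [D] is just a set stable under translation by [a]; finite order makes the translation a
    permutation of [D]. *)
Lemma gelt_mul_norm (D : {set gT}) a : (forall s, s \in D -> (a * s)%g \in D) ->
  gelt R a * gring_norm R D = gring_norm R D.
Proof.
move=> aD; rewrite /gring_norm mulr_sumr.
have aDE s : ((a * s)%g \in D) = (s \in D).
  have aX n t : t \in D -> (a ^+ n * t)%g \in D.
    by elim: n => [|n IHn] tD; rewrite ?mul1g // expgS -mulgA aD ?IHn.
  apply/idP/idP => [asD|]; last exact: aD.
  by have := aX #[a]%g.-1 _ asD; rewrite -invg_expg mulKg.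
rewrite [RHS](reindex_inj (mulgI a)); apply: eq_big => s; first by rewrite aDE.
by rewrite geltM.
Qed.

Lemma gring_scale_mul (r : R) x y : (r *: x) * y = r *: (x * y).
Proof.
by apply/ffunP => g; rewrite !ffunE mulr_sumr; apply: eq_bigr => h _; rewrite ffunE mulrA.
Qed.

Lemma gring_mul_scale (r : R) x y : x * (r *: y) = r *: (x * y).
Proof.
by apply/ffunP => g; rewrite !ffunE mulr_sumr; apply: eq_bigr => h _; rewrite ffunE mulrCA.
Qed.

End GringBasics.

Section GringCoef.
Variables (R S : comNzRingType) (f : {rmorphism R -> S}) (gT : finGroupType).

Fact gring_coef_zmod : zmod_morphism (gring_coef f : gring R gT -> gring S gT).
Proof. by move=> x y; apply/ffunP => g; rewrite !ffunE rmorphB. Qed.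
Fact gring_coef_monoid : monoid_morphism (gring_coef f : gring R gT -> gring S gT).
Proof.
split=> [|x y]; apply/ffunP => g; rewrite !ffunE ?rmorph_nat // rmorph_sum.
by apply: eq_bigr => h _; rewrite !ffunE rmorphM.
Qed.
HB.instance Definition _ := GRing.isZmodMorphism.Build (gring R gT) (gring S gT) (gring_coef f) gring_coef_zmod.
HB.instance Definition _ := GRing.isMonoidMorphism.Build (gring R gT) (gring S gT) (gring_coef f) gring_coef_monoid.

Lemma gring_coef_elt (g : gT) : gring_coef f (gelt R g) = gelt S g.
Proof. by apply/ffunP => h; rewrite !ffunE rmorph_nat. Qed.

Lemma gring_coef_inj : injective f -> injective (gring_coef f : gring R gT -> gring S gT).
Proof. by move=> injf x y /ffunP xy; apply/ffunP => g; apply: injf; have := xy g; rewrite !ffunE. Qed.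

Lemma gring_coefZ r x : gring_coef f (r *: x : gring R gT) = f r *: gring_coef f x.
Proof. by apply/ffunP => g; rewrite !ffunE rmorphM. Qed.

End GringCoef.

Section GringPush.
Variables (R : comNzRingType) (gT hT : finGroupType) (f : gT -> hT).
Hypothesis fM : {morph f : x y / (x * y)%g}.

Fact gring_push_zmod : zmod_morphism (gring_push f : gring R gT -> gring R hT).
Proof. by move=> x y; apply/ffunP => g; rewrite !ffunE -sumrB; apply: eq_bigr => h _; rewrite !ffunE. Qed.
HB.instance Definition _ := GRing.isZmodMorphism.Build (gring R gT) (gring R hT) (gring_push f) gring_push_zmod.

Lemma gring_push_elt (g : gT) : gring_push f (gelt R g) = gelt R (f g).
Proof.
apply/ffunP => h; rewrite !ffunE; case: eqP => [->|hf].
  by rewrite (bigD1 g) //= ffunE eqxx big1 ?addr0 // => k /andP[_ /negPf kg]; rewrite ffunE kg.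
by rewrite big1 // => k /eqP fk; rewrite ffunE; case: eqP => // kg; case: hf; rewrite -fk kg.
Qed.

Lemma gring_pushZ r (x : gring R gT) : gring_push f (r *: x) = r *: gring_push f x.
Proof. by apply/ffunP => g; rewrite !ffunE mulr_sumr; apply: eq_bigr => h _; rewrite !ffunE. Qed.

Lemma gring_pushM (x y : gring R gT) : gring_push f (x * y) = gring_push f x * gring_push f y.
Proof.
rewrite [x]gring_decomp [y]gring_decomp mulr_suml !raddf_sum mulr_suml.
apply: eq_bigr => g _; rewrite mulr_sumr !raddf_sum mulr_sumr; apply: eq_bigr => h _.
rewrite /= !gring_scale_mul !gring_mul_scale !gring_pushZ !gring_scale_mul !gring_mul_scale.
by rewrite -geltM !gring_push_elt fM geltM.
Qed.

Lemma gring_push1 : gring_push f (1 : gring R gT) = 1.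
Proof.
rewrite -!gelt1 gring_push_elt; congr gelt; apply: (mulgI (f 1%g)).
by rewrite -fM !mulg1.
Qed.

End GringPush.

Lemma gring_push_coef (R S : comNzRingType) (e : {rmorphism R -> S}) (gT hT : finGroupType) (f : gT -> hT) x :
  gring_push f (gring_coef e x) = gring_coef e (gring_push f x).
Proof.
by apply/ffunP => g; rewrite !ffunE rmorph_sum; apply: eq_bigr => h _; rewrite ffunE.
Qed.

Section MinusBasics.
Variables (R : comNzRingType) (gT : finGroupType) (c : gT).
Hypotheses (abG : abelian [set: gT]) (cc : (c * c)%g = 1%g).
Local Notation A := (gring R gT).
Local Notation tm := (@to_minus R gT c).
Implicit Types x y : A.

Lemma to_minusZ (a x : A) : a *: tm x = tm (a * x).
Proof. exact: minus_scaleE. Qed.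

Lemma gelt_cc : gelt R c * gelt R c = 1.
Proof. by rewrite -geltM cc gelt1. Qed.

Lemma anti_sym : (1 - gelt R c) * (gelt R c + 1) = 0 :> A.
Proof. by rewrite mulrDr mulr1 mulrBl mul1r gelt_cc addrC subrKA subrr. Qed.

(* Multiplication by 1 - c embeds the minus part in the group ring, at the cost
   of a factor 2. *)
Lemma to_minus_anti x : tm ((1 - gelt R c) * x) = 2%:R *: tm x.
Proof.
rewrite to_minusZ; apply/to_minusP; exists (- x).
rewrite -mulrBl [LHS](gring_mulC abG) mulNr -mulrN; congr (_ * _).
by rewrite mulr2n !opprD addrACA subrr add0r.
Qed.

Lemma to_minus_eq0 x : tm x = 0 -> (1 - gelt R c) * x = 0.
Proof.
rewrite -(raddf0 tm) => /to_minusP [w]; rewrite subr0 => ->.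
by rewrite mulrA [_ * w](gring_mulC abG) -mulrA anti_sym mulr0.
Qed.

Lemma scale_c_minus (eta : minus_part R c) : (gelt R c + 1) *: eta = 0.
Proof.
rewrite -[eta]of_minusK to_minusZ -(raddf0 tm); apply/to_minusP.
by exists (of_minus eta); rewrite subr0 (gring_mulC abG).
Qed.

End MinusBasics.

Section MinusSemisimple.
Variables (R : fieldType) (gT : finGroupType) (c : gT).
Hypotheses (R0 : forall n, (n%:R == 0 :> R) = (n == 0%N)).
Hypotheses (abG : abelian [set: gT]).
Local Notation A := (gring R gT).
Local Notation M := (minus_part R c).
Implicit Types eta : M.

Lemma nat_scale_eq0 m eta : m != 0%N -> (m%:R : A) *: eta = 0 -> eta = 0.
Proof.
move=> m0 meta; have inv : (m%:R^-1 *: (1 : A)) * m%:R = 1.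
  by rewrite gring_scale_mul mul1r -[m%:R in X in _ *: X]scaler_nat scalerA mulVf ?R0 // scale1r.
by rewrite -[eta]scale1r -inv -scalerA meta scaler0.
Qed.

(* [#[h]] is the sum of the norm of <[h]>, which kills 1 - h, and of a multiple
   of 1 - h. *)
Lemma semisimple_kill (h : gT) r eta :
  (1 - gelt R h) ^+ r *: eta = 0 -> (1 - gelt R h) *: eta = 0.
Proof.
set H := gelt R h; have Ho : H ^+ #[h]%g = 1 by rewrite -geltX expg_order gelt1.
pose N := \sum_(i < #[h]%g) H ^+ i.
have N0 : N * (1 - H) = 0.
  rewrite (gring_mulC abG) -opprB mulNr -subrX1 Ho subrr oppr0 //.
have [w Dw] : exists w, (#[h]%g)%:R - N = w * (1 - H).
  exists (\sum_(i < #[h]%g) \sum_(k < i) H ^+ k).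
  rewrite mulr_suml -[X in X%:R]card_ord -sumr_const -sumrB; apply: eq_bigr => i _.
  by rewrite [RHS](gring_mulC abG) -[1 - H]opprB mulNr -subrX1 opprB.
have step (xi : M) : (1 - H) *: ((1 - H) *: xi) = 0 -> (1 - H) *: xi = 0.
  set xi1 := (1 - H) *: xi => xi2; apply: (@nat_scale_eq0 #[h]%g); first by rewrite -lt0n.
  rewrite -[(#[h]%g)%:R](subrK N) Dw scalerDl -scalerA xi2 scaler0 add0r.
  by rewrite /xi1 scalerA N0 scale0r.
elim: r => [|[|r] IHr]; first by rewrite expr0 scale1r => ->; rewrite scaler0.
  by rewrite expr1.
rewrite 2!exprS -!scalerA => /step h0; apply: IHr.
by rewrite exprS -scalerA.
Qed.

(* The factors at infinite places satisfy the first alternative, because c lies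
   in their decomposition groups; those at finite places satisfy the second. *)
Definition tame (h : gT) (a : A) :=
  (forall eta, a *: eta = eta) \/ (exists u, u * a = 1 - gelt R h).

(** Factors acting trivially are dropped and each other one is multiplied up to [1 - h]; the
    exponent counts the latter. *)
Lemma tame_prod_kill (h : gT) (I : eqType) (s : seq I) (f : I -> A) eta :
  (forall i, i \in s -> tame h (f i)) -> (\prod_(i <- s) f i) *: eta = 0 ->
  exists r, (1 - gelt R h) ^+ r *: eta = 0.
Proof.
elim: s eta => [|i s IHs] eta ts; first by rewrite big_nil scale1r => ->; exists 0%N; rewrite scaler0.
have {}IHs xi := IHs xi (fun k ks => ts k (mem_behead (s := i :: s) ks)).
rewrite big_cons -scalerA; case: (ts i (mem_head i s)) => [->|[u Du] fe]; first exact: IHs.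
have : (\prod_(k <- s) f k) *: ((1 - gelt R h) *: eta) = 0.
  by rewrite scalerA (gring_mulC abG) -scalerA -Du -scalerA fe scaler0.
by case/IHs => r re; exists r.+1; rewrite exprSr -scalerA.
Qed.

(** [h] fixes the norm of [D], so [1 - h] absorbs the factor. *)
Lemma tame_idem (h : gT) (D : {set gT}) : h \in D ->
  (forall s, s \in D -> (h * s)%g \in D) -> tame h (1 - (#|D|%:R)^-1 *: gring_norm R D).
Proof.
move=> hD hDD; right; exists (1 - gelt R h).
by rewrite mulrBr mulr1 gring_mul_scale mulrBl mul1r gelt_mul_norm // subrr scaler0 subr0.
Qed.

(** [c] fixes the norm of [D], so twice the norm is a multiple of [c + 1] and kills the minus
    part. *)
Lemma tame_conj (h : gT) (D : {set gT}) :
  (forall s, s \in D -> (c * s)%g \in D) -> tame h (1 - (#|D|%:R)^-1 *: gring_norm R D).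
Proof.
move=> cD; left => eta.
suff N0 : gring_norm R D *: eta = 0.
  rewrite scalerBl scale1r -[gring_norm R D]mul1r -gring_scale_mul -scalerA N0 scaler0 subr0 //.
apply: (@nat_scale_eq0 2) => //.
rewrite scalerA mulr_natl mulr2n -{1}(gelt_mul_norm R cD) -[X in _ + X]mul1r -mulrDl.
by rewrite (gring_mulC abG) -scalerA scale_c_minus // scaler0.
Qed.

Lemma tame_elt (h s : gT) k : h = (s ^+ k)%g -> tame h (1 - gelt R s).
Proof.
move=> ->; right; exists (\sum_(i < k) gelt R s ^+ i).
by rewrite (gring_mulC abG) geltX -opprB mulNr -subrX1 opprB.
Qed.

End MinusSemisimple.

Section PushDivisible.
Variables (R S : comNzRingType) (e : {rmorphism R -> S}) (e_inj : injective e).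
Variables (gT hT : finGroupType) (f : gT -> hT) (c h : gT).
Hypothesis fM : {morph f : x y / (x * y)%g}.
Hypotheses (abG : abelian [set: gT]) (abH : abelian [set: hT]).
Hypotheses (cc : (c * c)%g = 1%g) (fh : f h = 1%g).

(** [y] is constant on the cosets of [<[h]>], and [f] is constant on them too, so each coset
    contributes [#[h]] equal terms. *)
Lemma push_invariant (y : gring R gT) : (1 - gelt R h) * y = 0 ->
  exists w, gring_push f y = (#[h]%g)%:R * w.
Proof.
move=> hy.
have yh g : y (h^-1 * g)%g = y g.
  by move/eqP: hy; rewrite mulrBl mul1r subr_eq0 => /eqP/ffunP/(_ g) ->; rewrite gelt_mulE.
have yhX k g : y (h ^+ k * g)%g = y g.
  elim: k g => [|k IHk] g; first by rewrite mul1g.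
  by rewrite expgSr -mulgA IHk -[in RHS](mulKg h g) yh.
(* One representative per coset; [w] sums [y] over representatives only. *)
pose rep g := fingroup.repr (<[h]> :* g)%g.
pose w : gring R hT := [ffun b => \sum_(g | (f g == b) && (g == rep g)) y g].
exists w; apply/ffunP => b; rewrite mulr_natl.
have natE n (x : gring R hT) : (x *+ n) b = x b *+ n by elim: n => [|n IHn]; rewrite ?mulr0n ?ffunE // !mulrS ffunE IHn.
rewrite natE !ffunE.
have repP g : exists k, rep g = (h ^+ k * g)%g.
  have : rep g \in (<[h]> :* g)%g by exact: mem_repr_rcoset.
  by case/rcosetP => _ /cycleP [k ->] ->; exists k.
have repK k g : rep (h ^+ k * g)%g = rep g.
  by rewrite /rep; congr fingroup.repr; apply/rcoset_eqP/rcosetP; exists (h ^+ k)%g; rewrite ?mem_cycle.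
have rep_id g : rep (rep g) = rep g.
  by have [k Dk] := repP g; rewrite {1}Dk repK.
have fX k g : f (h ^+ k * g)%g = f g.
  have f1 : f 1%g = 1%g by apply: (mulgI (f 1%g)); rewrite -fM !mulg1.
  rewrite fM; have -> : f (h ^+ k)%g = 1%g; last by rewrite mul1g.
  by elim: k => [|k IHk]; rewrite ?expg0 // expgS fM fh IHk mulg1.
rewrite (partition_big rep (fun g => (f g == b) && (g == rep g))) /=; last first.
  by move=> g /eqP fg; rewrite rep_id eqxx andbT; have [k ->] := repP g; rewrite fX fg.
rewrite -sumrMnl; apply: eq_bigr => g0 /andP[/eqP fg0 /eqP g0r].
transitivity (\sum_(g in (<[h]> :* g0)%g) y g0); last first.
  by rewrite sumr_const card_rcoset.
apply: eq_big => [g|g /andP[_ /eqP rg]].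
  apply/andP/rcosetP => [[_ /eqP rg]|[_ /cycleP [k ->] ->]].
    have [k Dk] := repP g; exists (h ^- k)%g; first by rewrite groupV mem_cycle.
    by rewrite -rg Dk mulKg.
  by rewrite fX fg0 repK -g0r !eqxx.
by have [k Dk] := repP g; rewrite -rg Dk yhX.
Qed.

(** Invariance modulo [c + 1] becomes invariance in the group ring itself after multiplication by
    [1 - c], which on the minus part is multiplication by 2. *)
Lemma minus_push_divisible (x : gring R gT) :
  (1 - gelt S h) *: to_minus c (gring_coef e x) = 0 ->
  exists w, 2%:R *: to_minus (f c) (gring_push f x) = (#[h]%g)%:R *: to_minus (f c) w.
Proof.
move=> hx; have hy : (1 - gelt R h) * ((1 - gelt R c) * x) = 0.
  apply: (gring_coef_inj e_inj); rewrite rmorph0.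
  have := hx; rewrite to_minusZ => /(to_minus_eq0 abG cc) hx0; apply: etrans hx0.
  rewrite !rmorphM !rmorphB !rmorph1 /= !gring_coef_elt !mulrA; congr (_ * _).
  exact: gring_mulC.
have [w Dw] := push_invariant hy; exists w.
have f1 : f 1%g = 1%g by apply: (mulgI (f 1%g)); rewrite -fM !mulg1.
rewrite -to_minus_anti // -?fM ?cc // to_minusZ -Dw gring_pushM // raddfB /= gring_push1 // gring_push_elt.
by [].
Qed.

End PushDivisible.

(** * Compactness and separatedness of p-adic group rings *)

Lemma infinite_pigeonhole (T : finType) (res : nat -> T) (S : nat -> Prop) :
  (forall N, exists2 n, (N <= n)%N & S n) ->
  exists r, forall N, exists2 n, (N <= n)%N & S n /\ res n = r.
Proof.
move=> infS; apply: contrapT => /forallNP nr.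
have /(_ _)/cid bound r : exists N, forall n, (N <= n)%N -> S n -> res n <> r.
  have /existsNP [N HN] := nr r; exists N => n Nn Sn rn.
  by apply: HN; exists n.
have [n nN Sn] := infS (\max_r projT1 (bound r)).
case: (bound (res n)) (leq_trans (leq_bigmax (res n)) nN) => N HN /= Nn.
exact: HN Nn Sn erefl.
Qed.

Section PadicGroupRing.
Variables (p : nat) (p_pr : prime p) (gT : finGroupType).
Local Notation Zp := (padic_int p_pr).
Local Notation Qp := (padic_num p_pr).
Local Notation tau := (@Zp_to_Qp p p_pr).

Lemma padic_bound (a : Zp) k : exists2 m, (m < p ^ k)%N & a k = m%:Z.
Proof.
have pk0 : (0 < (p ^ k)%:Z)%R by rewrite ltz_nat expn_gt0 prime_gt0.
have := padic_mod a (leqnn k); have := modz_ge0 (a k) (lt0r_neq0 pk0).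
have := ltz_pmod (a k) pk0 => + + aE; rewrite aE; case: (a k) => // m mk _.
by exists m.
Qed.

Lemma gring_natrE (R : comNzRingType) (n : nat) (x : gring R gT) g : (n%:R * x) g = n%:R * x g.
Proof.
rewrite mulr_natl mulr_natl; elim: n => [|n IHn]; first by rewrite !mulr0n ffunE.
by rewrite !mulrS ffunE IHn.
Qed.

Section Compactness.
Variable x : nat -> gring Zp gT.

(** The residue of [x m] at level [k] recurs arbitrarily late in the sequence. *)
Let cluster k m := forall N, exists2 n, (N <= n)%N & forall g, x n g k = x m g k.

Let cluster_step k m : cluster k m ->
  exists m', cluster k.+1 m' /\ forall g, x m' g k = x m g k.
Proof.
move=> cl; pose res n : {ffun gT -> 'I_(p ^ k.+1).+1} := [ffun g => inord `|x n g k.+1|%N].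
have [r Hr] := infinite_pigeonhole res cl.
have [m' _ [m'm rm']] := Hr 0%N; exists m'; split=> // N.
have [n Nn [_ rn]] := Hr N; exists n => // g.
have /ffunP/(_ g) : res n = res m' by rewrite rn rm'.
rewrite !ffunE => /(congr1 val) /=.
have [a ak ->] := padic_bound (x n g) k.+1; have [b bk ->] := padic_bound (x m' g) k.+1.
by rewrite /= !inordK ?ltnS ?(ltnW ak) ?(ltnW bk) // => ->.
Qed.

(** Each level has finitely many residues, so recurring residues can be refined coherently and
    define the limit point [y]. The bound [k <= n] matters because the [n]-th approximation will be
    right only modulo [p^n]. *)
Lemma gring_compact : exists y : gring Zp gT, forall k, exists2 n, (k <= n)%N &
  exists u, x n - y = (p ^ k)%:R * u.
Proof.
have cl0 : cluster 0 0.
  move=> N; exists N => // g.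
  by rewrite -(padic_mod (x N g) (leqnn 0)) -(padic_mod (x 0%N g) (leqnn 0)) !modz1.
pose ms := nat_rect (fun k => {m | cluster k m}) (exist _ 0%N cl0)
  (fun k m => let s := cid (cluster_step (projT2 m)) in exist _ (projT1 s) (proj1 (projT2 s))).
pose m k := projT1 (ms k).
have clm k : cluster k (m k) by exact: projT2 (ms k).
have mS k g : x (m k.+1) g k = x (m k) g k.
  rewrite /m /=; case: cid => m' [c' e']; exact: e'.
have coh g : padic_coherent p (fun k => x (m k) g k).
  by apply/asboolP => k; rewrite padicP mS.
exists [ffun g => (PadicSeq (coh g) : Zp)] => k.
have [n kn xn] := clm k k; exists n => //.
have /(_ _)/cid ug g : exists u, x n g - (PadicSeq (coh g) : Zp) = (p ^ k)%:R * u.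
  by apply: padic_cong; rewrite xn.
exists [ffun g => projT1 (ug g)]; apply/ffunP => g.
by rewrite gring_natrE !ffunE; case: (ug g).
Qed.

End Compactness.

Lemma gring_denominator (a : gring Qp gT) :
  exists m : Zp, m != 0 /\ exists b, tau m *: a = gring_coef tau b.
Proof.
have /(_ _)/cid den g := Qp_denominator (a g); pose m g := projT1 (den g).
have /(_ _)/cid num g : exists b, tau (m g) * a g = tau b by rewrite /m; case: (den g) => ? [].
exists (\prod_g m g); split.
  by apply/prodf_neq0 => g _; rewrite /m; case: (den g) => ? [].
exists [ffun g => projT1 (num g) * \prod_(h | h != g) m h]; apply/ffunP => g.
rewrite !ffunE rmorphM; case: (num g) => b /= <-.
by rewrite (bigD1 g) //= rmorphM mulrAC.
Qed.

Variable c : gT.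
Hypotheses (abG : abelian [set: gT]) (cc : (c * c)%g = 1%g).
Local Notation tm := (@to_minus Qp gT c).

(** The multiples of [a] by integral elements form a lattice in the minus part, and a lattice
    contains no nonzero infinitely [p]-divisible element. Multiplication by [1 - c] moves the
    question to the group ring, where denominators are cleared and coefficients compared. *)
Lemma minus_separated (a : gring Qp gT) (eta : minus_part Qp c) :
  (forall k, exists w, 2%:R *: eta = (p ^ k)%:R *: (a *: tm (gring_coef tau w))) -> eta = 0.
Proof.
rewrite -[eta]of_minusK; set x0 := of_minus eta => Hk.
have [m [m0 [b Db]]] := gring_denominator a.
have [m' [m'0 [b' Db']]] := gring_denominator x0.
have R0 := Qp_natr_eq0 p_pr.
have coefM (u w : gring Zp gT) : gring_coef tau (u * w) = gring_coef tau u * gring_coef tau w by exact: rmorphM.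
have coef_nat n : gring_coef tau (n%:R : gring Zp gT) = n%:R by exact: rmorph_nat.
have coefC : gring_coef tau (1 - gelt Zp c) = 1 - gelt Qp c.
  by rewrite -(gring_coef_elt tau c) -[1 in RHS](rmorph1 (gring_coef tau)) -rmorphB.
(* An integral multiple of [2 x0]: [m'] clears the denominators of [x0], and [m] is there for those
   of [a]. *)
pose t : gring Zp gT := m *: (2%:R * b').
have tE : gring_coef tau t = tau (m * m') *: (2%:R * x0).
  by rewrite gring_coefZ [gring_coef tau _]rmorphM rmorph_nat /= -Db' gring_mul_scale scalerA -rmorphM.
have t0 : (1 - gelt Zp c) * t = 0.
  apply/ffunP => g; rewrite [RHS]ffunE; apply: padic_inf_divisible => k.
  have [w] := Hk k; rewrite !to_minusZ => /eqP; rewrite -subr_eq0 -raddfB => /eqP.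
  move=> /(to_minus_eq0 abG cc) E0.
  exists (((1 - gelt Zp c) * (m' *: (b * w))) g).
  rewrite -gring_natrE; suff -> : (1 - gelt Zp c) * t = (p ^ k)%:R * ((1 - gelt Zp c) * (m' *: (b * w))) by [].
  apply: (gring_coef_inj (@Zp_to_Qp_inj p p_pr)).
  move: (congr1 (fun y => tau (m * m') *: y) E0); rewrite scaler0 mulrBr scalerBr => /eqP.
  rewrite subr_eq0 => /eqP E1.
  rewrite coefM coefC tE gring_mul_scale E1.
  rewrite !coefM coef_nat coefC gring_coefZ coefM -Db.
  rewrite !gring_scale_mul !gring_mul_scale scalerA -rmorphM [m' * m]mulrC; congr (_ *: _).
  by rewrite [LHS]mulrA (gring_mulC abG (1 - gelt Qp c) (p ^ k)%:R) -mulrA.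
have : tm (gring_coef tau t) = 0.
  apply: (nat_scale_eq0 R0 (m := 2)) => //.
  rewrite -to_minus_anti // -coefC -coefM t0.
  by rewrite (_ : gring_coef tau 0 = 0) ?raddf0 //; exact: rmorph0.
rewrite tE => t1.
have : 2%:R *: tm x0 = 0.
  have inv : ((tau (m * m'))^-1 *: (1 : gring Qp gT)) * (tau (m * m') *: (2%:R * x0)) = 2%:R * x0.
    rewrite gring_scale_mul mul1r scalerA mulVf ?scale1r //.
    rewrite -(rmorph0 tau) (inj_eq (@Zp_to_Qp_inj p p_pr)) mulf_neq0 //.
  by rewrite to_minusZ -inv -to_minusZ t1 scaler0.
by move/(nat_scale_eq0 R0); apply.
Qed.

End PadicGroupRing.

(** * Reduction and transport of minus parts *)

(** [red] and [transport] are computed on chosen representatives; another choice alters the result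
    by a multiple of [f c + 1]. *)
Lemma to_minus_push (R : comNzRingType) (gT hT : finGroupType) (f : gT -> hT) (c : gT) (x : gring R gT) :
  {morph f : a b / (a * b)%g} ->
  to_minus (f c) (gring_push f (of_minus (to_minus c x))) = to_minus (f c) (gring_push f x).
Proof.
move=> fM; have /to_minusP [w Dw] := of_minusK (to_minus c x).
apply/to_minusP; exists (gring_push f w).
by rewrite -raddfB Dw /= gring_pushM // raddfD /= gring_push_elt gring_push1.
Qed.

Lemma to_minus_coef (R S : comNzRingType) (e : {rmorphism R -> S}) (gT : finGroupType) (c : gT) (x : gring R gT) :
  to_minus c (gring_coef e (of_minus (to_minus c x))) = to_minus c (gring_coef e x).
Proof.
have /to_minusP [w Dw] := of_minusK (to_minus c x).
apply/to_minusP; exists (gring_coef e w).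
by rewrite -rmorphB Dw rmorphM rmorphD rmorph1 /= gring_coef_elt.
Qed.

Lemma gring_push_inj (R : comNzRingType) (gT hT : finGroupType) (f : gT -> hT) :
  injective f -> injective (gring_push f : gring R gT -> gring R hT).
Proof.
move=> f_inj x y /ffunP xy; apply/ffunP => g; have := xy (f g); rewrite !ffunE.
by rewrite !(big_pred1 g) // => h; rewrite /= (inj_eq f_inj).
Qed.

Lemma gring_push_norm (R : comNzRingType) (gT hT : finGroupType) (f : gT -> hT)
    (D : {set gT}) (D' : {set hT}) : bijective f -> (forall g, (f g \in D') = (g \in D)) ->
  gring_push f (gring_norm R D) = gring_norm R D'.
Proof.
move=> f_bij DD'; rewrite /gring_norm raddf_sum [RHS](reindex f) /=; last exact: onW_bij.
by apply: eq_big => g; [rewrite DD' | rewrite gring_push_elt].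
Qed.

Lemma bijective_rmorphism (R S : comNzRingType) (f : {rmorphism R -> S}) :
  bijective f -> exists2 g : {rmorphism S -> R}, cancel f g & cancel g f.
Proof.
case=> g fK gK.
have gz : zmod_morphism g := can2_zmod_morphism fK gK.
have gm : monoid_morphism g := can2_monoid_morphism fK gK.
pose g' : {rmorphism S -> R} := HB.pack g (GRing.isZmodMorphism.Build _ _ g gz) (GRing.isMonoidMorphism.Build _ _ g gm).
by exists g'.
Qed.

Section ProjE.
Variables (p : nat) (p_pr : prime p) (F : fieldExtType rat) (K : splittingFieldType F).
Variable E : {subfield K}.
Local Notation Zp := (padic_int p_pr).
Local Notation Qp := (padic_num p_pr).
Local Notation tau := (@Zp_to_Qp p p_pr).
Local Notation tmZ := (@to_minus Zp (gal_of E) (complex_conj E)).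
Local Notation tmQ := (@to_minus Qp (gal_of E) (complex_conj E)).

Lemma proj_e_to_minus (x : gring Zp (gal_of E)) :
  proj_e (tmZ x : minus E Zp) = idem_e p_pr E *: tmQ (gring_coef tau x).
Proof. by rewrite /proj_e /minus_ZQ; congr (_ *: _); exact: to_minus_coef. Qed.

Lemma to_minus_surj (x : minus E Zp) : exists y, x = tmZ y.
Proof. by exists (of_minus x); rewrite of_minusK. Qed.

Fact proj_e_zmod : zmod_morphism (@proj_e p p_pr F K E).
Proof.
move=> x y; have [[a ->] [b ->]] := (to_minus_surj x, to_minus_surj y).
by rewrite -[tmZ a - tmZ b](raddfB tmZ) !proj_e_to_minus !raddfB.
Qed.
HB.instance Definition _ := GRing.isZmodMorphism.Build (minus E Zp) (minus E Qp) (@proj_e p p_pr F K E) proj_e_zmod.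

End ProjE.

Section ResMap.
Variables (F : fieldExtType rat) (K K' : splittingFieldType F) (iota : 'AHom(K, K')).
Variables (E : {subfield K}) (E' : {subfield K'}).
Hypothesis sEE' : (iota @: E <= E')%VS.
Variable r : gal_of E' -> gal_of E.
Hypothesis rP : forall s, restricts iota s (r s).

Lemma res_morph : {morph r : s t / (s * t)%g}.
Proof. by move=> s t; apply: restricts_inj (rP _) _; apply: restrictsM. Qed.

Lemma res_conj : totally_real F -> CM E -> CM E' -> r (complex_conj E') = complex_conj E.
Proof.
move=> F_real cmE cmE'; apply: restricts_inj (rP _) _.
exact: (restricts_complex_conj sEE').
Qed.

Hypothesis F_real : totally_real F.
Hypotheses (cmE : CM E) (cmE' : CM E').

Lemma minus_push_res (R : comNzRingType) (x : gring R (gal_of E')) :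
  to_minus (complex_conj E) (gring_push r (of_minus (to_minus (complex_conj E') x))) =
  to_minus (complex_conj E) (gring_push r x).
Proof. by rewrite -(res_conj F_real cmE cmE'); apply: to_minus_push; exact: res_morph. Qed.

End ResMap.

Section Red.
Variables (p : nat) (p_pr : prime p) (F : fieldExtType rat) (K : splittingFieldType F).
Hypotheses (F_real : totally_real F) (abK : abelian_ext K).
Variables (E E' : {subfield K}).
Hypotheses (sEE' : (E <= E')%VS) (cmE : CM E) (cmE' : CM E').
Local Notation Zp := (padic_int p_pr).

Lemma gal_restr (s : gal_of E') : restricts \1%AF s (gal E s).
Proof.
move=> x xE; rewrite !id_lfunE.
have /and3P[_ _ nE] := abelian_galois E abK.
by rewrite (normalField_cast_eq _ nE) ?gal1T ?finset.in_setT ?sub1v.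
Qed.

Lemma sub_id_embed : (\1%AF @: E <= E')%VS.
Proof. by rewrite lim1g. Qed.

Lemma red_to_minus (x : gring Zp (gal_of E')) :
  red E (to_minus (complex_conj E') x : minus E' Zp) =
  to_minus (complex_conj E) (gring_push (fun s : gal_of E' => gal E s) x).
Proof. exact: (minus_push_res sub_id_embed gal_restr). Qed.

Fact red_zmod : zmod_morphism (@red p p_pr F K E' E).
Proof.
move=> x y; have [[a ->] [b ->]] := (to_minus_surj x, to_minus_surj y).
by rewrite -[X in red E X](raddfB (@to_minus Zp _ (complex_conj E'))) !red_to_minus !raddfB.
Qed.

End Red.

Section Transport.
Variables (p : nat) (p_pr : prime p) (F : fieldExtType rat) (K K' : splittingFieldType F).
Variables (iota : 'AHom(K, K')) (E : {subfield K}).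
Hypotheses (F_real : totally_real F) (abK : abelian_ext K) (abK' : abelian_ext K').
Local Notation E' := (iota @: E)%AS.
Local Notation Zp := (padic_int p_pr).
Local Notation Qp := (padic_num p_pr).
Local Notation tau := (@Zp_to_Qp p p_pr).
Local Notation r := (@gal_transport F K K' iota E).

Let sEE' : (iota @: E <= E')%VS. Proof. exact: subvv. Qed.
Let j := sub_embed sEE' : {rmorphism subvs_of E -> subvs_of E'}.

Lemma gal_transportP s : restricts iota s (r s).
Proof.
rewrite /gal_transport; case: pickP => [t /asboolP //|none].
have /and3P[_ _ nE] := abelian_galois E abK.
by have [t /asboolP] := gal_restricts iota nE s; rewrite none.
Qed.

Lemma gal_transport_bij : bijective r.
Proof.
apply: inj_card_bij => [s t st|].
  apply/eqP/gal_eqP => _ /memv_imgP [x xE ->].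
  by rewrite -(gal_transportP s xE) -(gal_transportP t xE) st.
have := card_gal E abK; have := card_gal E' abK'; rewrite !cardsT => -> ->.
rewrite limg_dim_eq //; apply/eqP; rewrite -subv0 (subv_trans (capvSr _ _)) // subv0.
by apply/lker0P; exact: (fmorph_inj iota).
Qed.

Lemma sub_embed_bij : bijective j.
Proof.
have ker0 : lker iota == 0%VS by apply/lker0P; exact: (fmorph_inj iota).
exists (fun y => vsproj E ((iota^-1)%VF (vsval y))) => x.
  by rewrite [vsval _]sub_embedE lker0_lfunK // vsvalK.
have /memv_imgP [u uE Du] : vsval x \in (iota @: E)%VS := subvsP x.
apply: val_inj; rewrite [LHS]sub_embedE Du lker0_lfunK //.
by rewrite vsprojK.
Qed.

(** The isomorphism [j] from [E] to its image fixes [F] and intertwines the two Galois actions, so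
    embeddings and primes above [v] correspond. *)
Lemma decomp_transport v s : (r s \in decomp_group E v) = (s \in decomp_group E' v).
Proof.
have [ji jK jiK] := bijective_rmorphism sub_embed_bij.
have jr x : j (gal_act (r s) x) = gal_act s (j x).
  exact: sub_embed_gal (@gal_transportP s).
have jbase x : j (base_embed E x) = base_embed E' x by exact: sub_embed_base.
have jir y : ji (gal_act s y) = gal_act (r s) (ji y).
  by apply: (can_inj jK); rewrite jiK jr jiK.
have jibase x : ji (base_embed E' x) = base_embed E x.
  by apply: (can_inj jK); rewrite jiK jbase.
case: v => [f|v]; rewrite !inE; apply/asboolP/asboolP => D.
- move=> g gf; have [|gs|gs] := D (g \o j); first by move=> x; rewrite /= jbase gf.
    left=> y; have : g (j (gal_act (r s) (ji y))) = g (j (ji y)) := gs (ji y).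
    by rewrite jr jiK.
  right=> y; have : g (j (gal_act (r s) (ji y))) = (g (j (ji y)))^* := gs (ji y).
  by rewrite jr jiK.
- move=> g gf; have [|gs|gs] := D (g \o ji); first by move=> x; rewrite /= jibase gf.
    left=> y; have : g (ji (gal_act s (j y))) = g (ji (j y)) := gs (j y).
    by rewrite jir jK.
  right=> y; have : g (ji (gal_act s (j y))) = (g (ji (j y)))^* := gs (j y).
  by rewrite jir jK.
- move=> P vP y; have vP' := lies_over_restr sEE' vP.
  have := D _ vP' (int_map ji y); rewrite !unfold_in.
  have -> : int_map (sub_embed sEE') (int_map (gal_act (r s)) (int_map ji y)) = int_map (gal_act s) y.
    by apply: val_inj; rewrite /= -[sub_embed _ _]/(j _) jr jiK.
  have -> // : int_map (sub_embed sEE') (int_map ji y) = y.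
  by apply: val_inj; exact: jiK.
- move=> P vP x; have [pP Pv] := vP.
  have vP' : lies_over v (fun y => int_map ji y \in P).
    split; first exact: (prime_ideal_preim (int_map ji) pP).
    by move=> a; rewrite -Pv unfold_in; congr (_ \in P); apply: val_inj; exact: jibase.
  have := D _ vP' (int_map j x); rewrite !unfold_in.
  have -> : int_map ji (int_map (gal_act s) (int_map j x)) = int_map (gal_act (r s)) x.
    by apply: val_inj; rewrite /= jir jK.
  have -> // : int_map ji (int_map j x) = x.
  by apply: val_inj; exact: jK.
Qed.

Lemma Sigma_transport : Sigma E' p = Sigma E p.
Proof.
have galE := abelian_galois E abK; have galE' := abelian_galois E' abK'.
apply/seteqP; split; last exact: (Sigma_sub sEE' galE galE').
(* The image of [E] is [E] with the root of unity 1 adjoined. *)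
apply: (Sigma_adjoin_root (iota := iota) sEE' (m := 1) (z := 1)) => //.
- by rewrite dvdn1 neq_ltn prime_gt1 ?orbT.
- by apply/Fadjoin_idP; exact: mem1v.
Qed.

(** The idempotents are products along enumerations of supports, so the supports themselves have to
    be matched, by injectivity of the transport, and not only the factors. *)
Lemma idem_transport : gring_push r (idem_e p_pr E') = idem_e p_pr E.
Proof.
have rM : {morph r : s t / (s * t)%g} := res_morph sEE' gal_transportP.
pose fE v : gring Qp (gal_of E) := 1 - (#|decomp_group E v|%:R)^-1 *: gring_norm Qp (decomp_group E v).
pose fE' v : gring Qp (gal_of E') := 1 - (#|decomp_group E' v|%:R)^-1 *: gring_norm Qp (decomp_group E' v).
have cardD v : #|decomp_group E' v| = #|decomp_group E v|.
  rewrite -(on_card_preimset (f := r)); last exact: onW_bij gal_transport_bij.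
  by apply: eq_card => s; rewrite !inE decomp_transport.
have fEE' v : gring_push r (fE' v) = fE v.
  rewrite raddfB /= gring_push1 // gring_pushZ cardD.
  by rewrite (gring_push_norm _ gal_transport_bij (D' := decomp_group E v)) // => s; exact: decomp_transport.
have r_inj : injective (gring_push r : gring Qp (gal_of E') -> _).
  exact: gring_push_inj (bij_inj gal_transport_bij).
have supp : finite_support 1 (Sigma E' p) fE' = finite_support 1 (Sigma E p) fE.
  rewrite /finite_support Sigma_transport; congr (locked_with _ (fset_set _)).
  apply/seteqP; split=> v /= [Sv fv]; split=> // fv1; apply: fv.
    by apply: r_inj; rewrite fEE' gring_push1.
  by rewrite -fEE' fv1 gring_push1.
rewrite /idem_e -[finite_support _ _ _]/(finite_support 1 (Sigma E' p) fE') supp.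
elim: (finite_support _ _ _) => [|v s IHs]; first by rewrite !big_nil gring_push1.
by rewrite !big_cons gring_pushM // IHs; congr (_ * _); exact: fEE'.
Qed.

Hypotheses (cmE : CM E) (cmE' : CM E').

Lemma transport_to_minus (x : gring Qp (gal_of E')) :
  transport (to_minus (complex_conj E') x : minus E' Qp) = to_minus (complex_conj E) (gring_push r x).
Proof. exact: (minus_push_res sEE' gal_transportP). Qed.

Lemma transport_proj_e (x : gring Zp (gal_of E')) :
  transport (proj_e (to_minus (complex_conj E') x : minus E' Zp)) =
  proj_e (to_minus (complex_conj E) (gring_push r x) : minus E Zp).
Proof.
have rM : {morph r : s t / (s * t)%g} := res_morph sEE' gal_transportP.
rewrite !proj_e_to_minus !to_minusZ [LHS]transport_to_minus gring_pushM // idem_transport.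
by rewrite gring_push_coef.
Qed.

Fact transport_zmod : zmod_morphism (@transport p p_pr F K K' iota E).
Proof.
move=> x y; rewrite -[x](of_minusK) -[y](of_minusK) -(raddfB (@to_minus Qp _ (complex_conj E'))).
by rewrite !transport_to_minus !raddfB.
Qed.

End Transport.

(** * Composition of restrictions, roots of unity, powers of Frobenius *)

Lemma gring_push_comp (R : comNzRingType) (gT hT kT : finGroupType) (f : gT -> hT) (g : hT -> kT)
    (x : gring R gT) : gring_push g (gring_push f x) = gring_push (g \o f) x.
Proof.
apply/ffunP => b; rewrite !ffunE; under eq_bigr do rewrite ffunE.
rewrite (exchange_big_dep (fun a => g (f a) == b)) /=; last by move=> h a /eqP <- /eqP ->.
apply: eq_bigr => a /eqP gfa; rewrite (big_pred1 (f a)) // => h /=.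
by apply/andP/eqP => [[_ /eqP ->]//|->]; rewrite gfa !eqxx.
Qed.

Lemma eq_gring_push (R : comNzRingType) (gT hT : finGroupType) (f g : gT -> hT) (x : gring R gT) :
  f =1 g -> gring_push f x = gring_push g x.
Proof. by move=> fg; apply/ffunP => b; rewrite !ffunE; apply: eq_bigl => a; rewrite fg. Qed.

(** With [r] the residue of [a] modulo [N], [p^N - 1] divides [p^r - 1], which is smaller; so
    [r = 0]. *)
Lemma expn_mod_pred (p N a : nat) : (1 < p)%N -> (0 < N)%N ->
  p ^ a = 1 %[mod (p ^ N).-1] -> (N %| a)%N.
Proof.
move=> p1 N0; have pN1 : (1 < p ^ N)%N by rewrite -(exp1n N) ltn_exp2r.
have pN : p ^ N = 1 %[mod (p ^ N).-1].
  by rewrite -{1}(prednK (ltnW pN1)) -addn1 modnDl.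
have -> : (p ^ a = (p ^ N) ^ (a %/ N) * p ^ (a %% N))%N.
  by rewrite -expnM -expnD mulnC -divn_eq.
rewrite -modnMml -modnXm pN modnXm exp1n modnMml mul1n.
move=> pr; rewrite /dvdn; apply/negPn/negP => r0.
set r := (a %% N)%N in pr r0; have rN : (r < N)%N by rewrite ltn_pmod.
have pr1 : (1 < p ^ r)%N by rewrite -(exp1n r) ltn_exp2r // lt0n.
have prN : (p ^ r < p ^ N)%N by rewrite ltn_exp2l.
have : ((p ^ N).-1 %| (p ^ r).-1)%N.
  by rewrite -[(p ^ r).-1]subn1 -eqn_mod_dvd ?(ltnW pr1) //; apply/eqP.
have pr0 : (0 < (p ^ r).-1)%N by rewrite -ltnS prednK // ltnW.
move/(dvdn_leq pr0); rewrite -ltnS !prednK ?(ltnW pr1) ?(ltnW pN1) //.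
by rewrite leqNgt prN.
Qed.

Section AdjoinRootGalois.
Variables (F : fieldExtType rat) (K K' : splittingFieldType F) (iota : 'AHom(K, K')).
Variables (m : nat) (z : K').
Hypotheses (abK : abelian_ext K) (z_prim : m.-primitive_root z).
Hypothesis genK' : <<(iota @: {:K})%AS; z>>%VS = {:K'}%VS.

Lemma gal_prim_root (E' : {subfield K'}) (s : gal_of E') : exists k, s z = z ^+ k.
Proof.
have szm : s z ^+ m = 1 by rewrite -rmorphXn (prim_expr_order z_prim) rmorph1.
by have [k ->] := prim_rootP z_prim szm; exists k.
Qed.

(** An automorphism is determined by its restriction to [K] and its exponent on [z], and both kinds
    of data commute. *)
Lemma abelian_adjoin_root : abelian_ext K'.
Proof.
rewrite /abelian_ext galois1f /=; apply/centsP => s _ t _.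
have /and3P[_ _ nK] := abelian_galois {:K}%AS abK.
have sKK' : (iota @: {:K} <= {:K'}%AS)%VS by exact: subvf.
have [s0 ss0] := gal_restricts iota nK s; have [t0 tt0] := gal_restricts iota nK t.
have ab0 : (s0 * t0 = t0 * s0)%g by apply: (centsP (abelian_gal {:K}%AS abK)); rewrite finset.in_setT.
apply: (gal_adjoin_ext (E0 := (iota @: {:K})%AS) (z := z)) => //.
  move=> _ /memv_imgP [x xK ->].
  rewrite -(restrictsM sKK' ss0 tt0 xK) -(restrictsM sKK' tt0 ss0 xK).
  by rewrite ab0.
have [k sz] := gal_prim_root s; have [l tz] := gal_prim_root t.
by rewrite !galM ?memvf // sz tz !rmorphXn /= sz tz -!exprM mulnC.
Qed.

End AdjoinRootGalois.

Lemma P_elt_eq1 (p : nat) (p_pr : prime p) (F : fieldExtType rat) (K : splittingFieldType F)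
    (E' E : {subfield K}) : (Sigma E' p `<=` Sigma E p)%classic -> P_elt p_pr E' E = 1.
Proof.
move=> sub; rewrite /P_elt.
have -> : (Sigma E' p `\` Sigma E p)%classic = classical_sets.set0.
  by apply/seteqP; split=> // v [v1 []]; apply: sub.
have fs0 (f : place F -> gring (padic_int p_pr) (gal_of E)) :
    finite_support 1 classical_sets.set0 f = [::].
  by rewrite /finite_support unlock classical_sets.set0I fset_set0.
by rewrite fs0 big_nil.
Qed.

Section FrobeniusPower.
Variables (p : nat) (p_pr : prime p) (F : fieldExtType rat) (K K' : splittingFieldType F).
Variables (iota : 'AHom(K, K')) (E : {subfield K}) (E' : {subfield K'}).
Variables (m : nat) (z : K').
Hypotheses (abK : abelian_ext K) (abK' : abelian_ext K') (pm : ~~ (p %| m)%N) (zm : z ^+ m = 1).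
Hypothesis genE' : <<(iota @: E)%AS; z>>%VS = E'.

(* For every residue degree f above p, t / f is an integer divisible by [E : F]. *)
Let t := ((\dim {:K})`! * (\dim {:F})`!)%N.

(** The point is that [p^t] does not depend on [v]. The exponent is [k = t / f], a multiple of
    [[K:F]!] and so of the order of the Galois group of [E]. *)
Lemma frobenius_power (v : {pred int_ring F}) (s : gal_of E') :
  prime_ideal v -> p%:R \in v -> is_frobenius v s ->
  exists k, {in (iota @: E)%VS, (s ^+ k)%g =1 id} /\ (s ^+ k)%g z = z ^+ (p ^ t).
Proof.
move=> pv vp frs; have [f [/andP[f0 fn] Dq _]] := residue_field p_pr pv vp.
have zE' : z \in E' by rewrite -genE' memv_adjoin.
have sEE' : (iota @: E <= E')%VS by rewrite -genE' subv_adjoin.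
have sz := frobenius_unity_root p_pr abK' pv vp frs pm zE' zm.
have /dvdnP [b Db] : (f %| (\dim {:F})`!)%N by rewrite dvdn_fact // f0.
have /dvdnP [a Da] : (\dim E %| (\dim {:K})`!)%N by rewrite dvdn_fact // adim_gt0 dimvS ?subvf.
exists ((\dim {:K})`! * b)%N; split.
  move=> _ /memv_imgP [x xE ->].
  have /and3P[_ _ nE] := abelian_galois E abK.
  have [s0 ss0] := gal_restricts iota nE s.
  rewrite -(restrictsX sEE' _ ss0 xE) Da -mulnA mulnCA expgM -(card_gal E abK).
  by rewrite expg_cardG ?finset.in_setT // expg1n gal_id.
have sX k : (s ^+ k)%g z = z ^+ (ideal_norm v ^ k).
  elim: k => [|k IHk]; first by rewrite gal_id expr1.
  by rewrite expgSr galM // IHk rmorphXn /= sz -exprM -expnS.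
by rewrite sX Dq -expnM /t Db [(b * f)%N]mulnC mulnCA.
Qed.

End FrobeniusPower.

Lemma frobenius_decomp_mul (p : nat) (F : fieldExtType rat) (K : splittingFieldType F) (E : {subfield K})
    (v : {pred int_ring F}) (h s : gal_of E) :
  h \in decomp_group E (FinPlace v) -> s \in decomp_group E (FinPlace v) -> (h * s)%g \in decomp_group E (FinPlace v).
Proof.
rewrite !inE => /asboolP hD /asboolP sD; apply/asboolP => P vP x.
have -> : int_map (gal_act (h * s)%g) x = int_map (gal_act s) (int_map (gal_act h) x).
  exact: (gal_intM h s x).
by rewrite sD // hD.
Qed.

Section Descent.
Variables (p : nat) (p_pr : prime p) (F : fieldExtType rat) (K : splittingFieldType F).
Hypotheses (F_real : totally_real F) (abK : abelian_ext K).
Local Notation Zp := (padic_int p_pr).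
Local Notation Qp := (padic_num p_pr).
Local Notation tau := (@Zp_to_Qp p p_pr).
Variables (E1 E2 : {subfield K}) (h : gal_of E2).
Hypotheses (s12 : (E1 <= E2)%VS) (cm1 : CM E1) (cm2 : CM E2).
Hypothesis h_fix : {in E1, h =1 id}.
Local Notation c2 := (complex_conj E2).

Let h_restr : gal E1 h = 1%g.
Proof.
apply: restricts_inj (gal_restr abK s12 h) _ => x xE; rewrite !id_lfunE gal_id.
by rewrite h_fix.
Qed.

(** The two products stand for the Euler product and the idempotent; each is traded for a power of
    [1 - h], and semisimplicity reduces the total power to the first. *)
Lemma killed_red_divisible (x : gring Zp (gal_of E2)) (s1 s2 : seq (place F)) (f1 f2 : place F -> gring Qp (gal_of E2)) :
  (forall v, v \in s1 -> tame c2 h (f1 v)) -> (forall v, v \in s2 -> tame c2 h (f2 v)) ->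
  (\prod_(v <- s1) f1 v) *: ((\prod_(v <- s2) f2 v) *: to_minus c2 (gring_coef tau x)) = 0 ->
  exists w : gring Zp (gal_of E1), red E1 (to_minus c2 x : minus E2 Zp) *+ 2 =
    (to_minus (complex_conj E1) w : minus E1 Zp) *+ #[h]%g.
Proof.
move=> t1 t2 kill; have ab2 := abelian_gal E2 abK; have ab1 := abelian_gal E1 abK.
have R0 := Qp_natr_eq0 p_pr.
have [r1 kill1] := tame_prod_kill ab2 t1 kill.
have [|r2 kill2] := tame_prod_kill ab2 t2 (eta := (1 - gelt Qp h) ^+ r1 *: to_minus c2 (gring_coef tau x)).
  by rewrite scalerA (gring_mulC ab2) -scalerA.
rewrite scalerA -exprD in kill2.
have kh := semisimple_kill R0 ab2 kill2.
have cc := complex_conj2 F_real cm2.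
have gM := res_morph (sub_id_embed s12) (gal_restr abK s12).
have gc := res_conj (sub_id_embed s12) (gal_restr abK s12) F_real cm1 cm2.
have [w] := minus_push_divisible (@Zp_to_Qp_inj p p_pr) gM ab2 ab1 cc h_restr kh.
rewrite gc !scaler_nat => Dw; exists w; rewrite red_to_minus //.
Qed.

End Descent.

(** * Descent from cyclotomic extensions *)

Section CyclotomicDescent.
Variables (p : nat) (p_pr : prime p) (F : fieldExtType rat) (K K' : splittingFieldType F) (iota : 'AHom(K, K')).
Hypotheses (F_real : totally_real F) (abK : abelian_ext K) (abK' : abelian_ext K').
Local Notation Zp := (padic_int p_pr).
Local Notation Qp := (padic_num p_pr).
Local Notation tau := (@Zp_to_Qp p p_pr).
Let t := ((\dim {:K})`! * (\dim {:F})`!)%N.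
Variables (n : nat) (z : K').
(* p has order t p^n modulo m. *)
Let m := ((p ^ (t * p ^ n)).-1)%N.
Hypothesis z_prim : m.-primitive_root z.
Hypothesis cmK' : CM ({:K'}%AS : {subfield K'}).
Variable v0 : {pred int_ring F}.
Hypothesis Sv0 : Sigma ({:K'}%AS : {subfield K'}) p (FinPlace v0).
Variables (z' : minus_family p_pr K') (z'_compat : norm_compatible z').
Variable zt : minus ({:K'}%AS : {subfield K'}) Zp.
Hypothesis zt_lift : proj_e zt = z' {:K'}%AS.

Let t_gt0 : (0 < t)%N. Proof. by rewrite muln_gt0 !fact_gt0. Qed.
Let N_gt0 : (0 < t * p ^ n)%N. Proof. by rewrite muln_gt0 t_gt0 expn_gt0 prime_gt0. Qed.

Let pm : ~~ (p %| m)%N.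
Proof. by rewrite -prime_coprime // -(coprime_pexpl _ _ N_gt0) coprimenP // expn_gt0 prime_gt0. Qed.

Let zm : z ^+ m = 1. Proof. exact: prim_expr_order. Qed.

Let m_gt0 : (0 < m)%N. Proof. exact: prim_order_gt0 z_prim. Qed.

Lemma CM_image (E : {subfield K}) : CM E -> CM (iota @: E)%AS.
Proof.
apply: (CM_adjoin_root (iota := iota) (subvv _) (m := 1) (z := 1)) => //.
by apply/Fadjoin_idP; exact: mem1v.
Qed.

Section OneField.
Variables (E : {subfield K}) (cmE : CM E).
Let E1 := (iota @: E)%AS.
Let E2 := <<(iota @: E)%AS; z>>%AS.
Let s12 : (E1 <= E2)%VS. Proof. exact: subv_adjoin. Qed.
Let cm1 : CM E1. Proof. exact: CM_image. Qed.
Let cm2 : CM E2. Proof. by apply: (CM_adjoin_root (iota := iota) (E := E) s12 m_gt0 zm). Qed.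

Lemma red_red (E3 : {subfield K'}) (x : minus E3 Zp) : CM E3 -> (E2 <= E3)%VS ->
  red E1 (red E2 x) = red E1 x.
Proof.
move=> cm3 s23; have [a ->] := to_minus_surj x; have s13 := subv_trans s12 s23.
rewrite (red_to_minus F_real abK' s23 cm2 cm3) (red_to_minus F_real abK' s13 cm1 cm3).
rewrite (red_to_minus F_real abK' s12 cm1 cm2) gring_push_comp; congr to_minus.
apply: eq_gring_push => s; apply: restricts_inj (gal_restr abK' s13 s) => y yE.
have e1 := gal_restr abK' s12 (gal E2 s) yE.
have e2 := gal_restr abK' s23 s (subvP s12 y yE).
by rewrite !id_lfunE in e1 e2 *; rewrite /= e1 e2.
Qed.

(** Without new ramification above [p] the Euler product is empty and compatibility is an
    equality. *)
Lemma norm_compatible_eq (E3 E4 : {subfield K'}) (x : minus E3 Zp) : CM E3 -> CM E4 -> (E4 <= E3)%VS ->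
  (Sigma E3 p `<=` Sigma E4 p)%classic -> proj_e x = z' E3 -> proj_e (red E4 x) = z' E4.
Proof.
move=> cm3 cm4 s43 sub px; have := proj2 z'_compat E3 E4 cm3 cm4 s43 x px.
rewrite (P_elt_eq1 p_pr sub) (_ : gring_coef _ 1 = 1) ?scale1r; last exact: rmorph1.
by move/eqP; rewrite subr_eq0 => /eqP.
Qed.

(** A lift [y] of [z' E2] reduces exactly to [z' E1], so the error at [E1] is the reduction of [d],
    the difference at [E2], which compatibility from [K'] to [E2] controls. The prime [v0] supplies
    a Frobenius from which [h] is formed. *)
Lemma cyclotomic_descent :
  exists w : gring Zp (gal_of E1),
    (proj_e (red E1 zt) - z' E1) *+ 2 = proj_e (to_minus (complex_conj E1) w : minus E1 Zp) *+ (p ^ n).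
Proof.
have [pv0 v0p _] := Sv0.
have sEE2 : (iota @: E <= E2)%VS := s12.
have genE2 : <<(iota @: E)%AS; z>>%VS = E2 by [].
have [k0 [fix0 z0]] := frobenius_power p_pr abK abK' pm zm genE2 pv0 v0p (@frobeniusP _ _ E2 _ p_pr _ abK' pv0 v0p).
set h := (_ ^+ k0)%g in fix0 z0.
(* Every Frobenius above [p] has the same [h] among its powers, since being trivial on [E1] and
   raising [z] to [p^t] determines [h]. *)
have hX v (s : gal_of E2) : prime_ideal v -> p%:R \in v -> is_frobenius v s -> exists k, h = (s ^+ k)%g.
  move=> pv vp frs; have [k [fixk zk]] := frobenius_power p_pr abK abK' pm zm genE2 pv vp frs.
  exists k; apply: (gal_adjoin_ext (E0 := E1) (z := z)) => //; last by rewrite z0 zk.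
  by move=> x xE; rewrite fix0 // fixk.
have zE2 : z \in E2 by exact: memv_adjoin.
(* [h^k] raises [z] to the power [p^(t k)]; taking [k = #[h]], the order of [p] modulo [m] shows
   that [t p^n] divides [t #[h]]. *)
have pn_h : (p ^ n %| #[h]%g)%N.
  have hXz k : (h ^+ k)%g z = z ^+ (p ^ (t * k)).
    elim: k => [|k IHk]; first by rewrite gal_id muln0 expr1.
    by rewrite expgSr galM // IHk rmorphXn /= z0 -exprM -expnD -mulnS.
  have := hXz #[h]%g; rewrite expg_order gal_id => /eqP.
  rewrite -{1}(expr1 z) eq_sym (eq_prim_root_expr z_prim) => /eqP.
  by move/(expn_mod_pred (prime_gt1 p_pr) N_gt0); rewrite dvdn_pmul2l.
have [y Dy] := proj1 z'_compat E2 cm2.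
have s2K : (E2 <= {:K'}%AS)%VS by exact: subvf.
have SE2 : (Sigma E2 p `<=` Sigma E1 p)%classic.
  have sub : (\1%AF @: E1 <= E2)%VS by rewrite lim1g.
  apply: (Sigma_adjoin_root (iota := \1%AF) sub p_pr pm zm); last exact: abelian_galois.
  by rewrite /= lim1g.
have PE := norm_compatible_eq cm2 cm1 s12 SE2 Dy.
pose d : minus E2 Zp := red E2 zt - y.
have redB (E3 E4 : {subfield K'}) : CM E3 -> CM E4 -> (E4 <= E3)%VS -> forall a b : minus E3 Zp,
    red E4 (a - b) = red E4 a - red E4 b.
  by move=> cm3 cm4 s43 a b; exact: (red_zmod F_real abK' s43 cm4 cm3).
have Dd : proj_e (red E1 zt) - z' E1 = proj_e (red E1 d).
  by rewrite -PE -(red_red _ cmK' s2K) (redB _ _ cm2 cm1 s12) raddfB.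
have [x0 Dx0] := to_minus_surj d.
have compat := proj2 z'_compat _ _ cmK' cm2 s2K zt zt_lift.
rewrite -Dy -raddfB -/d Dx0 /= proj_e_to_minus in compat.
rewrite /P_elt rmorph_prod in compat.
have hE1 : {in E1, h =1 id} by move=> x xE; exact: fix0.
have [||w Dw] := killed_red_divisible F_real abK' s12 cm1 cm2 hE1 _ _ compat.
(* Euler factors: infinite places lie in every [Sigma], so only finite ones occur. *)
- move=> v; case: finite_supportP => // X XS _ _ /XS [].
  case: v => [f|v]; first by move=> _ [].
  move=> [pv vp _] _; have fr := @frobeniusP _ _ E2 _ p_pr v abK' pv vp.
  have [k hk] := hX v _ pv vp fr.
  rewrite rmorphB rmorph1 /= gring_coef_elt.
  (* The Euler factor contains the inverse of the Frobenius, which is recovered as a power of that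
     inverse: its order minus one. *)
  apply: (@tame_elt _ _ _ (abelian_gal E2 abK') _ _ (#[(frobenius E2 (FinPlace v))^-1]%g.-1 * k)%N).
  by rewrite expgM -invg_expg invgK.
- move=> v; case: finite_supportP => // X XS _ _ /XS.
  case: v => [f|v] Sv.
    by apply: (tame_conj (Qp_natr_eq0 p_pr) (abelian_gal E2 abK')) => s; exact: decomp_mul_conj.
  have [pv vp _] := Sv; have fr := @frobeniusP _ _ E2 _ p_pr v abK' pv vp.
  have [k hk] := hX v _ pv vp fr.
  have hD : h \in decomp_group E2 (FinPlace v).
    by rewrite hk; apply: (frobenius_decomp p_pr).
  by apply: tame_idem => // s sD; exact: frobenius_decomp_mul.
have /dvdnP [q Dq] := pn_h.
exists (w *+ q); rewrite Dd Dx0 -raddfMn [LHS](congr1 _ Dw) Dq (raddfMn (to_minus _)).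
by rewrite [LHS]raddfMn [in RHS]raddfMn mulrnA.
Qed.
End OneField.
End CyclotomicDescent.

(** * Lifts correct modulo a power of p, and their limit *)

Section Approximation.
Variables (p : nat) (p_pr : prime p) (F : fieldExtType rat) (F_real : totally_real F).
Local Notation Zp := (padic_int p_pr).

(** The two ways from [K'] to [E], through the image of [E] or through [K], restrict automorphisms
    identically. *)
Lemma red_transport (K K' : splittingFieldType F) (iota : 'AHom(K, K')) (abK : abelian_ext K)
    (abK' : abelian_ext K') (cmK : CM ({:K}%AS : {subfield K})) (cmK' : CM ({:K'}%AS : {subfield K'}))
    (E : {subfield K}) (cmE : CM E) (a : gring Zp (gal_of {:K'})) :
  transport (proj_e (red (iota @: E)%AS (to_minus (complex_conj {:K'}%AS) a : minus {:K'}%AS Zp))) =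
  proj_e (red E (to_minus (complex_conj {:K}%AS) (gring_push (@gal_transport F K K' iota {:K}%AS)
    (gring_push (fun s : gal_of {:K'} => gal (iota @: {:K}) s) a)) : minus {:K}%AS Zp)).
Proof.
have sK : (E <= {:K}%AS)%VS by exact: subvf.
have sK' : ((iota @: E)%AS <= {:K'}%AS)%VS by exact: subvf.
have sKK' : ((iota @: {:K})%AS <= {:K'}%AS)%VS by exact: subvf.
have cmE1 := CM_image iota cmE.
rewrite (red_to_minus F_real abK' sK' cmE1 cmK') (red_to_minus F_real abK sK cmE cmK).
rewrite (transport_proj_e F_real abK abK' cmE cmE1) !gring_push_comp; congr (proj_e (to_minus _ _)).
apply: eq_gring_push => s /=.
apply: restricts_inj (gal_transportP abK _) _ => x xE.
have e1 := gal_restr abK' sK' s (memv_img iota xE).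
have e2 := gal_restr abK sK (gal_transport (gal (iota @: {:K}) s)) xE.
have e3 := gal_transportP abK (gal (iota @: {:K}) s) (memvf x).
have e4 := gal_restr abK' sKK' s (memv_img iota (memvf x)).
rewrite !id_lfunE in e1 e2 e4.
by rewrite /= e2 e3 e1 e4.
Qed.

Lemma approximate_lift (K : splittingFieldType F) (abK : abelian_ext K)
    (cmK : CM ({:K}%AS : {subfield K})) (z : minus_family p_pr K) (z_compat : norm_compatible z)
    (z_ext : forall (K' : splittingFieldType F) (iota : 'AHom(K, K')),
       abelian_ext K' -> CM ({:K'}%AS : {subfield K'}) ->
       Sigma ({:K'}%AS : {subfield K'}) p = Sigma ({:K}%AS : {subfield K}) p ->
       extends_to iota z) (n : nat) :
  exists x : gring Zp (gal_of {:K}),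
    proj_e (to_minus (complex_conj {:K}%AS) x : minus {:K}%AS Zp) = z {:K}%AS /\
    forall E : {subfield K}, CM E -> exists w : gring Zp (gal_of E),
      (proj_e (red E (to_minus (complex_conj {:K}%AS) x : minus {:K}%AS Zp)) - z E) *+ 2 =
      proj_e (to_minus (complex_conj E) w : minus E Zp) *+ (p ^ n).
Proof.
(* With no finite place in [Sigma(K)] the Euler products from [K] are empty and any lift of [z_K] is
   exact. *)
have [[v0 Sv0]|noS] := pselect (exists v, Sigma {:K}%AS p (FinPlace v)); last first.
  have [x0 Dx0] := proj1 z_compat _ cmK; have [x Dx] := to_minus_surj x0.
  exists x; split=> [|E cmE]; first by rewrite -Dx.
  exists 0; rewrite -Dx raddf0 raddf0 mul0rn (norm_compatible_eq z_compat cmK cmE (subvf _) _ Dx0).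
    by rewrite subrr mul0rn.
  by move=> [f|v] // Sv; case: noS; exists v.
set t := ((\dim {:K})`! * (\dim {:F})`!)%N.
have t_gt0 : (0 < t)%N by rewrite muln_gt0 !fact_gt0.
have N_gt0 : (0 < t * p ^ n)%N by rewrite muln_gt0 t_gt0 expn_gt0 prime_gt0.
set m := (p ^ (t * p ^ n)).-1.
have m_gt0 : (0 < m)%N by rewrite -ltnS prednK ?expn_gt0 ?prime_gt0 // -{1}(exp1n (t * p ^ n)) ltn_exp2r ?prime_gt1.
have pm : ~~ (p %| m)%N.
  by rewrite -prime_coprime // -(coprime_pexpl _ _ N_gt0) coprimenP // expn_gt0 prime_gt0.
have [K' [iota [zeta [z_prim gen]]]] := cyclotomic_extension K m_gt0.
have zm : zeta ^+ m = 1 := prim_expr_order z_prim.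
have abK' := abelian_adjoin_root abK z_prim gen.
have sKK' : (iota @: {:K} <= {:K'}%AS)%VS by exact: subvf.
have cmK' : CM ({:K'}%AS : {subfield K'}) := CM_adjoin_root sKK' m_gt0 zm gen cmK.
have galK := abelian_galois {:K}%AS abK; have galK' := abelian_galois {:K'}%AS abK'.
have SK : Sigma ({:K'}%AS : {subfield K'}) p = Sigma ({:K}%AS : {subfield K}) p.
  apply/seteqP; split; last exact: (Sigma_sub sKK' galK galK').
  exact: (Sigma_adjoin_root sKK' p_pr pm zm gen).
have [z' [z'_compat z'z]] := z_ext _ iota abK' cmK' SK.
have [zt Dzt] := proj1 z'_compat _ cmK'; have [a Da] := to_minus_surj zt.
have red_tr E cmE := @red_transport K K' iota abK abK' cmK cmK' E cmE a.
set x := gring_push _ (gring_push _ a) in red_tr; rewrite -Da in red_tr.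
exists x; split=> [|E cmE].
  rewrite -z'z //; have cm1 := CM_image iota cmK.
  rewrite -(norm_compatible_eq z'_compat cmK' cm1 sKK' _ Dzt).
    by rewrite Da (red_to_minus F_real abK' sKK' cm1 cmK') (transport_proj_e F_real abK abK' cmK cm1).
  by rewrite (Sigma_transport p_pr iota {:K}%AS abK abK') SK.
have Sv0' : Sigma ({:K'}%AS : {subfield K'}) p (FinPlace v0) by rewrite SK.
have [w Dw] := cyclotomic_descent iota F_real abK abK' z_prim cmK' Sv0' z'_compat Dzt cmE.
have cm1 := CM_image iota cmE.
exists (gring_push (@gal_transport F K K' iota E) w).
rewrite -red_tr // -z'z // -(transport_proj_e F_real abK abK' cmE cm1).
pose trZ : zmod_morphism (@transport p p_pr F K K' iota E) := transport_zmod F_real abK cmE cm1.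
pose HBtr := GRing.isZmodMorphism.Build _ _ _ trZ.
pose tr : {additive _ -> _} := HB.pack (@transport p p_pr F K K' iota E) HBtr.
by rewrite -[transport _]/(tr _) -[transport (z' _)]/(tr _) -raddfB -raddfMn Dw raddfMn.
Qed.
End Approximation.

Lemma proj_e_separated (p : nat) (p_pr : prime p) (F : fieldExtType rat) (F_real : totally_real F)
    (K : splittingFieldType F) (abK : abelian_ext K) (E : {subfield K}) (cmE : CM E)
    (eta : minus E (padic_num p_pr)) :
  (forall k, exists w : gring (padic_int p_pr) (gal_of E),
     eta *+ 2 = proj_e (to_minus (complex_conj E) w : minus E (padic_int p_pr)) *+ (p ^ k)) ->
  eta = 0.
Proof.
move=> H; apply: (minus_separated (abelian_gal E abK) (complex_conj2 F_real cmE) (a := idem_e p_pr E)) => k.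
by have [w Dw] := H k; exists w; rewrite !scaler_nat Dw proj_e_to_minus.
Qed.

Theorem proposition10 (p : nat) (p_pr : prime p)
  (F : fieldExtType rat) (F_real : totally_real F)
  (K : splittingFieldType F) (K_abelian : abelian_ext K)
  (K_CM : CM ({:K}%AS : {subfield K}))
  (z : minus_family p_pr K) (z_compatible : norm_compatible z)
  (z_extends : forall (K' : splittingFieldType F) (iota : 'AHom(K, K')),
     abelian_ext K' -> CM ({:K'}%AS : {subfield K'}) ->
     Sigma ({:K'}%AS : {subfield K'}) p = Sigma ({:K}%AS : {subfield K}) p ->
     extends_to iota z) :
  exists zt : minus ({:K}%AS : {subfield K}) (padic_int p_pr),
    proj_e zt = z {:K}%AS /\
    forall E : {subfield K}, CM E -> proj_e (red E zt) = z E.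
Proof.
have [x xP] := choice (approximate_lift F_real K_abelian K_CM z_compatible z_extends).
have [xK xE] := all_and2 xP.
(* The [x n] need not converge; [y] is a limit point. *)
have [y Dy] := gring_compact x.
exists (to_minus (complex_conj {:K}%AS) y); split=> [|E cmE].
  apply/eqP; rewrite -subr_eq0; apply/eqP; apply: (proj_e_separated F_real K_abelian K_CM) => k.
  (* [x n] is an exact lift at [K], so the error of [y] comes from [p^k u] alone; the 2 matches the
     doubling in [proj_e_separated]. *)
  have [n _ [u Du]] := Dy k; exists (- u *+ 2).
  rewrite -(xK n) -raddfB -(raddfB (to_minus _)) -opprB Du mulr_natl.
  by rewrite -mulNrn !raddfMn mulrnAC.
apply/eqP; rewrite -subr_eq0; apply/eqP; apply: (proj_e_separated F_real K_abelian cmE) => k.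
have [n kn [u Du]] := Dy k; have [w Dw] := xE n E cmE.
have sE : (E <= {:K}%AS)%VS by exact: subvf.
rewrite !(red_to_minus F_real K_abelian sE cmE K_CM) in Dw *.
set f := fun s => _ in Dw *.
(* Two errors: that of [x n] at [E], a multiple of [p^n = p^(n-k) p^k], and the distance [p^k u]
   from [x n] to [y], doubled. *)
exists (w *+ (p ^ (n - k)) - gring_push f u *+ 2).
have Du' : y = x n - u *+ (p ^ k) by rewrite -mulr_natl -Du subKr.
pose g v : minus E _ := proj_e (to_minus (complex_conj E) v : minus E (padic_int p_pr)).
have gB v1 v2 : g (v1 - v2) = g v1 - g v2 by rewrite /g !raddfB.
have gMn v j : g (v *+ j) = g v *+ j by rewrite /g !raddfMn.
rewrite -!/(g _) in Dw *.
rewrite Du' (raddfB (gring_push f)) (raddfMn (gring_push f)) !gB !gMn addrAC mulrnBl Dw mulrnBl.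
by rewrite -!mulrnA -expnD subnK // [(2 * _)%N]mulnC.
Qed.
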